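(* Let $\mathbf S$ be a category with finite products and $\mathscr V$ an $\mathbf S$-indexed monoidal category. The 2-functors $\Theta$ and $\Lambda$ are inverse 2-equivalences between the 2-category $\mathscr V\text{-}\mathcal C\mathrm{AT}_{\mathrm{idx}}$ of indexed $\mathscr V$-categories, indexed $\mathscr V$-functors and indexed $\mathscr V$-natural transformations, and the 2-category $\mathscr V\text{-}\mathcal{FIB}$ of $\mathscr V$-fibrations, indexed $\mathscr V$-functors between them, and all $\mathscr V$-natural transformations between those.
   Context: An $\mathbf S$-indexed monoidal category $\mathscr V$ is a pseudofunctor $\mathbf S^{\mathrm{op}}\to\mathrm{MonCat}$ (strong monoidal functors, monoidal transformations), $X\mapsto(\mathscr V^X,\otimes_X,\mathbb I_X)$, $f\mapsto f^*$. A morphism $M\to N$ ''over'' $f:X\to Y$ ($M\in\mathscr V^X$, $N\in\mathscr V^Y$) means a morphism $M\to f^*N$ in $\mathscr V^X$. For $M\in\mathscr V^{X\times Y}$, $N\in\mathscr V^{Y\times Z}$, $M\otimes_YN\in\mathscr V^{X\times Y\times Z}$ is the $\otimes_{X\times Y\times Z}$-product of the pullbacks of $M,N$ along the projections. $\pi_X$ denotes a projection that projects $X$ away. Indexed $\mathscr V$-categories. An indexed $\mathscr V$-category $\mathscr A$ consists of a $\mathscr V^X$-enriched category $\mathscr A^X$ for each $X\in\mathbf S$; for each $f:X\to Y$ a fully faithful $\mathscr V^X$-enriched functor $f^*:(f^* )_\bullet\mathscr A^Y\to\mathscr A^X$, where $(f^* )_\bullet$ means applying the monoidal functor $f^*:\mathscr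 V^Y\to\mathscr V^X$ to hom-objects; and $\mathscr V^X$-natural isomorphisms $(gf)^*\cong f^*\circ(f^* )_\bullet(g^* )$ and $(1_X)^*\cong 1_{\mathscr A^X}$ satisfying the usual coherence axioms of a pseudofunctor. An indexed $\mathscr V$-functor $F:\mathscr A\to\mathscr B$ consists of $\mathscr V^X$-functors $F^X:\mathscr A^X\to\mathscr B^X$ and isomorphisms $F^X\circ f^*\cong f^*\circ(f^* )_\bullet(F^Y)$, coherent with respect to composition and identities. An indexed $\mathscr V$-natural transformation consists of $\mathscr V^X$-natural transformations $\alpha^X:F^X\to G^X$ compatible with these isomorphisms. Large $\mathscr V$-categories. A large $\mathscr V$-category $\mathscr A$ has a collection of objects, each $x$ with an extent $\epsilon x\in\mathbf S$; hom-objects $\mathscr A(x,y)\in\mathscr V^{\epsilon y\times\epsilon x}$; identities $\mathbb I_{\epsilon x}\to\mathscr A(x,x)$ over the diagonal; compositions $\mathscr A(y,z)\otimes_{\epsilon y}\mathscr A(x,y)\to\mathscr A(x,z)$ over the projection $\epsilon z\times\epsilon y\times\epsilon x\to\epsilon z\times\epsilon x$; associative and unital. A $\mathscr V$-functor $f$ assigns to each $x$ an object $fx$ and a morphism $\epsilon f_x:\epsilon x\to\epsilon(fx)$, with morphisms $\mathscr A(x,y)\to\mathscr B(fx,fy)$ over $\epsilon f_y\times\epsilon f_x$ preserving identities and composition; it is called indexed if every $\epsilon f_x$ is an identity. A $\mathscr V$-natural transformation $f\to g$ consists of morphisms $\mathbb I_{\epsilon x}\to\mathscr B(fx,gx)$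 over $(\epsilon g_x,\epsilon f_x)$ satisfying the usual naturality square. $\mathscr V$-fibrations. For an object $x$ of $\mathscr A$ and $f:Y\to\epsilon x$ in $\mathbf S$, a restriction of $x$ along $f$ is an object $f^*x$ with $\epsilon(f^*x)=Y$ together with morphisms $\mathbb I_Y\to\mathscr A(f^*x,x)$ over $(f,1_Y)$ and $\mathbb I_Y\to\mathscr A(x,f^*x)$ over $(1_Y,f)$ that are mutually inverse under composition (their composites are the identity of $f^*x$ and the pullback along $f$ of the identity of $x$). A $\mathscr V$-fibration is a large $\mathscr V$-category in which all restrictions exist. The 2-functors. For an indexed $\mathscr V$-category $\mathscr A$, $\Theta\mathscr A$ is the large $\mathscr V$-category whose objects of extent $X$ are the objects of $\mathscr A^X$, with $\Theta\mathscr A(x,y)=\mathscr A^{Y\times X}(\pi_X^*x,\pi_Y^*y)$ for $x\in\mathscr A^X$, $y\in\mathscr A^Y$; $\Theta F$ sends $x\in\mathscr A^X$ to $F^Xx$ with identity extent-components, and $\Theta$ is defined in the evident way on homs and transformations. ($\Theta$ takes values in $\mathscr V$-fibrations and indexed $\mathscr V$-functors.) For a $\mathscr V$-fibration $\mathscr B$, $\Lambda\mathscr B$ is the indexed $\mathscr V$-category for which $(\Lambda\mathscr B)^X$ has as objects the objects of $\mathscr B$ of extent $X$, with $(\Lambda\mathscr B)^X(x,y)=\Delta_X^*\mathscr B(x,y)$, and whose reindexing functors $f^*$ send $x$ to a chosen restriction $f^*x$; this extends to a 2-functor on indexed $\mathscr V$-functors and $\mathscr V$-natural transformations. *)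

(* Defs.v *)
(** Indexed V-categories, large V-categories and the cells between them are
    split into raw data (types [...Data]) and predicates [is_...] stating the
    axioms; the bundled types pair the two. *)

Set Implicit Arguments.
Unset Strict Implicit.
Unset Printing Implicit Defensive.

Reserved Notation "a ~> b" (at level 70, no associativity).
Reserved Notation "g ∘ f" (at level 40, left associativity).
Reserved Notation "a ⊗ b" (at level 37, left associativity).
Reserved Notation "u ⊗₁ v" (at level 37, left associativity).
Reserved Notation "f ^* M" (at level 30, right associativity).
Reserved Notation "f ^*₁ u" (at level 30, right associativity).
Reserved Notation "⟨ f , g ⟩" (at level 0, format "⟨ f ,  g ⟩").

Record Cat := {
  obj :> Type;
  hom : obj -> obj -> Type;
  idm : forall a, hom a a;
  cmp : forall a b c, hom b c -> hom a b -> hom a c;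
  cmp_idl : forall a b (f : hom a b), cmp (idm b) f = f;
  cmp_idr : forall a b (f : hom a b), cmp f (idm a) = f;
  cmp_assoc : forall a b c d (h : hom c d) (g : hom b c) (f : hom a b),
    cmp (cmp h g) f = cmp h (cmp g f)
}.
Arguments idm {_} a.
Notation "a ~> b" := (hom a b).
Notation "g ∘ f" := (cmp g f).

Record Iso (C : Cat) (a b : C) := {
  fwd : a ~> b;
  bwd : b ~> a;
  fwd_bwd : fwd ∘ bwd = idm b;
  bwd_fwd : bwd ∘ fwd = idm a
}.

Record FinProdCat := {
  fpcat :> Cat;
  one : fpcat;
  bang : forall X, X ~> one;
  bang_uniq : forall X (f : X ~> one), f = bang X;
  prd : fpcat -> fpcat -> fpcat;
  pr1 : forall X Y, prd X Y ~> X;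
  pr2 : forall X Y, prd X Y ~> Y;
  pair : forall W X Y, W ~> X -> W ~> Y -> W ~> prd X Y;
  pr1_pair : forall W X Y (f : W ~> X) (g : W ~> Y), pr1 X Y ∘ pair f g = f;
  pr2_pair : forall W X Y (f : W ~> X) (g : W ~> Y), pr2 X Y ∘ pair f g = g;
  pair_uniq : forall W X Y (h : W ~> prd X Y),
    h = pair (pr1 X Y ∘ h) (pr2 X Y ∘ h)
}.
Arguments pr1 {_} X Y.
Arguments pr2 {_} X Y.
Notation "⟨ f , g ⟩" := (pair f g).

Record MonCat := {
  mcat :> Cat;
  tob : mcat -> mcat -> mcat;
  tmor : forall a a' b b' : mcat,
    a ~> a' -> b ~> b' -> tob a b ~> tob a' b';
  tunit : mcat;
  tmor_id : forall a b, tmor (idm a) (idm b) = idm (tob a b);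
  tmor_cmp : forall (a a' a'' b b' b'' : mcat)
      (u' : a' ~> a'') (u : a ~> a') (v' : b' ~> b'') (v : b ~> b'),
    tmor (u' ∘ u) (v' ∘ v) = tmor u' v' ∘ tmor u v;
  tassoc : forall a b c, Iso (tob (tob a b) c) (tob a (tob b c));
  tlunit : forall a, Iso (tob tunit a) a;
  trunit : forall a, Iso (tob a tunit) a;
  tassoc_nat : forall (a a' b b' c c' : mcat)
      (u : a ~> a') (v : b ~> b') (w : c ~> c'),
    fwd (tassoc a' b' c') ∘ tmor (tmor u v) w
    = tmor u (tmor v w) ∘ fwd (tassoc a b c);
  tlunit_nat : forall (a a' : mcat) (u : a ~> a'),
    fwd (tlunit a') ∘ tmor (idm tunit) u = u ∘ fwd (tlunit a);
  trunit_nat : forall (a a' : mcat) (u : a ~> a'),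
    fwd (trunit a') ∘ tmor u (idm tunit) = u ∘ fwd (trunit a);
  pentagon : forall a b c d,
    fwd (tassoc a b (tob c d)) ∘ fwd (tassoc (tob a b) c d)
    = tmor (idm a) (fwd (tassoc b c d)) ∘ fwd (tassoc a (tob b c) d)
      ∘ tmor (fwd (tassoc a b c)) (idm d);
  triangle : forall a b,
    tmor (idm a) (fwd (tlunit b)) ∘ fwd (tassoc a tunit b)
    = tmor (fwd (trunit a)) (idm b)
}.
Arguments tunit {_}.
Notation "a ⊗ b" := (tob a b).
Notation "u ⊗₁ v" := (tmor u v).

Record StrongMon (C D : MonCat) := {
  sob :> C -> D;
  smor : forall a b : C, a ~> b -> sob a ~> sob b;
  smor_id : forall a, smor (idm a) = idm (sob a);
  smor_cmp : forall (a b c : C) (v : b ~> c) (u : a ~> b),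
    smor (v ∘ u) = smor v ∘ smor u;
  smul : forall a b, Iso (sob a ⊗ sob b) (sob (a ⊗ b));
  sunit : Iso tunit (sob tunit);
  smul_nat : forall (a a' b b' : C) (u : a ~> a') (v : b ~> b'),
    fwd (smul a' b') ∘ (smor u ⊗₁ smor v) = smor (u ⊗₁ v) ∘ fwd (smul a b);
  smul_assoc : forall a b c,
    smor (fwd (tassoc a b c)) ∘ fwd (smul (a ⊗ b) c)
      ∘ (fwd (smul a b) ⊗₁ idm (sob c))
    = fwd (smul a (b ⊗ c)) ∘ (idm (sob a) ⊗₁ fwd (smul b c))
      ∘ fwd (tassoc (sob a) (sob b) (sob c));
  smul_lunit : forall a,
    smor (fwd (tlunit a)) ∘ fwd (smul tunit a) ∘ (fwd sunit ⊗₁ idm (sob a))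
    = fwd (tlunit (sob a));
  smul_runit : forall a,
    smor (fwd (trunit a)) ∘ fwd (smul a tunit) ∘ (idm (sob a) ⊗₁ fwd sunit)
    = fwd (trunit (sob a))
}.

Record IMCData (S : Cat) := {
  fib :> S -> MonCat;
  pb : forall X Y : S, X ~> Y -> StrongMon (fib Y) (fib X);
  pbcmp : forall (X Y Z : S) (f : X ~> Y) (g : Y ~> Z) (M : fib Z),
    Iso (pb (g ∘ f) M) (pb f (pb g M));
  pbid : forall (X : S) (M : fib X), Iso M (pb (idm X) M)
}.
Arguments pb {S} _ {X Y} _.
Arguments pbcmp {S} _ {X Y Z} f g M.
Arguments pbid {S} _ {X} M.
Notation "f ^* M" := (sob (pb _ f) M).
Notation "f ^*₁ u" := (smor (pb _ f) u).

(** The comparison isomorphisms at a morphism [h] only propositionally equal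
    to [g ∘ f], respectively to an identity. *)
Definition pbcmpE (S : Cat) (V : IMCData S) (X Y Z : S)
    (f : X ~> Y) (g : Y ~> Z) (h : X ~> Z) (e : g ∘ f = h) (M : V Z) :
    Iso (h ^* M) (f ^* (g ^* M)) :=
  match e in _ = k return Iso (k ^* M) (f ^* (g ^* M)) with
  | eq_refl => pbcmp V f g M
  end.

Definition pbidE (S : Cat) (V : IMCData S) (X : S)
    (h : X ~> X) (e : idm X = h) (M : V X) : Iso M (h ^* M) :=
  match e in _ = k return Iso M (k ^* M) with
  | eq_refl => pbid V M
  end.

Record is_IMC (S : Cat) (V : IMCData S) : Prop := {
  pbcmp_nat : forall (X Y Z : S) (f : X ~> Y) (g : Y ~> Z)
      (M N : V Z) (u : M ~> N),
    fwd (pbcmp V f g N) ∘ (g ∘ f) ^*₁ u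
    = f ^*₁ (g ^*₁ u) ∘ fwd (pbcmp V f g M);
  pbid_nat : forall (X : S) (M N : V X) (u : M ~> N),
    fwd (pbid V N) ∘ u = idm X ^*₁ u ∘ fwd (pbid V M);
  pbcmp_tensor : forall (X Y Z : S) (f : X ~> Y) (g : Y ~> Z) (M N : V Z),
    fwd (pbcmp V f g (M ⊗ N)) ∘ fwd (smul (pb V (g ∘ f)) M N)
    = f ^*₁ fwd (smul (pb V g) M N) ∘ fwd (smul (pb V f) (g ^* M) (g ^* N))
      ∘ (fwd (pbcmp V f g M) ⊗₁ fwd (pbcmp V f g N));
  pbcmp_unit : forall (X Y Z : S) (f : X ~> Y) (g : Y ~> Z),
    fwd (pbcmp V f g tunit) ∘ fwd (sunit (pb V (g ∘ f)))
    = f ^*₁ fwd (sunit (pb V g)) ∘ fwd (sunit (pb V f));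
  pbid_tensor : forall (X : S) (M N : V X),
    fwd (pbid V (M ⊗ N))
    = fwd (smul (pb V (idm X)) M N) ∘ (fwd (pbid V M) ⊗₁ fwd (pbid V N));
  pbid_unit : forall X : S,
    fwd (pbid V tunit) = fwd (sunit (pb V (idm X)));
  pbcmp_assoc : forall (X Y Z W : S)
      (f : X ~> Y) (g : Y ~> Z) (h : Z ~> W) (M : V W),
    f ^*₁ fwd (pbcmp V g h M) ∘ fwd (pbcmp V f (h ∘ g) M)
    = fwd (pbcmp V f g (h ^* M))
      ∘ fwd (pbcmpE (eq_sym (cmp_assoc h g f)) M);
  pbcmp_idl : forall (X Y : S) (f : X ~> Y) (M : V Y),
    fwd (pbcmpE (cmp_idl f) M) = f ^*₁ fwd (pbid V M);
  pbcmp_idr : forall (X Y : S) (f : X ~> Y) (M : V Y),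
    fwd (pbcmpE (cmp_idr f) M) = fwd (pbid V (f ^* M))
}.

Record IndexedMonCat (S : Cat) := {
  imc_data :> IMCData S;
  imc_ax : is_IMC imc_data
}.

Record ECatData (M : MonCat) := {
  eob :> Type;
  ehom : eob -> eob -> M;
  eid : forall x, tunit ~> ehom x x;
  ecmp : forall x y z, ehom y z ⊗ ehom x y ~> ehom x z
}.
Arguments eid {M e} x.
Arguments ecmp {M e} x y z.

Record is_ECat (M : MonCat) (C : ECatData M) : Prop := {
  ecmp_assoc : forall x y z w : C,
    ecmp x y w ∘ (ecmp y z w ⊗₁ idm (ehom x y))
    = ecmp x z w ∘ (idm (ehom z w) ⊗₁ ecmp x y z)
      ∘ fwd (tassoc (ehom z w) (ehom y z) (ehom x y));
  ecmp_idl : forall x y : C,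
    ecmp x y y ∘ (eid y ⊗₁ idm (ehom x y)) = fwd (tlunit (ehom x y));
  ecmp_idr : forall x y : C,
    ecmp x x y ∘ (idm (ehom x y) ⊗₁ eid x) = fwd (trunit (ehom x y))
}.

Record EFunData (M : MonCat) (C D : ECatData M) := {
  efo :> C -> D;
  efh : forall x y, ehom x y ~> ehom (efo x) (efo y)
}.
Arguments efh {M C D} e x y.

Record is_EFun (M : MonCat) (C D : ECatData M) (F : EFunData C D) : Prop := {
  efh_id : forall x, efh F x x ∘ eid x = eid (F x);
  efh_cmp : forall x y z,
    efh F x z ∘ ecmp x y z
    = ecmp (F x) (F y) (F z) ∘ (efh F y z ⊗₁ efh F x y)
}.

Definition efun_cmp (M : MonCat) (C D E : ECatData M)
    (G : EFunData D E) (F : EFunData C D) : EFunData C E :=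
  {| efo := fun x => G (F x);
     efh := fun x y => efh G (F x) (F y) ∘ efh F x y |}.

(** [elt x y] is the hom-set of the underlying ordinary category. *)
Definition elt (M : MonCat) (C : ECatData M) (x y : C) : Type :=
  tunit ~> ehom x y.

Definition epost (M : MonCat) (C : ECatData M) (x y z : C) (v : elt y z) :
    ehom x y ~> ehom x z :=
  ecmp x y z ∘ (v ⊗₁ idm (ehom x y)) ∘ bwd (tlunit (ehom x y)).

Definition epre (M : MonCat) (C : ECatData M) (x y z : C) (u : elt x y) :
    ehom y z ~> ehom x z :=
  ecmp x y z ∘ (idm (ehom y z) ⊗₁ u) ∘ bwd (trunit (ehom y z)).

Arguments epost {M C x y z} v.
Arguments epre {M C x y z} u.

Definition ecomp (M : MonCat) (C : ECatData M) (x y z : C)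
    (v : elt y z) (u : elt x y) : elt x z := epost v ∘ u.

Definition eapp (M : MonCat) (C D : ECatData M) (F : EFunData C D) (x y : C)
    (u : elt x y) : elt (F x) (F y) := efh F x y ∘ u.

Definition einverse (M : MonCat) (C : ECatData M) (x y : C)
    (u : elt x y) (v : elt y x) : Prop :=
  ecomp v u = eid x /\ ecomp u v = eid y.

Definition is_ENat (M : MonCat) (C D : ECatData M) (F G : EFunData C D)
    (t : forall x, elt (F x) (G x)) : Prop :=
  forall x y, epost (t y) ∘ efh F x y = epre (t x) ∘ efh G x y.

Definition chbase (M N : MonCat) (P : StrongMon M N) (C : ECatData M) :
    ECatData N :=
  {| eob := C;
     ehom := fun x y => P (ehom x y);
     eid := fun x => smor P (eid x) ∘ fwd (sunit P);
     ecmp := fun x y z =>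
       smor P (ecmp x y z) ∘ fwd (smul P (ehom y z) (ehom x y)) |}.

Definition chbase_fun (M N : MonCat) (P : StrongMon M N) (C D : ECatData M)
    (F : EFunData C D) : EFunData (chbase P C) (chbase P D) :=
  {| efo := F : chbase P C -> chbase P D;
     efh := fun x y => smor P (efh F x y) |}.

Section Indexed.
Variables (S : FinProdCat) (V : IMCData S).

Definition chbase_pbcmp (X Y Z : S) (f : X ~> Y) (g : Y ~> Z)
    (C : ECatData (V Z)) :
    EFunData (chbase (pb V (g ∘ f)) C) (chbase (pb V f) (chbase (pb V g) C)) :=
  Build_EFunData (C := chbase (pb V (g ∘ f)) C)
    (D := chbase (pb V f) (chbase (pb V g) C)) (efo := fun x => x)
    (fun x y => fwd (pbcmp V f g (@ehom _ C x y))).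

Definition chbase_pbid (X : S) (C : ECatData (V X)) :
    EFunData C (chbase (pb V (idm X)) C) :=
  Build_EFunData (C := C) (D := chbase (pb V (idm X)) C) (efo := fun x => x)
    (fun x y => fwd (pbid V (@ehom _ C x y))).

(** [ic_ffinv] is the inverse of the action of [ic_re f] on hom-objects;
    [ic_cmp] and [ic_id] are the components of the pseudofunctoriality
    isomorphisms, and [ic_cmpV], [ic_idV] those of their inverses. *)
Record ICatData := {
  ic :> forall X : S, ECatData (V X);
  ic_re : forall (X Y : S) (f : X ~> Y), EFunData (chbase (pb V f) (ic Y)) (ic X);
  ic_ffinv : forall (X Y : S) (f : X ~> Y) (x y : ic Y),
    ehom (ic_re f x) (ic_re f y) ~> f ^* ehom x y;
  ic_cmp : forall (X Y Z : S) (f : X ~> Y) (g : Y ~> Z) (x : ic Z),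
    elt (ic_re (g ∘ f) x) (ic_re f (ic_re g x));
  ic_cmpV : forall (X Y Z : S) (f : X ~> Y) (g : Y ~> Z) (x : ic Z),
    elt (ic_re f (ic_re g x)) (ic_re (g ∘ f) x);
  ic_id : forall (X : S) (x : ic X), elt x (ic_re (idm X) x);
  ic_idV : forall (X : S) (x : ic X), elt (ic_re (idm X) x) x
}.
Arguments ic_re i {X Y} f.
Arguments ic_ffinv i {X Y} f x y.
Arguments ic_cmp i {X Y Z} f g x.
Arguments ic_cmpV i {X Y Z} f g x.
Arguments ic_id i {X} x.
Arguments ic_idV i {X} x.

Section ICatOps.
Variable A : ICatData.

Definition ic_cmpE (X Y Z : S) (f : X ~> Y) (g : Y ~> Z) (h : X ~> Z)
    (e : g ∘ f = h) (x : A Z) :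
    elt (ic_re A h x) (ic_re A f (ic_re A g x)) :=
  match e in _ = k return elt (ic_re A k x) (ic_re A f (ic_re A g x)) with
  | eq_refl => ic_cmp A f g x
  end.

Definition ic_cmpVE (X Y Z : S) (f : X ~> Y) (g : Y ~> Z) (h : X ~> Z)
    (e : g ∘ f = h) (x : A Z) :
    elt (ic_re A f (ic_re A g x)) (ic_re A h x) :=
  match e in _ = k return elt (ic_re A f (ic_re A g x)) (ic_re A k x) with
  | eq_refl => ic_cmpV A f g x
  end.

Definition ic_app (X Y : S) (f : X ~> Y) (x y : A Y) (u : elt x y) :
    elt (ic_re A f x) (ic_re A f y) :=
  efh (ic_re A f) x y ∘ f ^*₁ u ∘ fwd (sunit (pb V f)).

End ICatOps.

Record is_ICat (A : ICatData) : Prop := {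
  ic_ecat : forall X, is_ECat (A X);
  ic_efun : forall (X Y : S) (f : X ~> Y), is_EFun (ic_re A f);
  ic_ff1 : forall (X Y : S) (f : X ~> Y) (x y : A Y),
    ic_ffinv A f x y ∘ efh (ic_re A f) x y = idm _;
  ic_ff2 : forall (X Y : S) (f : X ~> Y) (x y : A Y),
    efh (ic_re A f) x y ∘ ic_ffinv A f x y = idm _;
  ic_cmp_nat : forall (X Y Z : S) (f : X ~> Y) (g : Y ~> Z),
    is_ENat (F := ic_re A (g ∘ f))
      (G := efun_cmp (efun_cmp (ic_re A f) (chbase_fun (pb V f) (ic_re A g)))
                     (chbase_pbcmp f g (A Z)))
      (ic_cmp A f g);
  ic_cmp_inv : forall (X Y Z : S) (f : X ~> Y) (g : Y ~> Z) (x : A Z),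
    einverse (ic_cmp A f g x) (ic_cmpV A f g x);
  ic_id_nat : forall X : S,
    is_ENat (F := {| efo := fun x : A X => x; efh := fun x y => idm (ehom x y) |})
      (G := efun_cmp (ic_re A (idm X)) (chbase_pbid (A X)))
      (@ic_id A X);
  ic_id_inv : forall (X : S) (x : A X), einverse (ic_id A x) (ic_idV A x);
  ic_cmp_assoc : forall (X Y Z W : S)
      (f : X ~> Y) (g : Y ~> Z) (h : Z ~> W) (x : A W),
    ecomp (ic_app f (ic_cmp A g h x)) (ic_cmp A f (h ∘ g) x)
    = ecomp (ic_cmp A f g (ic_re A h x))
            (ic_cmpE (eq_sym (cmp_assoc h g f)) x);
  ic_cmp_idl : forall (X Y : S) (f : X ~> Y) (x : A Y),
    ic_cmpE (cmp_idl f) x = ic_app f (ic_id A x);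
  ic_cmp_idr : forall (X Y : S) (f : X ~> Y) (x : A Y),
    ic_cmpE (cmp_idr f) x = ic_id A (ic_re A f x)
}.

Record ICat := { icat_data :> ICatData; icat_ax : is_ICat icat_data }.

(** [if_re f x : F (f^* x) -> f^* (F x)] has inverse [if_reV f x]. *)
Record IFunData (A B : ICatData) := {
  ifn :> forall X : S, EFunData (A X) (B X);
  if_re : forall (X Y : S) (f : X ~> Y) (x : A Y),
    elt (ifn X (ic_re A f x)) (ic_re B f (ifn Y x));
  if_reV : forall (X Y : S) (f : X ~> Y) (x : A Y),
    elt (ic_re B f (ifn Y x)) (ifn X (ic_re A f x))
}.
Arguments if_re {A B} i {X Y} f x.
Arguments if_reV {A B} i {X Y} f x.

Record is_IFun (A B : ICatData) (F : IFunData A B) : Prop := {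
  if_efun : forall X, is_EFun (F X);
  if_re_nat : forall (X Y : S) (f : X ~> Y),
    is_ENat (F := efun_cmp (F X) (ic_re A f))
      (G := efun_cmp (ic_re B f) (chbase_fun (pb V f) (F Y)))
      (if_re F f);
  if_re_inv : forall (X Y : S) (f : X ~> Y) (x : A Y),
    einverse (if_re F f x) (if_reV F f x);
  if_re_cmp : forall (X Y Z : S) (f : X ~> Y) (g : Y ~> Z) (x : A Z),
    ecomp (ic_cmp B f g (F Z x)) (if_re F (g ∘ f) x)
    = ecomp (ic_app f (if_re F g x))
        (ecomp (if_re F f (ic_re A g x)) (eapp (F X) (ic_cmp A f g x)));
  if_re_id : forall (X : S) (x : A X),
    ecomp (if_re F (idm X) x) (eapp (F X) (ic_id A x)) = ic_id B (F X x)
}.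

Record IFun (A B : ICatData) := {
  ifun_data :> IFunData A B;
  ifun_ax : is_IFun ifun_data
}.

Definition INatData (A B : ICatData) (F G : IFunData A B) : Type :=
  forall (X : S) (x : A X), elt (F X x) (G X x).

Record is_INat (A B : ICatData) (F G : IFunData A B) (t : INatData F G) :
    Prop := {
  in_nat : forall X, is_ENat (@t X);
  in_re : forall (X Y : S) (f : X ~> Y) (x : A Y),
    ecomp (if_re G f x) (t X (ic_re A f x))
    = ecomp (ic_app f (t Y x)) (if_re F f x)
}.

Record INat (A B : ICatData) (F G : IFunData A B) := {
  inat_data :> INatData F G;
  inat_ax : is_INat inat_data
}.

Definition ifun_id (A : ICatData) : IFunData A A :=
  {| ifn := fun X => {| efo := fun x : A X => x;
                        efh := fun x y => idm (ehom x y) |};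
     if_re := fun X Y f x => eid (ic_re A f x);
     if_reV := fun X Y f x => eid (ic_re A f x) |}.

Definition ifun_cmp (A B C : ICatData) (G : IFunData B C) (F : IFunData A B) :
    IFunData A C :=
  {| ifn := fun X => efun_cmp (G X) (F X);
     if_re := fun X Y f x =>
       ecomp (if_re G f (F Y x)) (eapp (G X) (if_re F f x));
     if_reV := fun X Y f x =>
       ecomp (eapp (G X) (if_reV F f x)) (if_reV G f (F Y x)) |}.

Definition inat_id (A B : ICatData) (F : IFunData A B) : INatData F F :=
  fun X x => eid (F X x).

Definition inat_vcmp (A B : ICatData) (F G H : IFunData A B)
    (b : INatData G H) (a : INatData F G) : INatData F H :=
  fun X x => ecomp (b X x) (a X x).

Definition inat_hcmp (A B C : ICatData) (F F' : IFunData A B)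
    (G G' : IFunData B C) (b : INatData G G') (a : INatData F F') :
    INatData (ifun_cmp G F) (ifun_cmp G' F') :=
  fun X x => ecomp (b X (F' X x)) (eapp (G X) (a X x)).

Definition pmap (X X' Y Y' : S) (f : X ~> X') (g : Y ~> Y') :
    prd X Y ~> prd X' Y' := ⟨f ∘ pr1 X Y, g ∘ pr2 X Y⟩.

Definition tr1 (Z Y X : S) : prd (prd Z Y) X ~> Z := pr1 Z Y ∘ pr1 (prd Z Y) X.
Definition tr2 (Z Y X : S) : prd (prd Z Y) X ~> Y := pr2 Z Y ∘ pr1 (prd Z Y) X.
Definition tr3 (Z Y X : S) : prd (prd Z Y) X ~> X := pr2 (prd Z Y) X.

(** The collection of objects together with its extents is given as the family
    [lob] of the objects of each extent.  The domain of [lc_cmp] is the tensor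
    product over [Y] of [lhom y z] and [lhom x y], the projections of the
    triple product to binary ones being written as pairings. *)
Record LCatData := {
  lob : S -> Type;
  lhom : forall X Y, lob X -> lob Y -> V (prd Y X);
  lc_id : forall X (x : lob X), tunit ~> ⟨idm X, idm X⟩ ^* lhom x x;
  lc_cmp : forall X Y Z (x : lob X) (y : lob Y) (z : lob Z),
    ⟨tr1 Z Y X, tr2 Z Y X⟩ ^* lhom y z ⊗ ⟨tr2 Z Y X, tr3 Z Y X⟩ ^* lhom x y
    ~> ⟨tr1 Z Y X, tr3 Z Y X⟩ ^* lhom x z
}.
Arguments lhom {l X Y} x y.
Arguments lc_id {l X} x.
Arguments lc_cmp {l X Y Z} x y z.

Lemma pair_cmp (W' W X Y : S) (t : W' ~> W) (f : W ~> X) (g : W ~> Y)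
    (f' : W' ~> X) (g' : W' ~> Y) :
  f ∘ t = f' -> g ∘ t = g' -> ⟨f, g⟩ ∘ t = ⟨f', g'⟩.
Proof.
intros e1 e2. rewrite (pair_uniq (⟨f, g⟩ ∘ t)).
now rewrite <- !cmp_assoc, pr1_pair, pr2_pair, e1, e2.
Qed.

Lemma pmap_pair (W X X' Y Y' : S) (f : X ~> X') (g : Y ~> Y')
    (h : W ~> X) (k : W ~> Y) (h' : W ~> X') (k' : W ~> Y') :
  f ∘ h = h' -> g ∘ k = k' -> pmap f g ∘ ⟨h, k⟩ = ⟨h', k'⟩.
Proof.
intros e1 e2. apply pair_cmp.
- now rewrite cmp_assoc, pr1_pair.
- now rewrite cmp_assoc, pr2_pair.
Qed.

Lemma pmap_id (X Y : S) : idm (prd X Y) = pmap (idm X) (idm Y).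
Proof.
unfold pmap. rewrite (pair_uniq (idm (prd X Y))).
now rewrite !cmp_idl, !cmp_idr.
Qed.

Lemma pmap_idcmp (X Y : S) :
  pmap (idm X) (idm Y) ∘ pmap (idm X) (idm Y) = pmap (idm X) (idm Y).
Proof. now rewrite <- pmap_id, cmp_idl. Qed.

Lemma tr1_pair (W X Y Z : S) (c : W ~> Z) (b : W ~> Y) (a : W ~> X) :
  tr1 Z Y X ∘ ⟨⟨c, b⟩, a⟩ = c.
Proof. unfold tr1. now rewrite cmp_assoc, !pr1_pair. Qed.

Lemma tr2_pair (W X Y Z : S) (c : W ~> Z) (b : W ~> Y) (a : W ~> X) :
  tr2 Z Y X ∘ ⟨⟨c, b⟩, a⟩ = b.
Proof. unfold tr2. now rewrite cmp_assoc, pr1_pair, pr2_pair. Qed.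

Lemma tr3_pair (W X Y Z : S) (c : W ~> Z) (b : W ~> Y) (a : W ~> X) :
  tr3 Z Y X ∘ ⟨⟨c, b⟩, a⟩ = a.
Proof. apply pr2_pair. Qed.

(** For [u : M -> h^* N] over [h] and [t] into its domain, the pullback
    [t^* M -> (h ∘ t)^* N]; [pull_unit] is the case where [M] is the unit. *)
Definition pull (W' W X : S) (t : W' ~> W) (h : W ~> X) (k : W' ~> X)
    (e : h ∘ t = k) (M : V W) (N : V X) (u : M ~> h ^* N) :
    t ^* M ~> k ^* N :=
  bwd (pbcmpE e N) ∘ t ^*₁ u.

Definition pull_unit (W' W X : S) (t : W' ~> W) (h : W ~> X) (k : W' ~> X)
    (e : h ∘ t = k) (N : V X) (u : tunit ~> h ^* N) : tunit ~> k ^* N :=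
  pull e u ∘ fwd (sunit (pb V t)).

Section LCatOps.
Variable B : LCatData.

(** The object [⟨b, a⟩^* B(x, y)] of [V^W], for [a : W -> X] and
    [b : W -> Y]. *)
Definition ghom (W X Y : S) (b : W ~> Y) (a : W ~> X)
    (x : lob B X) (y : lob B Y) : V W := ⟨b, a⟩ ^* lhom x y.

(** The identity of [x] pulled back along [a], and the composition morphism
    pulled back along [⟨⟨c, b⟩, a⟩]. *)
Definition gid (W X : S) (a : W ~> X) (x : lob B X) : tunit ~> ghom a a x x :=
  pull_unit (pair_cmp (cmp_idl a) (cmp_idl a)) (lc_id x).

Definition gcmp (W X Y Z : S) (c : W ~> Z) (b : W ~> Y) (a : W ~> X)
    (x : lob B X) (y : lob B Y) (z : lob B Z) :
    ghom c b y z ⊗ ghom b a x y ~> ghom c a x z :=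
  pull (pair_cmp (tr1_pair c b a) (tr3_pair c b a)) (lc_cmp x y z)
  ∘ fwd (smul (pb V ⟨⟨c, b⟩, a⟩) _ _)
  ∘ (fwd (pbcmpE (pair_cmp (tr1_pair c b a) (tr2_pair c b a)) (lhom y z))
     ⊗₁ fwd (pbcmpE (pair_cmp (tr2_pair c b a) (tr3_pair c b a)) (lhom x y))).

Definition gpost (W X Y Z : S) (c : W ~> Z) (b : W ~> Y) (a : W ~> X)
    (x : lob B X) (y : lob B Y) (z : lob B Z)
    (v : tunit ~> ghom c b y z) : ghom b a x y ~> ghom c a x z :=
  gcmp c b a x y z ∘ (v ⊗₁ idm _) ∘ bwd (tlunit _).

Definition gpre (W X Y Z : S) (c : W ~> Z) (b : W ~> Y) (a : W ~> X)
    (x : lob B X) (y : lob B Y) (z : lob B Z)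
    (u : tunit ~> ghom b a x y) : ghom c b y z ~> ghom c a x z :=
  gcmp c b a x y z ∘ (idm _ ⊗₁ u) ∘ bwd (trunit _).

Definition gcomp (W X Y Z : S) (c : W ~> Z) (b : W ~> Y) (a : W ~> X)
    (x : lob B X) (y : lob B Y) (z : lob B Z)
    (v : tunit ~> ghom c b y z) (u : tunit ~> ghom b a x y) :
    tunit ~> ghom c a x z := gpost a x v ∘ u.

End LCatOps.
Arguments ghom {B W X Y} b a x y.
Arguments gid {B W X} a x.
Arguments gcmp {B W X Y Z} c b a x y z.
Arguments gpost {B W X Y Z c b} a {x y z} v.
Arguments gpre {B W X Y Z} c {b a x y z} u.
Arguments gcomp {B W X Y Z c b a x y z} v u.

(** Associativity is an equation in [V^W] for [W := ((W' × Z) × Y) × X], where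
    [d], [c], [b], [a] are the projections; the unit laws are equations over
    [Y × X]. *)
Record is_LCat (B : LCatData) : Prop := {
  lc_assoc : forall (X Y Z W' : S)
      (x : lob B X) (y : lob B Y) (z : lob B Z) (w : lob B W'),
    let p := pr1 (prd (prd W' Z) Y) X in
    let d := tr1 W' Z Y ∘ p in
    let c := tr2 W' Z Y ∘ p in
    let b := tr3 W' Z Y ∘ p in
    let a := pr2 (prd (prd W' Z) Y) X in
    gcmp d b a x y w ∘ (gcmp d c b y z w ⊗₁ idm (ghom b a x y))
    = gcmp d c a x z w ∘ (idm (ghom d c z w) ⊗₁ gcmp c b a x y z)
      ∘ fwd (tassoc (ghom d c z w) (ghom c b y z) (ghom b a x y));
  lc_idl : forall (X Y : S) (x : lob B X) (y : lob B Y),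
    let b := pr1 Y X in
    let a := pr2 Y X in
    gcmp b b a x y y ∘ (gid b y ⊗₁ idm (ghom b a x y))
    = fwd (tlunit (ghom b a x y));
  lc_idr : forall (X Y : S) (x : lob B X) (y : lob B Y),
    let b := pr1 Y X in
    let a := pr2 Y X in
    gcmp b a a x x y ∘ (idm (ghom b a x y) ⊗₁ gid a x)
    = fwd (trunit (ghom b a x y))
}.

Record LFunData (A B : LCatData) := {
  lf_ext : forall X, lob A X -> S;
  lf_ob : forall X (x : lob A X), lob B (lf_ext x);
  lf_eps : forall X (x : lob A X), X ~> lf_ext x;
  lf_hom : forall X Y (x : lob A X) (y : lob A Y),
    lhom x y ~> pmap (lf_eps y) (lf_eps x) ^* lhom (lf_ob x) (lf_ob y)
}.
Arguments lf_ob {A B} l {X} x.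
Arguments lf_eps {A B} l {X} x.
Arguments lf_hom {A B} l {X Y} x y.

(** The action of [F] on hom-objects, pulled back along [⟨b, a⟩]. *)
Definition gmap (A B : LCatData) (F : LFunData A B) (W X Y : S)
    (b : W ~> Y) (a : W ~> X) (x : lob A X) (y : lob A Y)
    (b' : W ~> lf_ext F y) (a' : W ~> lf_ext F x)
    (eb : lf_eps F y ∘ b = b') (ea : lf_eps F x ∘ a = a') :
    ghom b a x y ~> ghom b' a' (lf_ob F x) (lf_ob F y) :=
  pull (pmap_pair eb ea) (lf_hom F x y).

Record is_LFun (A B : LCatData) (F : LFunData A B) : Prop := {
  lf_id : forall X (x : lob A X),
    gmap (cmp_idr (lf_eps F x)) (cmp_idr (lf_eps F x)) ∘ lc_id x
    = gid (lf_eps F x) (lf_ob F x);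
  lf_cmp : forall X Y Z (x : lob A X) (y : lob A Y) (z : lob A Z),
    let c := tr1 Z Y X in
    let b := tr2 Z Y X in
    let a := tr3 Z Y X in
    gmap (b := c) (a := a) (x := x) (y := z) eq_refl eq_refl ∘ gcmp c b a x y z
    = gcmp (lf_eps F z ∘ c) (lf_eps F y ∘ b) (lf_eps F x ∘ a)
           (lf_ob F x) (lf_ob F y) (lf_ob F z)
      ∘ (gmap (b := c) (a := b) (x := y) (y := z) eq_refl eq_refl
         ⊗₁ gmap (b := b) (a := a) (x := x) (y := y) eq_refl eq_refl)
}.

(** An indexed V-functor, i.e. a V-functor all of whose extent components
    [lf_eps] are identities, so that [F x] has the same extent as [x]; [li_fun]
    is the underlying V-functor. *)
Record LIFunData (A B : LCatData) := {
  li_ob : forall X, lob A X -> lob B X;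
  li_hom : forall X Y (x : lob A X) (y : lob A Y),
    lhom x y ~> pmap (idm Y) (idm X) ^* lhom (li_ob x) (li_ob y)
}.
Arguments li_ob {A B} l {X} x.
Arguments li_hom {A B} l {X Y} x y.

Definition li_fun (A B : LCatData) (F : LIFunData A B) : LFunData A B :=
  {| lf_ext := fun X _ => X;
     lf_ob := fun X x => li_ob F x;
     lf_eps := fun X _ => idm X;
     lf_hom := fun X Y x y => li_hom F x y |}.
Coercion li_fun : LIFunData >-> LFunData.

Definition is_LIFun (A B : LCatData) (F : LIFunData A B) : Prop := is_LFun F.

Record LIFun (A B : LCatData) := {
  lifun_data :> LIFunData A B;
  lifun_ax : is_LIFun lifun_data
}.

Definition LNatData (A B : LCatData) (F G : LFunData A B) : Type :=
  forall X (x : lob A X),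
    tunit ~> ghom (lf_eps G x) (lf_eps F x) (lf_ob F x) (lf_ob G x).

(** Over [Y × X], with source the pullback of [A(x, y)] along the identity
    [⟨pr1, pr2⟩]. *)
Definition is_LNat (A B : LCatData) (F G : LFunData A B) (t : LNatData F G) :
    Prop :=
  forall X Y (x : lob A X) (y : lob A Y),
    let b := pr1 Y X in
    let a := pr2 Y X in
    gpost (lf_eps F x ∘ a)
        (pull_unit (pair_cmp eq_refl eq_refl) (t Y y)
         : tunit ~> ghom (lf_eps G y ∘ b) (lf_eps F y ∘ b) _ _)
      ∘ gmap (F := F) (b := b) (a := a) (x := x) (y := y) eq_refl eq_refl
    = gpre (lf_eps G y ∘ b)
        (pull_unit (pair_cmp eq_refl eq_refl) (t X x)
         : tunit ~> ghom (lf_eps G x ∘ a) (lf_eps F x ∘ a) _ _)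
      ∘ gmap (F := G) (b := b) (a := a) (x := x) (y := y) eq_refl eq_refl.

Record LNat (A B : LCatData) (F G : LFunData A B) := {
  lnat_data :> LNatData F G;
  lnat_ax : is_LNat lnat_data
}.

Definition lifun_id (A : LCatData) : LIFunData A A :=
  {| li_ob := fun X x => x;
     li_hom := fun X Y x y => fwd (pbidE (pmap_id Y X) (lhom x y)) |}.

Definition lifun_cmp (A B C : LCatData) (G : LIFunData B C)
    (F : LIFunData A B) : LIFunData A C :=
  {| li_ob := fun X x => li_ob G (li_ob F x);
     li_hom := fun X Y x y =>
       pull (pmap_idcmp Y X) (li_hom G (li_ob F x) (li_ob F y))
       ∘ li_hom F x y |}.

Definition lnat_id (A B : LCatData) (F : LIFunData A B) : LNatData F F :=
  fun X x => lc_id (li_ob F x).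

Definition lnat_vcmp (A B : LCatData) (F G H : LIFunData A B)
    (t : LNatData G H) (s : LNatData F G) : LNatData F H :=
  fun X x => gcomp (t X x) (s X x).

Definition lnat_hcmp (A B C : LCatData) (F F' : LIFunData A B)
    (G G' : LIFunData B C) (t : LNatData G G') (s : LNatData F F') :
    LNatData (lifun_cmp G F) (lifun_cmp G' F') :=
  fun X x =>
    gcomp (t X (li_ob F' x))
      (gmap (F := G) (cmp_idl (idm X)) (cmp_idl (idm X)) ∘ s X x).

(** [r_to : f^* x -> x] and [r_from : x -> f^* x] lie over [(f, 1)] and
    [(1, f)]; [gid f x] is the identity of [x] pulled back along [f]. *)
Record Restriction (B : LCatData) (X Y : S) (f : Y ~> X) (x : lob B X) := {
  rob : lob B Y;
  r_to : tunit ~> ghom f (idm Y) rob x;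
  r_from : tunit ~> ghom (idm Y) f x rob;
  r_from_to : gcomp r_from r_to = lc_id rob;
  r_to_from : gcomp r_to r_from = gid f x
}.

Record is_VFib (B : LCatData) : Prop := {
  vf_cat : is_LCat B;
  vf_restr : forall (X Y : S) (f : Y ~> X) (x : lob B X),
    inhabited (Restriction f x)
}.

Record VFib := { vfib_data :> LCatData; vfib_ax : is_VFib vfib_data }.

(** A choice of restrictions; it exists for every V-fibration by the axiom of
    choice. *)
Definition Cleavage (B : LCatData) : Type :=
  forall (X Y : S) (f : Y ~> X) (x : lob B X), Restriction f x.

Section Theta.
Variable A : ICatData.

(** The isomorphism [⟨b, a⟩^* A^{Y×X}(pr2^* x, pr1^* y) ≅ A^W(a^* x, b^* y)]
    and its inverse. *)
Definition th_to (W X Y : S) (b : W ~> Y) (a : W ~> X) (x : A X) (y : A Y) :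
    ⟨b, a⟩ ^* ehom (ic_re A (pr2 Y X) x) (ic_re A (pr1 Y X) y)
    ~> ehom (ic_re A a x) (ic_re A b y) :=
  epost (ic_cmpVE (pr1_pair b a) y)
  ∘ epre (ic_cmpE (pr2_pair b a) x)
  ∘ efh (ic_re A ⟨b, a⟩) (ic_re A (pr2 Y X) x) (ic_re A (pr1 Y X) y).

Definition th_from (W X Y : S) (b : W ~> Y) (a : W ~> X) (x : A X) (y : A Y) :
    ehom (ic_re A a x) (ic_re A b y)
    ~> ⟨b, a⟩ ^* ehom (ic_re A (pr2 Y X) x) (ic_re A (pr1 Y X) y) :=
  ic_ffinv A ⟨b, a⟩ (ic_re A (pr2 Y X) x) (ic_re A (pr1 Y X) y)
  ∘ epre (ic_cmpVE (pr2_pair b a) x)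
  ∘ epost (ic_cmpE (pr1_pair b a) y).

Definition theta_cat : LCatData :=
  {| lob := fun X => A X;
     lhom := fun X Y (x : A X) (y : A Y) =>
       ehom (ic_re A (pr2 Y X) x) (ic_re A (pr1 Y X) y);
     lc_id := fun X (x : A X) =>
       th_from (idm X) (idm X) x x ∘ eid (ic_re A (idm X) x);
     lc_cmp := fun X Y Z (x : A X) (y : A Y) (z : A Z) =>
       let c := tr1 Z Y X in
       let b := tr2 Z Y X in
       let a := tr3 Z Y X in
       th_from c a x z
       ∘ ecmp (ic_re A a x) (ic_re A b y) (ic_re A c z)
       ∘ (th_to c b y z ⊗₁ th_to b a x y) |}.

End Theta.
Arguments th_to {A W X Y} b a x y.
Arguments th_from {A W X Y} b a x y.

Definition theta_fun (A B : ICatData) (F : IFunData A B) :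
    LIFunData (theta_cat A) (theta_cat B) :=
  {| li_ob := (fun X (x : A X) => F X x)
       : forall X, lob (theta_cat A) X -> lob (theta_cat B) X;
     li_hom := fun X Y (x : A X) (y : A Y) =>
       fwd (pbidE (pmap_id Y X) _)
       ∘ (epost (if_re F (pr1 Y X) y) ∘ epre (if_reV F (pr2 Y X) x)
          ∘ efh (F (prd Y X)) (ic_re A (pr2 Y X) x) (ic_re A (pr1 Y X) y)) |}.

Definition theta_nat (A B : ICatData) (F G : IFunData A B) (t : INatData F G) :
    LNatData (theta_fun F) (theta_fun G) :=
  fun X (x : A X) =>
    th_from (idm X) (idm X) (F X x) (G X x) ∘ ic_app (idm X) (t X x).

Section Lambda.
Variable B : LCatData.
Variable r : Cleavage B.

Definition lambda_fib (X : S) : ECatData (V X) :=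
  {| eob := lob B X;
     ehom := fun x y => ⟨idm X, idm X⟩ ^* lhom x y;
     eid := fun x => lc_id x;
     ecmp := fun x y z => gcmp (idm X) (idm X) (idm X) x y z |}.

Lemma diag_cmp (X Y : S) (f : X ~> Y) : ⟨idm Y, idm Y⟩ ∘ f = ⟨f, f⟩.
Proof. apply pair_cmp; apply cmp_idl. Qed.

Definition lambda_re (X Y : S) (f : X ~> Y) :
    EFunData (chbase (pb V f) (lambda_fib Y)) (lambda_fib X) :=
  {| efo := (fun x : lob B Y => rob (r f x))
       : chbase (pb V f) (lambda_fib Y) -> lambda_fib X;
     efh := fun x y : lob B Y =>
       gpost (idm X) (r_from (r f y))
       ∘ gpre f (r_to (r f x))
       ∘ bwd (pbcmpE (diag_cmp f) (lhom x y)) |}.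

Definition lambda_ffinv (X Y : S) (f : X ~> Y) (x y : lob B Y) :
    ghom (idm X) (idm X) (rob (r f x)) (rob (r f y))
    ~> f ^* (⟨idm Y, idm Y⟩ ^* lhom x y) :=
  fwd (pbcmpE (diag_cmp f) (lhom x y))
  ∘ gpre f (r_from (r f x))
  ∘ gpost (idm X) (r_to (r f y)).

(** [(g f)^* x -> x -> g^* x -> f^* g^* x], the middle map being pulled back
    along [f]. *)
Definition lambda_cmp (X Y Z : S) (f : X ~> Y) (g : Y ~> Z) (x : lob B Z) :
    tunit ~> ghom (idm X) (idm X) (rob (r (g ∘ f) x))
                  (rob (r f (rob (r g x)))) :=
  gcomp (r_from (r f (rob (r g x))))
    (gcomp (pull_unit (pair_cmp (cmp_idl f) eq_refl) (r_from (r g x))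
            : tunit ~> ghom f (g ∘ f) _ _)
       (r_to (r (g ∘ f) x))).

Definition lambda_cmpV (X Y Z : S) (f : X ~> Y) (g : Y ~> Z) (x : lob B Z) :
    tunit ~> ghom (idm X) (idm X) (rob (r f (rob (r g x))))
                  (rob (r (g ∘ f) x)) :=
  gcomp (r_from (r (g ∘ f) x))
    (gcomp (pull_unit (pair_cmp eq_refl (cmp_idl f)) (r_to (r g x))
            : tunit ~> ghom (g ∘ f) f _ _)
       (r_to (r f (rob (r g x))))).

Definition lambda_cat : ICatData :=
  {| ic := lambda_fib;
     ic_re := lambda_re;
     ic_ffinv := lambda_ffinv;
     ic_cmp := lambda_cmp;
     ic_cmpV := lambda_cmpV;
     ic_id := fun X (x : lob B X) => r_from (r (idm X) x);
     ic_idV := fun X (x : lob B X) => r_to (r (idm X) x) |}.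

End Lambda.

(** [lambda_fun] uses that [F] preserves restrictions: [F (f^* x)] and
    [f^* (F x)] are both restrictions of [F x]. *)
Definition lambda_fun (A B : LCatData) (rA : Cleavage A) (rB : Cleavage B)
    (F : LIFunData A B) : IFunData (lambda_cat rA) (lambda_cat rB) :=
  {| ifn := (fun X =>
       {| efo := (fun x => li_ob F x) : lambda_fib A X -> lambda_fib B X;
          efh := fun x y : lob A X =>
            gmap (F := F) (cmp_idl (idm X)) (cmp_idl (idm X)) |})
       : forall X, EFunData (lambda_cat rA X) (lambda_cat rB X);
     if_re := fun X Y f (x : lob A Y) =>
       gcomp (r_from (rB Y X f (li_ob F x)))
         (gmap (F := F) (cmp_idl f) (cmp_idl (idm X)) ∘ r_to (rA Y X f x));
     if_reV := fun X Y f (x : lob A Y) =>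
       gcomp (gmap (F := F) (cmp_idl (idm X)) (cmp_idl f)
              ∘ r_from (rA Y X f x))
         (r_to (rB Y X f (li_ob F x))) |}.

Arguments lambda_fun {A B} rA rB F.

Definition lambda_nat (A B : LCatData) (rA : Cleavage A) (rB : Cleavage B)
    (F G : LIFunData A B) (t : LNatData F G) :
    INatData (lambda_fun rA rB F) (lambda_fun rA rB G) :=
  fun X (x : lob A X) => t X x.

End Indexed.
Arguments lambda_nat {S V A B} rA rB {F G} t.

Record TwoCatData := {
  ob2 :> Type;
  one2 : ob2 -> ob2 -> Type;
  two2 : forall a b, one2 a b -> one2 a b -> Type;
  id1 : forall a, one2 a a;
  cmp1 : forall a b c, one2 b c -> one2 a b -> one2 a c;
  id2 : forall a b (f : one2 a b), two2 f f;
  vcmp : forall a b (f g h : one2 a b), two2 g h -> two2 f g -> two2 f h;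
  hcmp : forall a b c (f f' : one2 a b) (g g' : one2 b c),
    two2 g g' -> two2 f f' -> two2 (cmp1 g f) (cmp1 g' f')
}.
Arguments id1 {t} a.

(** A 2-cell packed with its boundary, so that 2-cells with provably equal
    boundaries can be compared. *)
Definition cell (C : TwoCatData) (a b : C) : Type :=
  {f : one2 a b & {g : one2 a b & two2 f g}}.

Definition pack (C : TwoCatData) (a b : C) (f g : one2 a b) (t : two2 f g) :
    cell a b := existT _ f (existT _ g t).

Record is_2category (C : TwoCatData) : Prop := {
  cmp1_idl : forall (a b : C) (f : one2 a b), cmp1 (id1 b) f = f;
  cmp1_idr : forall (a b : C) (f : one2 a b), cmp1 f (id1 a) = f;
  cmp1_assoc : forall (a b c d : C)
      (h : one2 c d) (g : one2 b c) (f : one2 a b),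
    cmp1 (cmp1 h g) f = cmp1 h (cmp1 g f);
  vcmp_idl : forall (a b : C) (f g : one2 a b) (t : two2 f g),
    vcmp (id2 g) t = t;
  vcmp_idr : forall (a b : C) (f g : one2 a b) (t : two2 f g),
    vcmp t (id2 f) = t;
  vcmp_assoc : forall (a b : C) (f g h k : one2 a b)
      (u : two2 h k) (t : two2 g h) (s : two2 f g),
    vcmp (vcmp u t) s = vcmp u (vcmp t s);
  hcmp_id2 : forall (a b c : C) (g : one2 b c) (f : one2 a b),
    hcmp (id2 g) (id2 f) = id2 (cmp1 g f);
  interchange : forall (a b c : C) (f f' f'' : one2 a b) (g g' g'' : one2 b c)
      (t' : two2 g' g'') (t : two2 g g') (s' : two2 f' f'') (s : two2 f f'),
    hcmp (vcmp t' t) (vcmp s' s) = vcmp (hcmp t' s') (hcmp t s);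
  hcmp_idl : forall (a b : C) (f g : one2 a b) (t : two2 f g),
    pack (hcmp (id2 (id1 b)) t) = pack t;
  hcmp_idr : forall (a b : C) (f g : one2 a b) (t : two2 f g),
    pack (hcmp t (id2 (id1 a))) = pack t;
  hcmp_assoc : forall (a b c d : C)
      (h h' : one2 c d) (g g' : one2 b c) (f f' : one2 a b)
      (u : two2 h h') (t : two2 g g') (s : two2 f f'),
    pack (hcmp (hcmp u t) s) = pack (hcmp u (hcmp t s))
}.

Record TwoFunData (C D : TwoCatData) := {
  fun0 :> C -> D;
  fun1 : forall a b : C, one2 a b -> one2 (fun0 a) (fun0 b);
  fun2 : forall (a b : C) (f g : one2 a b), two2 f g -> two2 (fun1 f) (fun1 g)
}.
Arguments fun1 {C D} t {a b} f.
Arguments fun2 {C D} t {a b f g} s.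

Record is_2functor (C D : TwoCatData) (F : TwoFunData C D) : Prop := {
  fun1_id : forall a : C, fun1 F (id1 a) = id1 (F a);
  fun1_cmp : forall (a b c : C) (g : one2 b c) (f : one2 a b),
    fun1 F (cmp1 g f) = cmp1 (fun1 F g) (fun1 F f);
  fun2_id : forall (a b : C) (f : one2 a b), fun2 F (id2 f) = id2 (fun1 F f);
  fun2_vcmp : forall (a b : C) (f g h : one2 a b)
      (t : two2 g h) (s : two2 f g),
    fun2 F (vcmp t s) = vcmp (fun2 F t) (fun2 F s);
  fun2_hcmp : forall (a b c : C) (f f' : one2 a b) (g g' : one2 b c)
      (t : two2 g g') (s : two2 f f'),
    pack (fun2 F (hcmp t s)) = pack (hcmp (fun2 F t) (fun2 F s))
}.

Definition twofun_id (C : TwoCatData) : TwoFunData C C :=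
  {| fun0 := fun a : C => a; fun1 := fun a b f => f;
     fun2 := fun a b f g s => s |}.

Definition twofun_cmp (C D E : TwoCatData)
    (G : TwoFunData D E) (F : TwoFunData C D) : TwoFunData C E :=
  {| fun0 := fun a : C => G (F a);
     fun1 := fun a b f => fun1 G (fun1 F f);
     fun2 := fun a b f g s => fun2 G (fun2 F s) |}.

Record TwoNatIso (C D : TwoCatData) (F G : TwoFunData C D) := {
  tn : forall a : C, one2 (F a) (G a);
  tn_inv : forall a : C, one2 (G a) (F a);
  tn_inv_l : forall a : C, cmp1 (tn_inv a) (tn a) = id1 (F a);
  tn_inv_r : forall a : C, cmp1 (tn a) (tn_inv a) = id1 (G a);
  tn_nat1 : forall (a b : C) (f : one2 a b),
    cmp1 (fun1 G f) (tn a) = cmp1 (tn b) (fun1 F f);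
  tn_nat2 : forall (a b : C) (f g : one2 a b) (s : two2 f g),
    pack (hcmp (fun2 G s) (id2 (tn a))) = pack (hcmp (id2 (tn b)) (fun2 F s))
}.

Definition inverse_2equivalences (C D : TwoCatData)
    (F : TwoFunData C D) (G : TwoFunData D C) : Prop :=
  inhabited (TwoNatIso (twofun_id C) (twofun_cmp G F))
  /\ inhabited (TwoNatIso (twofun_cmp F G) (twofun_id D)).

(** That the operations on raw data preserve the axioms is expressed by the
    propositions [..._wf]; the 2-categories and 2-functors are assembled from
    proofs of these. *)

Section Main.
Variables (S : FinProdCat) (V : IMCData S).

Record VCATidx_wf : Prop := {
  ci_id1 : forall A : ICat V, is_IFun (ifun_id A);
  ci_cmp1 : forall (A B C : ICat V) (G : IFun B C) (F : IFun A B),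
    is_IFun (ifun_cmp G F);
  ci_id2 : forall (A B : ICat V) (F : IFun A B), is_INat (inat_id F);
  ci_vcmp : forall (A B : ICat V) (F G H : IFun A B)
      (t : INat G H) (s : INat F G), is_INat (inat_vcmp t s);
  ci_hcmp : forall (A B C : ICat V) (F F' : IFun A B) (G G' : IFun B C)
      (t : INat G G') (s : INat F F'), is_INat (inat_hcmp t s)
}.

Definition VCATidx (w : VCATidx_wf) : TwoCatData :=
  {| ob2 := ICat V;
     one2 := fun A B => IFun A B;
     two2 := fun A B F G => INat F G;
     id1 := fun A => {| ifun_ax := ci_id1 w A |};
     cmp1 := fun A B C G F => {| ifun_ax := ci_cmp1 w G F |};
     id2 := fun A B F => {| inat_ax := ci_id2 w F |};
     vcmp := fun A B F G H t s => {| inat_ax := ci_vcmp w t s |};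
     hcmp := fun A B C F F' G G' t s => {| inat_ax := ci_hcmp w t s |} |}.

Record VFIB_wf : Prop := {
  cf_id1 : forall A : VFib V, is_LIFun (lifun_id A);
  cf_cmp1 : forall (A B C : VFib V) (G : LIFun B C) (F : LIFun A B),
    is_LIFun (lifun_cmp G F);
  cf_id2 : forall (A B : VFib V) (F : LIFun A B), is_LNat (lnat_id F);
  cf_vcmp : forall (A B : VFib V) (F G H : LIFun A B)
      (t : LNat G H) (s : LNat F G), is_LNat (lnat_vcmp t s);
  cf_hcmp : forall (A B C : VFib V) (F F' : LIFun A B) (G G' : LIFun B C)
      (t : LNat G G') (s : LNat F F'), is_LNat (lnat_hcmp t s)
}.

Definition VFIB (w : VFIB_wf) : TwoCatData :=
  {| ob2 := VFib V;
     one2 := fun A B => LIFun A B;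
     two2 := fun A B F G => LNat F G;
     id1 := fun A => {| lifun_ax := cf_id1 w A |};
     cmp1 := fun A B C G F => {| lifun_ax := cf_cmp1 w G F |};
     id2 := fun A B F => {| lnat_ax := cf_id2 w F |};
     vcmp := fun A B F G H t s => {| lnat_ax := cf_vcmp w t s |};
     hcmp := fun A B C F F' G G' t s => {| lnat_ax := cf_hcmp w t s |} |}.

Record Theta_wf : Prop := {
  th_ob : forall A : ICat V, is_VFib (theta_cat A);
  th_fun : forall (A B : ICat V) (F : IFun A B), is_LIFun (theta_fun F);
  th_nat : forall (A B : ICat V) (F G : IFun A B) (t : INat F G),
    is_LNat (theta_nat t)
}.

Definition Theta (wi : VCATidx_wf) (wf : VFIB_wf) (w : Theta_wf) :
    TwoFunData (VCATidx wi) (VFIB wf) :=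
  Build_TwoFunData (C := VCATidx wi) (D := VFIB wf)
    (fun0 := fun A => {| vfib_ax := th_ob w A |})
    (fun1 := fun A B F => {| lifun_ax := th_fun w F |})
    (fun A B F G t => {| lnat_ax := th_nat w t |}).

Section ChosenRestrictions.
Variable r : forall B : VFib V, Cleavage B.
Arguments r : clear implicits.

Record Lambda_wf : Prop := {
  la_ob : forall B : VFib V, is_ICat (lambda_cat (r B));
  la_fun : forall (A B : VFib V) (F : LIFun A B),
    is_IFun (lambda_fun (r A) (r B) F);
  la_nat : forall (A B : VFib V) (F G : LIFun A B) (t : LNat F G),
    is_INat (lambda_nat (r A) (r B) t)
}.

Definition Lambda (wi : VCATidx_wf) (wf : VFIB_wf) (w : Lambda_wf) :
    TwoFunData (VFIB wf) (VCATidx wi) :=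
  Build_TwoFunData (C := VFIB wf) (D := VCATidx wi)
    (fun0 := fun B => {| icat_ax := la_ob w B |})
    (fun1 := fun A B F => {| ifun_ax := la_fun w F |})
    (fun A B F G t => {| inat_ax := la_nat w t |}).

End ChosenRestrictions.
End Main.

(* Main.v *)
(** Indexed and large V-categories both give rise to a system of hom-objects
    [khom b a x y] over [W], for [b : W ~> Y] and [a : W ~> X], with associative
    compositions over a fixed [W] and coherent isomorphisms under pullback along
    [t : W' ~> W].  For an indexed V-category [A] it is [phi A], with hom-objects
    [A^W(a^* x, b^* y)]; for a large one [B] it is [gamma B], with hom-objects
    [⟨b, a⟩^* B(x, y)].  A large V-category is determined by the part of its
    system with [b], [a] the two product projections: [Θ A] is the large
    V-category so obtained from [phi A], and the pullback isomorphisms [th]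
    identify [gamma (Θ A)] with [phi A].  The laws on either side are transferred
    along these isomorphisms to the system, where they are pointwise over each
    [W].  Likewise [Λ B] is computed inside [gamma B]: its hom-objects are
    [khom 1 1 x y], and a restriction makes [x] regarded along [f] isomorphic to
    [f^* x] regarded along [1].

    The unit [A -> Λ Θ A] is the identity on objects, and on hom-objects it is
    conjugation by [(1_X)^* x ≅ x] followed by [th^-1].  The counit
    [Θ Λ B -> B] is also the identity on objects; on hom-objects it is
    [A^W(a^* x, b^* y) = khom 1 1 (a^* x) (b^* y) ≅ khom b a x y], conjugation by
    the restriction isomorphisms.  Both are therefore 2-natural isomorphisms. *)

From Stdlib Require Import Setoid FunctionalExtensionality ProofIrrelevance.
Require Import Defs.

Set Implicit Arguments.
Unset Strict Implicit.
Unset Printing Implicit Defensive.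

(** * Calculation in monoidal and enriched categories *)

(** The obstacle is strictness: the equations between 1-cells and the two 2-natural isomorphisms
    must hold on the nose. As every comparison is the identity on objects, equality of 1-cells
    reduces to that of hom-actions and comparison elements, and functional extensionality and proof
    irrelevance do the rest. Projections compose with pairings only up to propositional equality;
    hence every pullback map carries equations [b ∘ t = b'], and the coherence of [V] is restated
    for arbitrary such equations. The restrictions used by [Λ] are arbitrary, also on [Θ A], where
    they need not be the reindexings of [A]. The construction of [Λ] is therefore repeated over any
    system with restrictions. Over [phi A] with the transported restrictions it gives a third
    indexed V-category between [A] and [Λ Θ A], and the unit splits into a change of reindexing
    followed by this construction applied to [th^-1]. The versions over systems, [lsys] and
    [lam_cat], are convertible with [theta_cat] and [lambda_cat], so results are carried over by
    [exact] and [change]. *)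

Section CatLemmas.
Variable C : Cat.

(** [cmp_idl] itself cannot be used for rewriting in goals in which it occurs
    as a term. *)
Lemma id_cmp (a b : C) (f : a ~> b) : idm b ∘ f = f.
Proof. apply cmp_idl. Qed.

Lemma reassoc2 (a b c : C) (g : b ~> c) (f : a ~> b) (h : a ~> c) :
  g ∘ f = h -> forall z (k : z ~> a), g ∘ (f ∘ k) = h ∘ k.
Proof. intros <- z k. now rewrite cmp_assoc. Qed.

Lemma reassoc3 (a b c d : C) (g : c ~> d) (f : b ~> c) (e : a ~> b) h :
  g ∘ (f ∘ e) = h -> forall z (k : z ~> a), g ∘ (f ∘ (e ∘ k)) = h ∘ k.
Proof. intros <- z k. now rewrite !cmp_assoc. Qed.

Lemma reassoc4 (a b c d d' : C) (i : d ~> d') (g : c ~> d) (f : b ~> c)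
    (e : a ~> b) h :
  i ∘ (g ∘ (f ∘ e)) = h ->
  forall z (k : z ~> a), i ∘ (g ∘ (f ∘ (e ∘ k))) = h ∘ k.
Proof. intros <- z k. now rewrite !cmp_assoc. Qed.

Lemma assoc3 (a b c d : C) (g : c ~> d) (f : b ~> c) (e : a ~> b) h :
  g ∘ f ∘ e = h -> g ∘ (f ∘ e) = h.
Proof. intros <-. now rewrite !cmp_assoc. Qed.

Lemma assoc4 (a b c d d' : C) (i : d ~> d') (g : c ~> d) (f : b ~> c)
    (e : a ~> b) h :
  i ∘ g ∘ f ∘ e = h -> i ∘ (g ∘ (f ∘ e)) = h.
Proof. intros <-. now rewrite !cmp_assoc. Qed.

Lemma cancel_epi (a b c : C) (i : a ~> b) (j : b ~> a) (f g : b ~> c) :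
  i ∘ j = idm b -> f ∘ i = g ∘ i -> f = g.
Proof.
intros e E. rewrite <- (cmp_idr f), <- (cmp_idr g), <- e, <- !cmp_assoc.
now rewrite E.
Qed.

Lemma cancel_mono (a b c : C) (i : b ~> c) (j : c ~> b) (f g : a ~> b) :
  j ∘ i = idm b -> i ∘ f = i ∘ g -> f = g.
Proof.
intros e E. rewrite <- (cmp_idl f), <- (cmp_idl g), <- e, !cmp_assoc.
now rewrite E.
Qed.

(** Stated for bare composites so that it can be applied by [exact]: the goals in which [t ∘ s]
    cancels have this shape only up to conversion. *)
Lemma cancel_mid (a b c d e e' : C) (g : d ~> e) (h : c ~> d) (t : e' ~> c)
    (s : c ~> e') (k : b ~> c) (l : a ~> b) :
  t ∘ s = idm c -> g ∘ ((h ∘ k) ∘ l) = (g ∘ (h ∘ t)) ∘ (s ∘ (k ∘ l)).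
Proof.
intros q. rewrite !cmp_assoc, (reassoc2 q). now rewrite cmp_idl.
Qed.

Lemma cancel_mid2 (a c d e e' : C) (g : d ~> e) (h : c ~> d) (t : e' ~> c)
    (s : c ~> e') (u : a ~> c) :
  t ∘ s = idm c -> (g ∘ (h ∘ t)) ∘ (s ∘ u) = g ∘ (h ∘ u).
Proof.
intros q. rewrite !cmp_assoc, (reassoc2 q). now rewrite cmp_idl.
Qed.

Lemma cancel_mid3 (a c d e' : C) (h : c ~> d) (t : e' ~> c)
    (s : c ~> e') (u : a ~> c) :
  t ∘ s = idm c -> (h ∘ t) ∘ (s ∘ u) = h ∘ u.
Proof.
intros q. rewrite !cmp_assoc, (reassoc2 q). now rewrite cmp_idl.
Qed.

(** The abstract form of naturality of the counit: [eA], [eB] are its components, [kA], [kB]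
    conjugations by restrictions, [tA], [sB] the pullback isomorphisms of [Θ], and [n] is [m] seen
    in the indexed category. *)
Lemma paste_square (a a' b b' c c' : C) (F : c ~> c') (eA : a ~> c) (eB : a' ~> c')
    (m : a ~> a') (kA : b ~> c) (kB : b' ~> c') (n : b ~> b') (tA : a ~> b)
    (sB : b' ~> a') :
  eA = kA ∘ tA -> eB ∘ sB = kB -> m = sB ∘ (n ∘ tA) -> kB ∘ n = F ∘ kA ->
  F ∘ eA = eB ∘ m.
Proof.
intros -> <- -> e. rewrite <- !cmp_assoc. now rewrite <- e, !cmp_assoc.
Qed.

Lemma iso_eq (a b : C) (i j : Iso a b) : fwd i = fwd j -> bwd i = bwd j.
Proof.
intros e. apply (cancel_mono (bwd_fwd i)).
now rewrite fwd_bwd, e, fwd_bwd.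
Qed.

Lemma fwd_inj (a b c : C) (i : Iso b c) (f g : a ~> b) :
  fwd i ∘ f = fwd i ∘ g -> f = g.
Proof. exact (cancel_mono (bwd_fwd i)). Qed.

End CatLemmas.

(** Composites are kept right-associated. The alternatives find the left-hand side of [H], up to
    four factors bracketed either way, with further factors to its right; the last one supplies
    missing arguments of [H]. *)
Ltac rwx H :=
  first [ rewrite (reassoc2 H) | rewrite (reassoc3 H) | rewrite (reassoc4 H)
        | rewrite (assoc3 H) | rewrite (reassoc3 (assoc3 H))
        | rewrite (assoc4 H) | rewrite (reassoc4 (assoc4 H))
        | let H' := open_constr:(H _) in rwx H' ].
Tactic Notation "rw" open_constr(H) :=
  rewrite ?cmp_assoc; first [ rewrite H | rwx H ]; rewrite ?cmp_assoc.
Ltac ra := rewrite ?cmp_assoc.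

Section Monoidal.
Variable M : MonCat.

Lemma tmor_cmp_ (a a' a'' b b' b'' : M)
    (u' : a' ~> a'') (u : a ~> a') (v' : b' ~> b'') (v : b ~> b') :
  (u' ⊗₁ v') ∘ (u ⊗₁ v) = (u' ∘ u) ⊗₁ (v' ∘ v).
Proof. symmetry. apply tmor_cmp. Qed.

Lemma tmor_cmpl (a a' a'' b : M) (u' : a' ~> a'') (u : a ~> a') :
  (u' ∘ u) ⊗₁ idm b = (u' ⊗₁ idm b) ∘ (u ⊗₁ idm b).
Proof. now rewrite tmor_cmp_, cmp_idl. Qed.

Lemma tmor_cmpr (a b b' b'' : M) (u' : b' ~> b'') (u : b ~> b') :
  idm a ⊗₁ (u' ∘ u) = (idm a ⊗₁ u') ∘ (idm a ⊗₁ u).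
Proof. now rewrite tmor_cmp_, cmp_idl. Qed.

Lemma tmor_split (a a' b b' : M) (u : a ~> a') (v : b ~> b') :
  u ⊗₁ v = (u ⊗₁ idm b') ∘ (idm a ⊗₁ v).
Proof. now rewrite tmor_cmp_, cmp_idl, cmp_idr. Qed.

Lemma tlunit_natV (a a' : M) (u : a ~> a') :
  bwd (tlunit a') ∘ u = (idm tunit ⊗₁ u) ∘ bwd (tlunit a).
Proof.
apply (fwd_inj (i := tlunit a')).
rewrite <- !cmp_assoc, fwd_bwd, tlunit_nat, cmp_assoc, fwd_bwd.
now rewrite cmp_idl, cmp_idr.
Qed.

Lemma trunit_natV (a a' : M) (u : a ~> a') :
  bwd (trunit a') ∘ u = (u ⊗₁ idm tunit) ∘ bwd (trunit a).
Proof.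
apply (fwd_inj (i := trunit a')).
rewrite <- !cmp_assoc, fwd_bwd, trunit_nat, cmp_assoc, fwd_bwd.
now rewrite cmp_idl, cmp_idr.
Qed.

Lemma tunitl_faithful (a b : M) (f g : a ~> b) :
  idm tunit ⊗₁ f = idm tunit ⊗₁ g -> f = g.
Proof.
intros e. apply (cancel_epi (fwd_bwd (tlunit a))).
now rewrite <- !tlunit_nat, e.
Qed.

Lemma tunitr_faithful (a b : M) (f g : a ~> b) :
  f ⊗₁ idm tunit = g ⊗₁ idm tunit -> f = g.
Proof.
intros e. apply (cancel_epi (fwd_bwd (trunit a))).
now rewrite <- !trunit_nat, e.
Qed.

(** Kelly's argument: tensoring with the unit on the left is faithful, and after precomposition with
    an invertible composite of two associators both sides agree by the pentagon for [tunit],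
    [tunit], [a], [b] and the triangle. *)
Lemma tlunit_tensor (a b : M) :
  fwd (tlunit (a ⊗ b)) ∘ fwd (tassoc tunit a b) = fwd (tlunit a) ⊗₁ idm b.
Proof.
apply tunitl_faithful.
set (A2 := tassoc tunit tunit a).
assert (e : fwd (tassoc tunit (tunit ⊗ a) b) ∘ (fwd A2 ⊗₁ idm b)
   ∘ ((bwd A2 ⊗₁ idm b) ∘ bwd (tassoc tunit (tunit ⊗ a) b)) = idm _).
{ ra. rewrite (reassoc2 (tmor_cmp_ _ _ _ _)), fwd_bwd, cmp_idl, tmor_id, cmp_idl.
  apply fwd_bwd. }
apply (cancel_epi e).
rewrite <- (cmp_idl (idm tunit)), !tmor_cmp, !cmp_idl. ra.
rewrite <- (cmp_assoc (idm tunit ⊗₁ fwd (tassoc tunit a b))).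
unfold A2. rewrite <- pentagon.
rewrite (reassoc2 (triangle _ _)).
rewrite <- (tmor_id a b), <- tassoc_nat.
rewrite (reassoc2 (eq_sym (tassoc_nat _ _ _))), cmp_assoc.
now rewrite tmor_cmp_, triangle, cmp_idl.
Qed.

Lemma trunit_tensor (a b : M) :
  (idm a ⊗₁ fwd (trunit b)) ∘ fwd (tassoc a b tunit) = fwd (trunit (a ⊗ b)).
Proof.
apply tunitr_faithful.
apply (fwd_inj (i := tassoc a b tunit)).
rewrite <- (cmp_idl (idm tunit)), !tmor_cmp, !cmp_idl.
rewrite (reassoc2 (tassoc_nat _ _ _)), <- !triangle, <- (tmor_id a b).
rewrite (reassoc2 (tassoc_nat _ _ _)). ra. rewrite pentagon.
now rw (tmor_cmp_ _ _ _ _); rewrite cmp_idl.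
Qed.

(** After tensoring with the unit on the right, the right side is [(1 ⊗ l) ∘ α] by the triangle and
    the left side [l ∘ α] by [tlunit_tensor]; naturality of [l] at itself gives [l = 1 ⊗ l] on
    [tunit ⊗ tunit]. *)
Lemma tunit_coh : fwd (tlunit (@tunit M)) = fwd (trunit tunit).
Proof.
apply tunitr_faithful.
rewrite <- triangle, <- tlunit_tensor.
f_equal.
apply (fwd_inj (i := tlunit tunit)).
now rewrite tlunit_nat.
Qed.
End Monoidal.

Lemma tmor_iso (M : MonCat) (a a' b b' : M) (u : a ~> a') (u' : a' ~> a)
    (v : b ~> b') (v' : b' ~> b) :
  u ∘ u' = idm a' -> v ∘ v' = idm b' ->
  (u ⊗₁ v) ∘ (u' ⊗₁ v') = idm (a' ⊗ b').
Proof. intros e e'. now rewrite tmor_cmp_, e, e', tmor_id. Qed.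

Section Transfer.
Variable M : MonCat.

(** An equation between maps out of the primed triple product may be checked after the split
    epimorphism [fa ⊗ fb ⊗ fc], where the four compatibilities reduce it to the unprimed one. It
    serves both to pull a law back to general base morphisms and to pass from a system to its large
    V-category. *)
Lemma assoc_transfer (a b c ab bc abc a' b' c' ab' bc' abc' : M)
    (mab : a ⊗ b ~> ab) (mbc : b ⊗ c ~> bc) (ml : ab ⊗ c ~> abc)
    (mr : a ⊗ bc ~> abc)
    (mab' : a' ⊗ b' ~> ab') (mbc' : b' ⊗ c' ~> bc') (ml' : ab' ⊗ c' ~> abc')
    (mr' : a' ⊗ bc' ~> abc')
    (fa : a ~> a') (fb : b ~> b') (fc : c ~> c') (fab : ab ~> ab')
    (fbc : bc ~> bc') (fabc : abc ~> abc')
    (ga : a' ~> a) (gb : b' ~> b) (gc : c' ~> c) :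
  fa ∘ ga = idm _ -> fb ∘ gb = idm _ -> fc ∘ gc = idm _ ->
  mab' ∘ (fa ⊗₁ fb) = fab ∘ mab -> mbc' ∘ (fb ⊗₁ fc) = fbc ∘ mbc ->
  ml' ∘ (fab ⊗₁ fc) = fabc ∘ ml -> mr' ∘ (fa ⊗₁ fbc) = fabc ∘ mr ->
  ml ∘ (mab ⊗₁ idm c) = mr ∘ (idm a ⊗₁ mbc) ∘ fwd (tassoc a b c) ->
  ml' ∘ (mab' ⊗₁ idm c') = mr' ∘ (idm a' ⊗₁ mbc') ∘ fwd (tassoc a' b' c').
Proof.
intros ea eb ec eab ebc el er e.
apply (cancel_epi (tmor_iso (tmor_iso ea eb) ec)). ra.
rewrite tassoc_nat. rw (tmor_cmp_ _ _ _ _). rw (tmor_cmp_ _ _ _ _).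
rewrite eab, ebc, !cmp_idl.
rewrite <- (cmp_idr fa), <- (cmp_idr fc), !tmor_cmp. ra.
rw el. rw er. now rewrite e, !cmp_assoc.
Qed.

Lemma lunit_transfer (a b a' b' : M) (m : b ⊗ a ~> a) (i : tunit ~> b)
    (m' : b' ⊗ a' ~> a') (i' : tunit ~> b')
    (fa : a ~> a') (fb : b ~> b') (ga : a' ~> a) :
  fa ∘ ga = idm _ -> fb ∘ i = i' -> m' ∘ (fb ⊗₁ fa) = fa ∘ m ->
  m ∘ (i ⊗₁ idm a) = fwd (tlunit a) ->
  m' ∘ (i' ⊗₁ idm a') = fwd (tlunit a').
Proof.
intros ea <- em e.
apply (cancel_epi (tmor_iso (cmp_idl (idm tunit)) ea)). ra.
rewrite tlunit_nat, <- e, tmor_cmp_, cmp_idl, cmp_idr.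
rewrite <- (cmp_idr fa) at 1. now rewrite tmor_cmp, <- cmp_assoc, em, cmp_assoc.
Qed.

Lemma runit_transfer (a b a' b' : M) (m : a ⊗ b ~> a) (i : tunit ~> b)
    (m' : a' ⊗ b' ~> a') (i' : tunit ~> b')
    (fa : a ~> a') (fb : b ~> b') (ga : a' ~> a) :
  fa ∘ ga = idm _ -> fb ∘ i = i' -> m' ∘ (fa ⊗₁ fb) = fa ∘ m ->
  m ∘ (idm a ⊗₁ i) = fwd (trunit a) ->
  m' ∘ (idm a' ⊗₁ i') = fwd (trunit a').
Proof.
intros ea <- em e.
apply (cancel_epi (tmor_iso ea (cmp_idl (idm tunit)))). ra.
rewrite trunit_nat, <- e, tmor_cmp_, cmp_idl, cmp_idr.
rewrite <- (cmp_idr fa) at 1. now rewrite tmor_cmp, <- cmp_assoc, em, cmp_assoc.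
Qed.

Variables (N : MonCat) (P : StrongMon M N).

Lemma assoc_image (a b c ab bc abc : M)
    (mab : a ⊗ b ~> ab) (mbc : b ⊗ c ~> bc) (ml : ab ⊗ c ~> abc)
    (mr : a ⊗ bc ~> abc) :
  ml ∘ (mab ⊗₁ idm c) = mr ∘ (idm a ⊗₁ mbc) ∘ fwd (tassoc a b c) ->
  (smor P ml ∘ fwd (smul P ab c))
    ∘ ((smor P mab ∘ fwd (smul P a b)) ⊗₁ idm (P c))
  = (smor P mr ∘ fwd (smul P a bc))
    ∘ (idm (P a) ⊗₁ (smor P mbc ∘ fwd (smul P b c)))
    ∘ fwd (tassoc (P a) (P b) (P c)).
Proof.
intros e. rewrite <- (cmp_idl (idm (P a))), <- (cmp_idl (idm (P c))).
rewrite !tmor_cmp, <- !smor_id. rw (smul_nat P _ _). rw (smul_nat P _ _).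
assert (q := smul_assoc P a b c).
rewrite cmp_assoc, <- !smor_id in q. rewrite cmp_assoc in q. rewrite <- q.
rewrite cmp_assoc in e. do 3 rw (eq_sym (smor_cmp P _ _)). now rewrite e.
Qed.

Lemma lunit_image (a b : M) (m : b ⊗ a ~> a) (i : tunit ~> b) :
  m ∘ (i ⊗₁ idm a) = fwd (tlunit a) ->
  (smor P m ∘ fwd (smul P b a))
    ∘ ((smor P i ∘ fwd (sunit P)) ⊗₁ idm (P a)) = fwd (tlunit (P a)).
Proof.
intros e. rewrite <- (cmp_idl (idm (P a))), tmor_cmp.
rewrite <- (smor_id P a) at 1. rw (smul_nat P _ _).
rewrite <- smul_lunit, <- e, smor_cmp. now ra.
Qed.

Lemma runit_image (a b : M) (m : a ⊗ b ~> a) (i : tunit ~> b) :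
  m ∘ (idm a ⊗₁ i) = fwd (trunit a) ->
  (smor P m ∘ fwd (smul P a b))
    ∘ (idm (P a) ⊗₁ (smor P i ∘ fwd (sunit P))) = fwd (trunit (P a)).
Proof.
intros e. rewrite <- (cmp_idl (idm (P a))), tmor_cmp.
rewrite <- (smor_id P a) at 1. rw (smul_nat P _ _).
rewrite <- smul_runit, <- e, smor_cmp. now ra.
Qed.

End Transfer.

Section ECatLemmas.
Variables (M : MonCat) (C : ECatData M) (H : is_ECat C).

Lemma epost_id (x y : C) : epost (eid y) = idm (ehom x y).
Proof. unfold epost. now rewrite (ecmp_idl H), fwd_bwd. Qed.

Lemma epre_id (x y : C) : epre (eid x) = idm (ehom x y).
Proof. unfold epre. now rewrite (ecmp_idr H), fwd_bwd. Qed.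

Lemma tlunit_tensorV (a b : M) :
  fwd (tassoc tunit a b) ∘ (bwd (tlunit a) ⊗₁ idm b) = bwd (tlunit (a ⊗ b)).
Proof.
apply (fwd_inj (i := tlunit (a ⊗ b))).
rw (tlunit_tensor _ _). now rewrite tmor_cmp_, !fwd_bwd, cmp_idl, tmor_id.
Qed.

Lemma trunit_tensorV (a b : M) :
  fwd (tassoc a b tunit) ∘ bwd (trunit (a ⊗ b)) = idm a ⊗₁ bwd (trunit b).
Proof.
apply (cancel_mono (i := idm a ⊗₁ fwd (trunit b))
  (tmor_iso (cmp_idl (idm a)) (bwd_fwd (trunit b)))).
rw (trunit_tensor _ _). now rewrite tmor_cmp_, !fwd_bwd, cmp_idl, tmor_id.
Qed.

Lemma ecmp_post (x y z w : C) (v : elt z w) :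
  ecmp x y w ∘ (epost v ⊗₁ idm (ehom x y)) = epost v ∘ ecmp x y z.
Proof.
unfold epost. rewrite !tmor_cmpl. ra.
rw (ecmp_assoc H x y z w). rw (tassoc_nat _ _ _).
rw (tlunit_tensorV _ _). rewrite tlunit_natV, tmor_id.
rw (tmor_cmp_ _ _ _ _). rw (tmor_cmp_ _ _ _ _).
now rewrite !cmp_idl, !cmp_idr.
Qed.

Lemma ecmp_pre (x y z w : C) (u : elt x y) :
  ecmp x z w ∘ (idm (ehom z w) ⊗₁ epre u) = epre u ∘ ecmp y z w.
Proof.
unfold epre. rewrite !tmor_cmpr. ra.
rewrite trunit_natV, <- trunit_tensorV. rw (eq_sym (tassoc_nat _ _ _)).
rewrite tmor_id. rw (eq_sym (ecmp_assoc H x y z w)).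
rw (tmor_cmp_ _ _ _ _). rw (tmor_cmp_ _ _ _ _).
now rewrite !cmp_idl, !cmp_idr.
Qed.

(** Associativity with [v] inserted between the two factors; by the triangle axiom the unit on which
    [v] is defined can be absorbed on either side. *)
Lemma ecmp_mid (x y z w : C) (v : elt y z) :
  ecmp x y w ∘ (epre v ⊗₁ idm (ehom x y))
  = ecmp x z w ∘ (idm (ehom z w) ⊗₁ epost v).
Proof.
unfold epre, epost.
rewrite !tmor_cmpl, !tmor_cmpr. ra.
rw (ecmp_assoc H x y z w). rw (tassoc_nat _ _ _).
f_equal. f_equal. f_equal.
apply (cancel_epi (i := fwd (trunit (ehom z w)) ⊗₁ idm (ehom x y))
  (tmor_iso (fwd_bwd _) (cmp_idl _))).
rw (tmor_cmp_ _ _ _ _). rewrite bwd_fwd, cmp_idl, tmor_id, cmp_idr.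
rewrite <- triangle. rw (tmor_cmp_ _ _ _ _).
now rewrite bwd_fwd, cmp_idl, tmor_id, cmp_idl.
Qed.

Lemma epost_epre (x y z w : C) (v : elt z w) (u : elt x y) :
  epost v ∘ epre u = epre u ∘ epost v.
Proof.
unfold epre at 1 2. ra. rewrite trunit_natV. rw (tmor_cmp_ _ _ _ _).
rewrite <- cmp_assoc, <- ecmp_post. rw (tmor_cmp_ _ _ _ _).
now rewrite !cmp_idl, !cmp_idr.
Qed.

(** Both sides are [ecmp ∘ (v ⊗ u)] after an inverse unitor of [tunit], the left one for [epost] and
    the right one for [epre]; [tunit_coh] identifies them. *)
Lemma ecomp_pre (x y z : C) (v : elt y z) (u : elt x y) :
  ecomp v u = epre u ∘ v.
Proof.
unfold ecomp, epost, epre. ra. rewrite tlunit_natV, trunit_natV.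
rw (tmor_cmp_ _ _ _ _). rw (tmor_cmp_ _ _ _ _).
now rewrite !cmp_idl, !cmp_idr, (iso_eq (tunit_coh M)).
Qed.

Lemma epost_comp (x y z w : C) (v : elt z w) (u : elt y z) :
  epost (x := x) (ecomp v u) = epost v ∘ epost u.
Proof.
unfold ecomp, epost at 1 4. ra. rw (eq_sym (ecmp_post _ _ _)).
rw (tmor_cmp_ _ _ _ _). now rewrite cmp_idl.
Qed.

(** The middle object may be replaced by one of which it is merely a retract. *)
Lemma ecmp_conj (x x' y y' z z' : C) (u : elt x' x) (w : elt z z')
    (c : elt y' y) (v : elt y y') :
  ecomp c v = eid y ->
  epost w ∘ epre u ∘ ecmp x y z
  = ecmp x' y' z' ∘ ((epost w ∘ epre c) ⊗₁ (epost v ∘ epre u)).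
Proof.
intros e. rewrite (epost_epre w c), <- (cmp_idl (epost v ∘ _)).
rewrite (tmor_cmp (epre c)). rw (ecmp_mid _). rewrite tmor_cmp_, cmp_idl.
rw (eq_sym (epost_comp _ _ _)). rewrite e, epost_id, cmp_idl.
rewrite tmor_split. rw (ecmp_post _ _ _). now rewrite ecmp_pre.
Qed.

Lemma epre_comp (x y z w : C) (v : elt y z) (u : elt x y) :
  epre (z := w) (ecomp v u) = epre u ∘ epre v.
Proof.
rewrite ecomp_pre. unfold epre at 1 4. ra. rw (eq_sym (ecmp_pre _ _ _)).
rw (tmor_cmp_ _ _ _ _). now rewrite cmp_idl.
Qed.

Lemma ecomp_assoc (x y z w : C) (t : elt z w) (v : elt y z) (u : elt x y) :
  ecomp (ecomp t v) u = ecomp t (ecomp v u).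
Proof. unfold ecomp at 1. rewrite epost_comp. apply cmp_assoc. Qed.

Lemma ecomp_idl (x y : C) (u : elt x y) : ecomp (eid y) u = u.
Proof. unfold ecomp. now rewrite epost_id, cmp_idl. Qed.

Lemma ecomp_idr (x y : C) (u : elt x y) : ecomp u (eid x) = u.
Proof. now rewrite ecomp_pre, epre_id, cmp_idl. Qed.

Lemma einverse_uniq (x y : C) (u : elt x y) (v v' : elt y x) :
  einverse u v -> einverse u v' -> v = v'.
Proof.
intros [_ e] [e' _].
now rewrite <- (ecomp_idl v), <- e', ecomp_assoc, e, ecomp_idr.
Qed.

End ECatLemmas.

Section EReassoc.
Variables (M : MonCat) (C : ECatData M) (H : is_ECat C).

Lemma ereassoc2 (a b c : C) (g : elt b c) (f : elt a b) (h : elt a c) :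
  ecomp g f = h -> forall z (k : elt z a), ecomp g (ecomp f k) = ecomp h k.
Proof. intros <- z k. now rewrite (ecomp_assoc H). Qed.

Lemma ereassoc3 (a b c d : C) (g : elt c d) (f : elt b c) (e : elt a b) h :
  ecomp g (ecomp f e) = h ->
  forall z (k : elt z a), ecomp g (ecomp f (ecomp e k)) = ecomp h k.
Proof. intros <- z k. now rewrite !(ecomp_assoc H). Qed.
End EReassoc.

Arguments ecmp_post {M C} H {x y z w} v.
Arguments ecmp_pre {M C} H {x y z w} u.
Arguments ecmp_mid {M C} H {x y z w} v.
Arguments ecmp_conj {M C} H {x x' y y' z z' u w c v} _.
Arguments epost_epre {M C} H {x y z w} v u.
Arguments ecomp_pre {M C x y z} v u.
Arguments epost_comp {M C} H {x y z w} v u.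
Arguments epre_comp {M C} H {x y z w} v u.
Arguments ecomp_assoc {M C} H {x y z w} t v u.
Arguments ecomp_idl {M C} H {x y} u.
Arguments ecomp_idr {M C} H {x y} u.

Ltac erwx E H :=
  first [ rewrite H | rewrite (ereassoc2 E H) | rewrite (ereassoc3 E H)
        | let H' := open_constr:(H _) in erwx E H' ].
Ltac era E := rewrite ?(ecomp_assoc E).
Tactic Notation "erw" open_constr(E) open_constr(H) :=
  rewrite ?(ecomp_assoc E); erwx E H; rewrite ?(ecomp_assoc E).

(** Brings composites of [epost]s and [epre]s to the form
    [epost _ ∘ (epre _ ∘ _)]. *)
Ltac enorm E :=
  rewrite ?cmp_assoc;
  repeat (first [ rewrite (reassoc2 (eq_sym (epost_epre E _ _)))
               | rewrite <- (epost_epre E _ _) ]; rewrite ?cmp_assoc);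
  repeat first [ rewrite (reassoc2 (eq_sym (epost_comp E _ _)))
               | rewrite <- (epost_comp E)
               | rewrite (reassoc2 (eq_sym (epre_comp E _ _)))
               | rewrite <- (epre_comp E) ];
  rewrite ?(ecomp_assoc E).

Section EFunLemmas.
Variables (M : MonCat) (C D : ECatData M) (F : EFunData C D) (H : is_EFun F).

Lemma efh_post (x y z : C) (v : elt y z) :
  efh F x z ∘ epost v = epost (eapp F v) ∘ efh F x y.
Proof.
unfold epost, eapp. ra. rw (efh_cmp H x y z). rewrite tlunit_natV.
rw (tmor_cmp_ _ _ _ _). rw (tmor_cmp_ _ _ _ _). now rewrite !cmp_idl, !cmp_idr.
Qed.

Lemma efh_pre (x y z : C) (u : elt x y) :
  efh F x z ∘ epre u = epre (eapp F u) ∘ efh F y z.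
Proof.
unfold epre, eapp. ra. rw (efh_cmp H x y z). rewrite trunit_natV.
rw (tmor_cmp_ _ _ _ _). rw (tmor_cmp_ _ _ _ _). now rewrite !cmp_idl, !cmp_idr.
Qed.

Lemma eapp_comp (x y z : C) (v : elt y z) (u : elt x y) :
  eapp F (ecomp v u) = ecomp (eapp F v) (eapp F u).
Proof. unfold eapp at 1, ecomp. rw (efh_post _). reflexivity. Qed.

Lemma eapp_id (x : C) : eapp F (eid x) = eid (F x).
Proof. apply (efh_id H). Qed.

End EFunLemmas.

Arguments efh_post {M C D F} H {x y z} v.
Arguments efh_pre {M C D F} H {x y z} u.
Arguments eapp_comp {M C D F} H {x y z} v u.

Section ChBase.
Variables (M N : MonCat) (P : StrongMon M N).

Definition capp (C : ECatData M) (x y : C) (u : elt x y) :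
    elt (M := N) (C := chbase P C) x y := smor P u ∘ fwd (sunit P).

Lemma smor_post (C : ECatData M) (x y z : C) (v : elt y z) :
  smor P (epost (x := x) v) = epost (C := chbase P C) (capp v).
Proof.
unfold epost, capp; cbn. rewrite !smor_cmp. ra.
rewrite ?tmor_cmpl, ?tmor_cmpr, <- smor_id.
rw (smul_nat P _ _). do 2 f_equal.
apply (cancel_epi (fwd_bwd (tlunit _))). ra.
rewrite bwd_fwd, cmp_idr, <- smul_lunit. rw (eq_sym (smor_cmp P _ _)).
now rewrite bwd_fwd, !smor_id, cmp_idl.
Qed.

Lemma smor_pre (C : ECatData M) (x y z : C) (u : elt x y) :
  smor P (epre (z := z) u) = epre (C := chbase P C) (capp u).
Proof.
unfold epre, capp; cbn. rewrite !smor_cmp. ra.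
rewrite ?tmor_cmpl, ?tmor_cmpr, <- smor_id.
rw (smul_nat P _ _). do 2 f_equal.
apply (cancel_epi (fwd_bwd (trunit _))). ra.
rewrite bwd_fwd, cmp_idr, <- smul_runit. rw (eq_sym (smor_cmp P _ _)).
now rewrite bwd_fwd, !smor_id, cmp_idl.
Qed.

Lemma capp_comp (C : ECatData M) (x y z : C) (v : elt y z) (u : elt x y) :
  capp (ecomp v u) = ecomp (capp v) (capp u).
Proof.
unfold capp at 1, ecomp. rewrite smor_cmp, smor_post. apply cmp_assoc.
Qed.

End ChBase.

Arguments smor_post {M N} P {C} x {y z} v.
Arguments smor_pre {M N} P {C x y} z u.
Arguments capp {M N} P {C x y} u.
Arguments capp_comp {M N} P {C x y z} v u.

Lemma efun_cmp_efun (M : MonCat) (C D E : ECatData M)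
    (G : EFunData D E) (F : EFunData C D) :
  is_EFun G -> is_EFun F -> is_EFun (efun_cmp G F).
Proof.
intros HG HF. split; intros; cbn.
- ra. now rewrite (efh_id HF), (efh_id HG).
- ra. rewrite (efh_cmp HF). rw (efh_cmp HG _ _ _). now rewrite tmor_cmp_.
Qed.

(** * Coherence of reindexing up to equality of base morphisms *)

Section Coherence.
Variables (S : FinProdCat) (V : IMCData S) (HV : is_IMC V).

Lemma pbcmpE_nat (X Y Z : S) (f : X ~> Y) (g : Y ~> Z) (h : X ~> Z)
    (e : g ∘ f = h) (M N : V Z) (u : M ~> N) :
  fwd (pbcmpE e N) ∘ h ^*₁ u = f ^*₁ (g ^*₁ u) ∘ fwd (pbcmpE e M).
Proof. destruct e. apply (pbcmp_nat HV). Qed.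

Lemma pbcmpE_tensor (X Y Z : S) (f : X ~> Y) (g : Y ~> Z) (h : X ~> Z)
    (e : g ∘ f = h) (M N : V Z) :
  fwd (pbcmpE e (M ⊗ N)) ∘ fwd (smul (pb V h) M N)
  = f ^*₁ fwd (smul (pb V g) M N) ∘ fwd (smul (pb V f) (g ^* M) (g ^* N))
    ∘ (fwd (pbcmpE e M) ⊗₁ fwd (pbcmpE e N)).
Proof. destruct e. apply (pbcmp_tensor HV). Qed.

Lemma pbcmpE_unit (X Y Z : S) (f : X ~> Y) (g : Y ~> Z) (h : X ~> Z)
    (e : g ∘ f = h) :
  fwd (pbcmpE (V := V) e tunit) ∘ fwd (sunit (pb V h))
  = f ^*₁ fwd (sunit (pb V g)) ∘ fwd (sunit (pb V f)).
Proof. destruct e. apply (pbcmp_unit HV). Qed.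

(** With all composites named by variables the equations can be destructed; only [e4] remains, an
    associativity equation, unique by proof irrelevance. *)
Lemma pbcmpE_assoc (X Y Z W : S) (f : X ~> Y) (g : Y ~> Z) (h : Z ~> W)
    (gf : X ~> Z) (hg : Y ~> W) (k : X ~> W) (M : V W)
    (e1 : h ∘ g = hg) (e2 : hg ∘ f = k) (e3 : g ∘ f = gf) (e4 : h ∘ gf = k) :
  f ^*₁ fwd (pbcmpE e1 M) ∘ fwd (pbcmpE e2 M)
  = fwd (pbcmpE e3 (h ^* M)) ∘ fwd (pbcmpE e4 M).
Proof.
destruct e1, e2, e3. cbn.
rewrite (proof_irrelevance _ e4 (eq_sym (cmp_assoc h g f))).
apply (pbcmp_assoc HV).
Qed.

(** The coherence solved for inverses; in this form it says that the pullback maps [gpl] compose. *)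
Lemma pbcmpE_assocV (X Y Z W : S) (f : X ~> Y) (g : Y ~> Z) (h : Z ~> W)
    (gf : X ~> Z) (hg : Y ~> W) (k : X ~> W) (M : V W)
    (e1 : h ∘ g = hg) (e2 : hg ∘ f = k) (e3 : g ∘ f = gf) (e4 : h ∘ gf = k) :
  bwd (pbcmpE e2 M) ∘ f ^*₁ bwd (pbcmpE e1 M)
    ∘ fwd (pbcmpE e3 (h ^* M))
  = bwd (pbcmpE e4 M).
Proof.
apply (cancel_epi (fwd_bwd (pbcmpE e4 M))). ra.
rw (eq_sym (pbcmpE_assoc _ e1 e2 e3 e4)).
rw (eq_sym (smor_cmp (pb V f) _ _)).
now rewrite bwd_fwd, smor_id, cmp_idl, !bwd_fwd.
Qed.

Lemma pbcmpE_idl (X Y : S) (f : X ~> Y) (h : Y ~> Y) (M : V Y)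
    (e : idm Y = h) (e' : h ∘ f = f) :
  fwd (pbcmpE e' M) = f ^*₁ fwd (pbidE e M).
Proof.
destruct e. cbn. rewrite (proof_irrelevance _ e' (cmp_idl f)).
apply (pbcmp_idl HV).
Qed.

Lemma pbcmpE_idr (X Y : S) (f : X ~> Y) (h : X ~> X) (M : V Y)
    (e : idm X = h) (e' : f ∘ h = f) :
  fwd (pbcmpE e' M) = fwd (pbidE e (f ^* M)).
Proof.
destruct e. cbn. rewrite (proof_irrelevance _ e' (cmp_idr f)).
apply (pbcmp_idr HV).
Qed.

Lemma pbidE_nat (X : S) (h : X ~> X) (e : idm X = h) (M N : V X) (u : M ~> N) :
  fwd (pbidE e N) ∘ u = h ^*₁ u ∘ fwd (pbidE e M).
Proof. destruct e. apply (pbid_nat HV). Qed.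

End Coherence.

(** * Systems of hom-objects *)

(** A V-category indexed by the morphisms out of all [W]: [khom b a x y] is
    the hom-object over [W] from the pullback of [x] along [a] to that of [y]
    along [b], and [kpl t] identifies its pullback along [t] with the
    corresponding hom-object over the domain of [t].  Both large V-categories
    ([⟨b, a⟩^* B(x, y)]) and indexed ones ([A^W(a^* x, b^* y)]) give examples. *)
Record KSys (S : FinProdCat) (V : IMCData S) := {
  kob : S -> Type;
  khom : forall (W X Y : S) (b : W ~> Y) (a : W ~> X), kob X -> kob Y -> V W;
  kid : forall (W X : S) (a : W ~> X) (x : kob X), tunit ~> khom a a x x;
  kcm : forall (W X Y Z : S) (c : W ~> Z) (b : W ~> Y) (a : W ~> X)
    (x : kob X) (y : kob Y) (z : kob Z),
    khom c b y z ⊗ khom b a x y ~> khom c a x z;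
  kpl : forall (W' W X Y : S) (t : W' ~> W) (b : W ~> Y) (a : W ~> X)
    (b' : W' ~> Y) (a' : W' ~> X) (eb : b ∘ t = b') (ea : a ∘ t = a')
    (x : kob X) (y : kob Y), t ^* khom b a x y ~> khom b' a' x y;
  kplV : forall (W' W X Y : S) (t : W' ~> W) (b : W ~> Y) (a : W ~> X)
    (b' : W' ~> Y) (a' : W' ~> X) (eb : b ∘ t = b') (ea : a ∘ t = a')
    (x : kob X) (y : kob Y), khom b' a' x y ~> t ^* khom b a x y;
  kassoc : forall (W X Y Z U : S) (d : W ~> U) (c : W ~> Z) (b : W ~> Y)
    (a : W ~> X) (x : kob X) (y : kob Y) (z : kob Z) (w : kob U),
    kcm d b a x y w ∘ (kcm d c b y z w ⊗₁ idm (khom b a x y))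
    = kcm d c a x z w ∘ (idm (khom d c z w) ⊗₁ kcm c b a x y z)
      ∘ fwd (tassoc (khom d c z w) (khom c b y z) (khom b a x y));
  kidl : forall (W X Y : S) (b : W ~> Y) (a : W ~> X) (x : kob X) (y : kob Y),
    kcm b b a x y y ∘ (kid b y ⊗₁ idm (khom b a x y))
    = fwd (tlunit (khom b a x y));
  kidr : forall (W X Y : S) (b : W ~> Y) (a : W ~> X) (x : kob X) (y : kob Y),
    kcm b a a x x y ∘ (idm (khom b a x y) ⊗₁ kid a x)
    = fwd (trunit (khom b a x y));
  kpl_kplV : forall (W' W X Y : S) (t : W' ~> W) (b : W ~> Y) (a : W ~> X)
    (b' : W' ~> Y) (a' : W' ~> X) (eb : b ∘ t = b') (ea : a ∘ t = a')
    (x : kob X) (y : kob Y), kpl eb ea x y ∘ kplV eb ea x y = idm _;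
  kplV_kpl : forall (W' W X Y : S) (t : W' ~> W) (b : W ~> Y) (a : W ~> X)
    (b' : W' ~> Y) (a' : W' ~> X) (eb : b ∘ t = b') (ea : a ∘ t = a')
    (x : kob X) (y : kob Y), kplV eb ea x y ∘ kpl eb ea x y = idm _;
  kpl_kpl : forall (W'' W' W X Y : S) (s : W'' ~> W') (t : W' ~> W)
    (st : W'' ~> W) (e : t ∘ s = st) (b : W ~> Y) (a : W ~> X)
    (b1 : W' ~> Y) (a1 : W' ~> X) (b2 : W'' ~> Y) (a2 : W'' ~> X)
    (eb1 : b ∘ t = b1) (ea1 : a ∘ t = a1) (eb2 : b1 ∘ s = b2)
    (ea2 : a1 ∘ s = a2) (eb3 : b ∘ st = b2) (ea3 : a ∘ st = a2)
    (x : kob X) (y : kob Y),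
    kpl eb2 ea2 x y ∘ s ^*₁ kpl eb1 ea1 x y ∘ fwd (pbcmpE e _)
    = kpl eb3 ea3 x y;
  kpl_idm : forall (W X Y : S) (b : W ~> Y) (a : W ~> X)
    (eb : b ∘ idm W = b) (ea : a ∘ idm W = a) (x : kob X) (y : kob Y),
    kpl eb ea x y ∘ fwd (pbid V _) = idm (khom b a x y);
  kpl_kcm : forall (W' W X Y Z : S) (t : W' ~> W)
    (c : W ~> Z) (b : W ~> Y) (a : W ~> X)
    (c' : W' ~> Z) (b' : W' ~> Y) (a' : W' ~> X)
    (ec : c ∘ t = c') (eb : b ∘ t = b') (ea : a ∘ t = a')
    (x : kob X) (y : kob Y) (z : kob Z),
    kpl ec ea x z ∘ t ^*₁ kcm c b a x y z ∘ fwd (smul (pb V t) _ _)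
    = kcm c' b' a' x y z ∘ (kpl ec eb y z ⊗₁ kpl eb ea x y);
  kpl_kid : forall (W' W X : S) (t : W' ~> W) (a : W ~> X) (a' : W' ~> X)
    (ea ea' : a ∘ t = a') (x : kob X),
    kpl ea ea' x x ∘ t ^*₁ kid a x ∘ fwd (sunit (pb V t)) = kid a' x
}.
Arguments kid {S V k W X} a x.
Arguments khom {S V k W X Y} b a x y.
Arguments kcm {S V k W X Y Z} c b a x y z.
Arguments kpl {S V k W' W X Y t b a b' a'} eb ea x y.
Arguments kplV {S V k W' W X Y t b a b' a'} eb ea x y.

Section KCalculus.
Variables (S : FinProdCat) (V : IMCData S) (HV : is_IMC V) (K : KSys V).

(** Over a fixed [W], objects equipped with a morphism from [W] to their extent form a V^W-category,
    so the calculus of enriched categories applies to a system pointwise. *)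
Record kobj (W : S) := KObj { kext : S; kbase : kob K kext; kmap : W ~> kext }.

Definition kcat (W : S) : ECatData (V W) :=
  {| eob := kobj W;
     ehom := fun x y => khom (kmap y) (kmap x) (kbase x) (kbase y);
     eid := fun x => kid (kmap x) (kbase x);
     ecmp := fun x y z =>
       kcm (kmap z) (kmap y) (kmap x) (kbase x) (kbase y) (kbase z) |}.

Lemma kcat_ecat (W : S) : is_ECat (kcat W).
Proof. split; intros; cbn; [apply kassoc | apply kidl | apply kidr]. Qed.

Definition kpullfun (W' W : S) (t : W' ~> W) :
    EFunData (chbase (pb V t) (kcat W)) (kcat W') :=
  Build_EFunData (C := chbase (pb V t) (kcat W)) (D := kcat W')
    (efo := fun x : kobj W => KObj (kbase x) (kmap x ∘ t))
    (fun x y : kobj W => kpl eq_refl eq_refl (kbase x) (kbase y)).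

Lemma kpullfun_efun (W' W : S) (t : W' ~> W) : is_EFun (kpullfun t).
Proof.
split; intros; cbn.
- rewrite <- cmp_assoc. apply kpl_kid.
- rewrite <- cmp_assoc. apply kpl_kcm.
Qed.

(** The operations of [kcat W] with objects and base morphisms as separate arguments: they unfold to
    the same terms, but unification need not invent a [KObj]. *)
Definition kpost (W X Y Z : S) (c : W ~> Z) (b : W ~> Y) (a : W ~> X)
    (x : kob K X) (y : kob K Y) (z : kob K Z)
    (v : tunit ~> khom c b y z) : khom b a x y ~> khom c a x z :=
  kcm c b a x y z ∘ (v ⊗₁ idm _) ∘ bwd (tlunit _).

Definition kpre (W X Y Z : S) (c : W ~> Z) (b : W ~> Y) (a : W ~> X)
    (x : kob K X) (y : kob K Y) (z : kob K Z)
    (u : tunit ~> khom b a x y) : khom c b y z ~> khom c a x z :=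
  kcm c b a x y z ∘ (idm _ ⊗₁ u) ∘ bwd (trunit _).

Definition kcomp (W X Y Z : S) (c : W ~> Z) (b : W ~> Y) (a : W ~> X)
    (x : kob K X) (y : kob K Y) (z : kob K Z)
    (v : tunit ~> khom c b y z) (u : tunit ~> khom b a x y) :
    tunit ~> khom c a x z := kpost a x v ∘ u.

Definition kapp (W' W X Y : S) (t : W' ~> W) (b : W ~> Y) (a : W ~> X)
    (b' : W' ~> Y) (a' : W' ~> X) (eb : b ∘ t = b') (ea : a ∘ t = a')
    (x : kob K X) (y : kob K Y) (u : tunit ~> khom b a x y) :
    tunit ~> khom b' a' x y :=
  kpl eb ea x y ∘ t ^*₁ u ∘ fwd (sunit (pb V t)).

End KCalculus.
Arguments KObj {S V K W kext} kbase kmap.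
Arguments kpost {S V K W X Y Z c b} a {x y z} v.
Arguments kpre {S V K W X Y Z} c {b a x y z} u.
Arguments kcomp {S V K W X Y Z c b a x y z} v u.
Arguments kapp {S V K W' W X Y t b a b' a'} eb ea {x y} u.

Section KLemmas.
Variables (S : FinProdCat) (V : IMCData S) (HV : is_IMC V) (K : KSys V).
Variables (W X Y Z U : S) (d : W ~> U) (c : W ~> Z) (b : W ~> Y) (a : W ~> X).
Variables (x : kob K X) (y : kob K Y) (z : kob K Z) (w : kob K U).

Lemma kpost_id : kpost a (kid b y) = idm (khom b a x y).
Proof. exact (epost_id (kcat_ecat K W) (KObj x a) (KObj y b)). Qed.

Lemma kpre_id : kpre b (kid a x) = idm (khom b a x y).
Proof. exact (epre_id (kcat_ecat K W) (KObj x a) (KObj y b)). Qed.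

Lemma kpost_kpre (v : tunit ~> khom d c z w) (u : tunit ~> khom b a x y) :
  kpost a v ∘ kpre c u = kpre d u ∘ kpost b v.
Proof.
exact (epost_epre (kcat_ecat K W)
  (x := KObj x a) (y := KObj y b) (z := KObj z c) (w := KObj w d) v u).
Qed.

Lemma kcomp_pre (v : tunit ~> khom c b y z) (u : tunit ~> khom b a x y) :
  kcomp v u = kpre c u ∘ v.
Proof.
exact (ecomp_pre (C := kcat K W)
  (x := KObj x a) (y := KObj y b) (z := KObj z c) v u).
Qed.

Lemma kpost_comp (v : tunit ~> khom d c z w) (u : tunit ~> khom c b y z) :
  kpost (x := x) a (kcomp v u) = kpost a v ∘ kpost a u.
Proof.
exact (epost_comp (kcat_ecat K W)
  (x := KObj x a) (y := KObj y b) (z := KObj z c) (w := KObj w d) v u).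
Qed.

Lemma kpre_comp (v : tunit ~> khom c b y z) (u : tunit ~> khom b a x y) :
  kpre (z := w) d (kcomp v u) = kpre d u ∘ kpre d v.
Proof.
exact (epre_comp (kcat_ecat K W)
  (x := KObj x a) (y := KObj y b) (z := KObj z c) (w := KObj w d) v u).
Qed.

Lemma kcm_conj (X' Y' Z' : S) (a' : W ~> X') (b' : W ~> Y') (c' : W ~> Z')
    (x' : kob K X') (y' : kob K Y') (z' : kob K Z')
    (m : tunit ~> khom a a' x' x) (n : tunit ~> khom c' c z z')
    (r : tunit ~> khom b b' y' y) (v : tunit ~> khom b' b y y') :
  kcomp r v = kid b y ->
  kpost a' n ∘ kpre c m ∘ kcm c b a x y z
  = kcm c' b' a' x' y' z' ∘ ((kpost b' n ∘ kpre c r) ⊗₁ (kpost a' v ∘ kpre b m)).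
Proof.
exact (ecmp_conj (kcat_ecat K W)
  (x := KObj x a) (y := KObj y b) (z := KObj z c)
  (x' := KObj x' a') (y' := KObj y' b') (z' := KObj z' c')
  (u := m) (w := n) (c := r) (v := v)).
Qed.

Lemma kcomp_assoc (t : tunit ~> khom d c z w) (v : tunit ~> khom c b y z)
    (u : tunit ~> khom b a x y) :
  kcomp (kcomp t v) u = kcomp t (kcomp v u).
Proof.
exact (ecomp_assoc (kcat_ecat K W)
  (x := KObj x a) (y := KObj y b) (z := KObj z c) (w := KObj w d) t v u).
Qed.

Lemma kcomp_idl (u : tunit ~> khom b a x y) : kcomp (kid b y) u = u.
Proof.
exact (ecomp_idl (kcat_ecat K W) (x := KObj x a) (y := KObj y b) u).
Qed.

Lemma kcomp_idr (u : tunit ~> khom b a x y) : kcomp u (kid a x) = u.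
Proof.
exact (ecomp_idr (kcat_ecat K W) (x := KObj x a) (y := KObj y b) u).
Qed.

Variables (W' : S) (t : W' ~> W).
Variables (c' : W' ~> Z) (b' : W' ~> Y) (a' : W' ~> X).
Variables (ec : c ∘ t = c') (eb : b ∘ t = b') (ea : a ∘ t = a').

Lemma kpl_post (v : tunit ~> khom c b y z) :
  kpl ec ea x z ∘ t ^*₁ kpost a v = kpost a' (kapp ec eb v) ∘ kpl eb ea x y.
Proof.
destruct ec, eb, ea.
refine (eq_trans (f_equal (fun q => _ ∘ q)
  (smor_post (pb V t) (C := kcat K W)
     (KObj x a) (y := KObj y b) (z := KObj z c) v)) _).
unfold kapp. rewrite cmp_assoc.
exact (efh_post (kpullfun_efun K t)
  (x := KObj x a) (y := KObj y b) (z := KObj z c) _).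
Qed.

Lemma kpl_pre (u : tunit ~> khom b a x y) :
  kpl ec ea x z ∘ t ^*₁ kpre c u = kpre c' (kapp eb ea u) ∘ kpl ec eb y z.
Proof.
destruct ec, eb, ea.
refine (eq_trans (f_equal (fun q => _ ∘ q)
  (smor_pre (pb V t) (C := kcat K W)
     (x := KObj x a) (y := KObj y b) (KObj z c) u)) _).
unfold kapp. rewrite cmp_assoc.
exact (efh_pre (kpullfun_efun K t)
  (x := KObj x a) (y := KObj y b) (z := KObj z c) _).
Qed.

Lemma kapp_comp (v : tunit ~> khom c b y z) (u : tunit ~> khom b a x y) :
  kapp ec ea (kcomp v u) = kcomp (kapp ec eb v) (kapp eb ea u).
Proof.
unfold kcomp, kapp at 1. rewrite smor_cmp. ra. rw kpl_post.
unfold kapp. now ra.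
Qed.

Lemma kapp_kid (ea' : a ∘ t = a') : kapp ea ea' (kid a x) = kid a' x.
Proof. apply kpl_kid. Qed.

Variables (W'' : S) (s : W'' ~> W') (b'' : W'' ~> Y) (a'' : W'' ~> X).
Variables (eb' : b' ∘ s = b'') (ea' : a' ∘ s = a'').

Lemma kapp_kapp (st : W'' ~> W) (e : t ∘ s = st)
    (eb'' : b ∘ st = b'') (ea'' : a ∘ st = a'') (u : tunit ~> khom b a x y) :
  kapp eb' ea' (kapp eb ea u) = kapp eb'' ea'' u.
Proof.
unfold kapp. rewrite !smor_cmp. ra.
rewrite <- (kpl_kpl e eb ea eb' ea' eb'' ea''). ra.
rw (pbcmpE_nat HV e u). now rewrite (pbcmpE_unit HV e).
Qed.
End KLemmas.
Arguments kpost_comp {S V K W X Y Z U d c b a x y z w} v u.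
Arguments kpre_comp {S V K W X Y Z U d c b a x y z w} v u.
Arguments kpost_kpre {S V K W X Y Z U d c b a x y z w} v u.
Arguments kpl_post {S V K W X Y Z c b a x y z W' t c' b' a'} ec eb ea v.
Arguments kpl_pre {S V K W X Y Z c b a x y z W' t c' b' a'} ec eb ea u.

Lemma kapp_idm (S : FinProdCat) (V : IMCData S) (HV : is_IMC V) (K : KSys V)
    (W X Y : S) (b : W ~> Y) (a : W ~> X)
    (eb : b ∘ idm W = b) (ea : a ∘ idm W = a) (x : kob K X) (y : kob K Y)
    (u : tunit ~> khom b a x y) :
  kapp eb ea u = u.
Proof.
unfold kapp. ra. rewrite <- (pbid_unit HV), <- (pbid_nat HV). ra.
rw (kpl_idm eb ea x y). now rewrite cmp_idl.
Qed.

Section KReassoc.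
Variables (S : FinProdCat) (V : IMCData S) (K : KSys V).
Variables (W X Y Z U U' : S) (e : W ~> U') (d : W ~> U) (c : W ~> Z)
  (b : W ~> Y) (a : W ~> X).
Variables (x : kob K X) (y : kob K Y) (z : kob K Z) (u : kob K U) (v : kob K U').

Lemma kreassoc2 (g : tunit ~> khom d c z u) (f : tunit ~> khom c b y z) h :
  kcomp g f = h ->
  forall k : tunit ~> khom b a x y, kcomp g (kcomp f k) = kcomp h k.
Proof. intros <- k. now rewrite kcomp_assoc. Qed.

Lemma kreassoc3 (i : tunit ~> khom e d u v)
    (g : tunit ~> khom d c z u) (f : tunit ~> khom c b y z) h :
  kcomp i (kcomp g f) = h ->
  forall k : tunit ~> khom b a x y,
    kcomp i (kcomp g (kcomp f k)) = kcomp h k.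
Proof. intros <- k. now rewrite !kcomp_assoc. Qed.
End KReassoc.

(** Brings composites of [kpost]s and [kpre]s to the form
    [kpost _ _ ∘ (kpre _ _ ∘ _)]. *)
Ltac knorm :=
  rewrite ?cmp_assoc;
  repeat (first [ rewrite (reassoc2 (eq_sym (kpost_kpre _ _)))
                | rewrite <- kpost_kpre ]; rewrite ?cmp_assoc);
  repeat first [ rewrite (reassoc2 (eq_sym (kpost_comp _ _)))
               | rewrite <- kpost_comp
               | rewrite (reassoc2 (eq_sym (kpre_comp _ _)))
               | rewrite <- kpre_comp ];
  rewrite ?kcomp_assoc.

Ltac krwx H :=
  first [ rewrite H | rewrite (kreassoc2 H) | rewrite (kreassoc3 H)
        | let H' := open_constr:(H _) in krwx H' ].
Tactic Notation "krw" open_constr(H) :=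
  rewrite ?kcomp_assoc; krwx H; rewrite ?kcomp_assoc.

(** * The system of a large V-category *)

Section Gamma.
Variables (S : FinProdCat) (V : IMCData S) (HV : is_IMC V).
Variables (B : LCatData V).

Definition gpl (W' W X Y : S) (t : W' ~> W) (b : W ~> Y) (a : W ~> X)
    (b' : W' ~> Y) (a' : W' ~> X) (eb : b ∘ t = b') (ea : a ∘ t = a')
    (x : lob B X) (y : lob B Y) : t ^* ghom b a x y ~> ghom b' a' x y :=
  bwd (pbcmpE (pair_cmp eb ea) (lhom x y)).

Definition gplV (W' W X Y : S) (t : W' ~> W) (b : W ~> Y) (a : W ~> X)
    (b' : W' ~> Y) (a' : W' ~> X) (eb : b ∘ t = b') (ea : a ∘ t = a')
    (x : lob B X) (y : lob B Y) : ghom b' a' x y ~> t ^* ghom b a x y :=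
  fwd (pbcmpE (pair_cmp eb ea) (lhom x y)).

Section Pull.
Variables (W' W X Y Z : S) (t : W' ~> W).
Variables (c : W ~> Z) (b : W ~> Y) (a : W ~> X).
Variables (c' : W' ~> Z) (b' : W' ~> Y) (a' : W' ~> X).
Variables (ec : c ∘ t = c') (eb : b ∘ t = b') (ea : a ∘ t = a').
Variables (x : lob B X) (y : lob B Y) (z : lob B Z).

Lemma gpl_gplV : gpl eb ea x y ∘ gplV eb ea x y = idm _.
Proof. apply bwd_fwd. Qed.

Lemma gplV_gpl : gplV eb ea x y ∘ gpl eb ea x y = idm _.
Proof. apply fwd_bwd. Qed.

Lemma gpl_gpl (W'' : S) (s : W'' ~> W') (st : W'' ~> W) (e : t ∘ s = st)
    (b2 : W'' ~> Y) (a2 : W'' ~> X) (eb2 : b' ∘ s = b2)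
    (ea2 : a' ∘ s = a2) (eb3 : b ∘ st = b2) (ea3 : a ∘ st = a2) :
  gpl eb2 ea2 x y ∘ s ^*₁ gpl eb ea x y ∘ fwd (pbcmpE e _)
  = gpl eb3 ea3 x y.
Proof. apply (pbcmpE_assocV HV). Qed.

(** [gcmp c b a] is the pullback of [lc_cmp] along [⟨⟨c, b⟩, a⟩], so both sides are its pullback
    along the composite with [t], up to the coherence of [V] and of its tensor products. *)
Lemma gpl_gcmp :
  gpl ec ea x z ∘ t ^*₁ gcmp c b a x y z ∘ fwd (smul (pb V t) _ _)
  = gcmp c' b' a' x y z ∘ (gpl ec eb y z ⊗₁ gpl eb ea x y).
Proof.
apply (cancel_epi (tmor_iso (fwd_bwd (pbcmpE (pair_cmp ec eb) (lhom y z)))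
                            (fwd_bwd (pbcmpE (pair_cmp eb ea) (lhom x y))))).
unfold gpl. ra. rewrite tmor_cmp_, !bwd_fwd, tmor_id.
rewrite cmp_idr. unfold gcmp, gpl, pull, ghom. rewrite !smor_cmp.
rw (eq_sym (smul_nat (pb V t) _ _)). rewrite tmor_cmp_.
(* [e] says that precomposition with [t] takes the classifying map of [c], [b], [a] to that of [c'],
   [b'], [a']; the rewrites below are coherence squares over it. *)
set (e := pair_cmp (pair_cmp ec eb) ea).
rewrite (pbcmpE_assoc HV _ _ _ e (pair_cmp (tr1_pair c' b' a') (tr2_pair c' b' a'))).
rewrite (pbcmpE_assoc HV _ _ _ e (pair_cmp (tr2_pair c' b' a') (tr3_pair c' b' a'))).
rewrite tmor_cmp. rw (eq_sym (pbcmpE_tensor HV e _ _)).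
rw (eq_sym (pbcmpE_nat HV e _)).
now rw (pbcmpE_assocV HV _ _ _ e (pair_cmp (tr1_pair c' b' a') (tr3_pair c' b' a'))).
Qed.

Lemma gpl_pull_unit (W'' : S) (s : W'' ~> W') (st : W'' ~> W) (e : t ∘ s = st)
    (b2 : W'' ~> Y) (a2 : W'' ~> X) (eb2 : b' ∘ s = b2)
    (ea2 : a' ∘ s = a2) (eb3 : b ∘ st = b2) (ea3 : a ∘ st = a2)
    (u : tunit ~> ghom b a x y) :
  gpl eb2 ea2 x y ∘ s ^*₁ pull_unit (pair_cmp eb ea) u ∘ fwd (sunit (pb V s))
  = pull_unit (pair_cmp eb3 ea3) u.
Proof.
unfold pull_unit, pull, gpl, ghom in *. rewrite !smor_cmp. ra.
rewrite <- (pbcmpE_assocV HV _ (pair_cmp eb ea) (pair_cmp eb2 ea2) e).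
rw (pbcmpE_nat HV e u). now rewrite (pbcmpE_unit HV e).
Qed.
End Pull.

Lemma gpl_gid (W' W X : S) (t : W' ~> W) (a : W ~> X) (a' : W' ~> X)
    (ea ea' : a ∘ t = a') (x : lob B X) :
  gpl ea ea' x x ∘ t ^*₁ gid a x ∘ fwd (sunit (pb V t)) = gid a' x.
Proof. apply gpl_pull_unit, ea. Qed.

Hypothesis HB : is_LCat B.

(** The axiom is the case of the four projections out of the quadruple product; any [d], [c], [b],
    [a] arise from these by precomposition with [t], and composition is stable under pullback. The
    unit laws are treated alike. *)
Lemma gassoc (W X Y Z U : S) (d : W ~> U) (c : W ~> Z) (b : W ~> Y)
    (a : W ~> X) (x : lob B X) (y : lob B Y) (z : lob B Z) (w : lob B U) :
  gcmp d b a x y w ∘ (gcmp d c b y z w ⊗₁ idm (ghom b a x y))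
  = gcmp d c a x z w ∘ (idm (ghom d c z w) ⊗₁ gcmp c b a x y z)
    ∘ fwd (tassoc (ghom d c z w) (ghom c b y z) (ghom b a x y)).
Proof.
set (t := ⟨⟨⟨d, c⟩, b⟩, a⟩).
assert (ed : (tr1 U Z Y ∘ pr1 (prd (prd U Z) Y) X) ∘ t = d)
  by (unfold t; now rewrite cmp_assoc, pr1_pair, tr1_pair).
assert (ec : (tr2 U Z Y ∘ pr1 (prd (prd U Z) Y) X) ∘ t = c)
  by (unfold t; now rewrite cmp_assoc, pr1_pair, tr2_pair).
assert (eb : (tr3 U Z Y ∘ pr1 (prd (prd U Z) Y) X) ∘ t = b)
  by (unfold t; now rewrite cmp_assoc, pr1_pair, tr3_pair).
assert (ea : pr2 (prd (prd U Z) Y) X ∘ t = a) by apply pr2_pair.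
apply (assoc_transfer (gpl_gplV ed ec z w) (gpl_gplV ec eb y z)
  (gpl_gplV eb ea x y)
  (eq_sym (eq_trans (eq_sym (cmp_assoc _ _ _)) (gpl_gcmp ed ec eb y z w)))
  (eq_sym (eq_trans (eq_sym (cmp_assoc _ _ _)) (gpl_gcmp ec eb ea x y z)))
  (eq_sym (eq_trans (eq_sym (cmp_assoc _ _ _)) (gpl_gcmp ed eb ea x y w)))
  (eq_sym (eq_trans (eq_sym (cmp_assoc _ _ _)) (gpl_gcmp ed ec ea x z w)))).
apply assoc_image, (lc_assoc HB).
Qed.

Lemma gidl (W X Y : S) (b : W ~> Y) (a : W ~> X) (x : lob B X) (y : lob B Y) :
  gcmp b b a x y y ∘ (gid b y ⊗₁ idm (ghom b a x y))
  = fwd (tlunit (ghom b a x y)).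
Proof.
assert (eb := pr1_pair b a). assert (ea := pr2_pair b a).
apply (lunit_transfer (gpl_gplV eb ea x y)
  (eq_trans (eq_sym (cmp_assoc _ _ _)) (gpl_gid eb eb y))
  (eq_sym (eq_trans (eq_sym (cmp_assoc _ _ _)) (gpl_gcmp eb eb ea x y y)))).
apply lunit_image, (lc_idl HB).
Qed.

Lemma gidr (W X Y : S) (b : W ~> Y) (a : W ~> X) (x : lob B X) (y : lob B Y) :
  gcmp b a a x x y ∘ (idm (ghom b a x y) ⊗₁ gid a x)
  = fwd (trunit (ghom b a x y)).
Proof.
assert (eb := pr1_pair b a). assert (ea := pr2_pair b a).
apply (runit_transfer (gpl_gplV eb ea x y)
  (eq_trans (eq_sym (cmp_assoc _ _ _)) (gpl_gid ea ea x))
  (eq_sym (eq_trans (eq_sym (cmp_assoc _ _ _)) (gpl_gcmp eb ea ea x x y)))).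
apply runit_image, (lc_idr HB).
Qed.

Lemma gpl_idm (W X Y : S) (b : W ~> Y) (a : W ~> X)
    (eb : b ∘ idm W = b) (ea : a ∘ idm W = a) (x : lob B X) (y : lob B Y) :
  gpl eb ea x y ∘ fwd (pbid V _) = idm (ghom b a x y).
Proof.
unfold gpl. change (pbid V (ghom b a x y)) with (pbidE eq_refl (ghom b a x y)).
unfold ghom. rewrite <- (pbcmpE_idr HV _ eq_refl (pair_cmp eb ea)).
apply bwd_fwd.
Qed.

Definition gamma : KSys V :=
  {| kob := lob B;
     khom := fun W X Y b a x y => ghom b a x y;
     kid := fun W X a x => gid a x;
     kcm := fun W X Y Z c b a x y z => gcmp c b a x y z;
     kpl := fun W' W X Y t b a b' a' eb ea x y => gpl eb ea x y;
     kplV := fun W' W X Y t b a b' a' eb ea x y => gplV eb ea x y;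
     kassoc := gassoc; kidl := gidl; kidr := gidr;
     kpl_kplV := gpl_gplV; kplV_kpl := gplV_gpl;
     kpl_kpl := fun W'' W' W X Y s t st e b a b1 a1 b2 a2
       eb1 ea1 eb2 ea2 eb3 ea3 x y => gpl_gpl eb1 ea1 x y e eb2 ea2 eb3 ea3;
     kpl_idm := gpl_idm;
     kpl_kcm := gpl_gcmp; kpl_kid := gpl_gid |}.

(** [gid] at the identity is [lc_id] pulled back along an identity, so the two agree by coherence
    and not by computation. *)
Lemma gid_idm (X : S) (x : lob B X) : gid (idm X) x = lc_id x.
Proof. exact (kapp_idm HV (K := gamma) _ _ (lc_id x)). Qed.

End Gamma.

(** * Functors between systems of hom-objects *)

Record KFun (S : FinProdCat) (V : IMCData S) (K L : KSys V) := {
  kfo :> forall X, kob K X -> kob L X;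
  kfh : forall (W X Y : S) (b : W ~> Y) (a : W ~> X) (x : kob K X) (y : kob K Y),
    khom b a x y ~> khom b a (kfo x) (kfo y);
  kfh_kid : forall (W X : S) (a : W ~> X) (x : kob K X),
    kfh a a x x ∘ kid a x = kid a (kfo x);
  kfh_kcm : forall (W X Y Z : S) (c : W ~> Z) (b : W ~> Y) (a : W ~> X)
    (x : kob K X) (y : kob K Y) (z : kob K Z),
    kfh c a x z ∘ kcm c b a x y z
    = kcm c b a (kfo x) (kfo y) (kfo z) ∘ (kfh c b y z ⊗₁ kfh b a x y);
  kfh_kpl : forall (W' W X Y : S) (t : W' ~> W) (b : W ~> Y) (a : W ~> X)
    (b' : W' ~> Y) (a' : W' ~> X) (eb : b ∘ t = b') (ea : a ∘ t = a')
    (x : kob K X) (y : kob K Y),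
    kfh b' a' x y ∘ kpl eb ea x y
    = kpl eb ea (kfo x) (kfo y) ∘ t ^*₁ kfh b a x y
}.
Arguments kfo {S V K L} k {X} x.
Arguments kfh {S V K L} k {W X Y} b a x y.

Section KFunLemmas.
Variables (S : FinProdCat) (V : IMCData S) (HV : is_IMC V) (K L : KSys V).
Variable F : KFun K L.

Definition kfun_efun (W : S) : EFunData (kcat K W) (kcat L W) :=
  Build_EFunData (C := kcat K W) (D := kcat L W)
    (efo := fun x : kobj K W => KObj (kfo F (kbase x)) (kmap x))
    (fun x y : kobj K W => kfh F (kmap y) (kmap x) (kbase x) (kbase y)).

Lemma kfun_is_efun (W : S) : is_EFun (kfun_efun W).
Proof. split; intros; cbn; [apply kfh_kid | apply kfh_kcm]. Qed.

Variables (W X Y Z : S) (c : W ~> Z) (b : W ~> Y) (a : W ~> X).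
Variables (x : kob K X) (y : kob K Y) (z : kob K Z).

Lemma kfh_post (v : tunit ~> khom c b y z) :
  kfh F c a x z ∘ kpost a v = kpost a (kfh F c b y z ∘ v) ∘ kfh F b a x y.
Proof.
exact (efh_post (kfun_is_efun W)
  (x := KObj x a) (y := KObj y b) (z := KObj z c) v).
Qed.

Lemma kfh_pre (u : tunit ~> khom b a x y) :
  kfh F c a x z ∘ kpre c u = kpre c (kfh F b a x y ∘ u) ∘ kfh F c b y z.
Proof.
exact (efh_pre (kfun_is_efun W)
  (x := KObj x a) (y := KObj y b) (z := KObj z c) u).
Qed.

Lemma kfh_kcomp (v : tunit ~> khom c b y z) (u : tunit ~> khom b a x y) :
  kfh F c a x z ∘ kcomp v u
  = kcomp (kfh F c b y z ∘ v) (kfh F b a x y ∘ u).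
Proof.
exact (eapp_comp (kfun_is_efun W)
  (x := KObj x a) (y := KObj y b) (z := KObj z c) v u).
Qed.

Lemma kfh_kapp (W' : S) (t : W' ~> W) (b' : W' ~> Y) (a' : W' ~> X)
    (eb : b ∘ t = b') (ea : a ∘ t = a') (u : tunit ~> khom b a x y) :
  kfh F b' a' x y ∘ kapp eb ea u = kapp eb ea (kfh F b a x y ∘ u).
Proof.
unfold kapp. rewrite smor_cmp. ra. now rw (kfh_kpl F eb ea x y).
Qed.
End KFunLemmas.
Arguments kfh_post {S V K L} F {W X Y Z c b a x y z} v.
Arguments kfh_pre {S V K L} F {W X Y Z c b a x y z} u.
Arguments kfh_kcomp {S V K L} F {W X Y Z c b a x y z} v u.
Arguments kfh_kapp {S V K L} F {W X Y b a x y W' t b' a'} eb ea u.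

Section KFunOps.
Variables (S : FinProdCat) (V : IMCData S).

Definition kfun_cmp (K L M : KSys V) (G : KFun L M) (F : KFun K L) : KFun K M.
Proof.
refine {| kfo := fun X x => kfo G (kfo F x);
  kfh := fun W X Y b a x y => kfh G b a (kfo F x) (kfo F y) ∘ kfh F b a x y |}.
- intros. ra. now rewrite kfh_kid, kfh_kid.
- intros. ra. rewrite kfh_kcm. rw (kfh_kcm G _ _ _ _ _ _). now rewrite tmor_cmp_.
- intros. ra. rewrite kfh_kpl. rw (kfh_kpl G eb ea _ _). now rewrite smor_cmp.
Defined.
End KFunOps.

(** * The large V-category of a system *)

Section LargeOfSystem.
Variables (S : FinProdCat) (V : IMCData S) (HV : is_IMC V) (K : KSys V).

(** For [K := phi HA] this is convertible with [theta_cat A]. [lc_cmp] is the composition of the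
    system at the projections of the triple product, rewritten in terms of pullbacks from binary
    products. *)
Definition lsys : LCatData V :=
  {| lob := kob K;
     lhom := fun X Y x y => khom (pr1 Y X) (pr2 Y X) x y;
     lc_id := fun X x =>
       kplV (pr1_pair (idm X) (idm X)) (pr2_pair (idm X) (idm X)) x x
       ∘ kid (idm X) x;
     lc_cmp := fun X Y Z x y z =>
       let c := tr1 Z Y X in
       let b := tr2 Z Y X in
       let a := tr3 Z Y X in
       kplV (pr1_pair c a) (pr2_pair c a) x z
       ∘ kcm c b a x y z
       ∘ (kpl (pr1_pair c b) (pr2_pair c b) y z
          ⊗₁ kpl (pr1_pair b a) (pr2_pair b a) x y) |}.

Definition th (W X Y : S) (b : W ~> Y) (a : W ~> X) (x : kob K X) (y : kob K Y) :
    ghom (B := lsys) b a x y ~> khom b a x y :=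
  kpl (pr1_pair b a) (pr2_pair b a) x y.

Definition thV (W X Y : S) (b : W ~> Y) (a : W ~> X) (x : kob K X) (y : kob K Y) :
    khom b a x y ~> ghom (B := lsys) b a x y :=
  kplV (pr1_pair b a) (pr2_pair b a) x y.

Lemma th_thV (W X Y : S) (b : W ~> Y) (a : W ~> X) (x : kob K X) (y : kob K Y) :
  th b a x y ∘ thV b a x y = idm _.
Proof. apply kpl_kplV. Qed.

Lemma thV_th (W X Y : S) (b : W ~> Y) (a : W ~> X) (x : kob K X) (y : kob K Y) :
  thV b a x y ∘ th b a x y = idm _.
Proof. apply kplV_kpl. Qed.

(** Both sides pull back from the universal pair of projections, in one step along [⟨b', a'⟩] or in
    two along [⟨b, a⟩] and [t]; this is [kpl_kpl]. *)
Lemma th_gpl (W' W X Y : S) (t : W' ~> W) (b : W ~> Y) (a : W ~> X)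
    (b' : W' ~> Y) (a' : W' ~> X) (eb : b ∘ t = b') (ea : a ∘ t = a')
    (x : kob K X) (y : kob K Y) :
  th b' a' x y ∘ gpl (B := lsys) eb ea x y = kpl eb ea x y ∘ t ^*₁ th b a x y.
Proof.
apply (cancel_epi (fwd_bwd (pbcmpE (pair_cmp eb ea)
  (khom (pr1 Y X) (pr2 Y X) x y)))). ra.
unfold gpl. cbn [lsys lhom]. rewrite bwd_fwd, cmp_idr.
symmetry. rewrite <- cmp_assoc. apply kpl_kpl.
Qed.

Lemma th_lc_id (X : S) (x : kob K X) :
  th (idm X) (idm X) x x ∘ lc_id (l := lsys) x = kid (idm X) x.
Proof.
change (lc_id (l := lsys) x) with (thV (idm X) (idm X) x x ∘ kid (idm X) x).
rw (th_thV _ _ _ _). apply cmp_idl.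
Qed.

Lemma th_gid (W X : S) (a : W ~> X) (x : kob K X) :
  th a a x x ∘ gid (B := lsys) a x = kid a x.
Proof.
transitivity (th a a x x ∘ ((gpl (B := lsys) (cmp_idl a) (cmp_idl a) x x
  ∘ smor (pb V a) (b := ghom (B := lsys) (idm X) (idm X) x x) (lc_id (l := lsys) x))
  ∘ fwd (sunit (pb V a)))).
{ reflexivity. }
rw (th_gpl _ _ _ _). rw (eq_sym (smor_cmp (pb V a) _ _)).
rewrite th_lc_id, <- cmp_assoc. apply kpl_kid.
Qed.

(** [lc_cmp] was defined by conjugating [kcm] over the triple product, so there [th] cancels the
    outer [thV]; pullback along [⟨⟨c, b⟩, a⟩] gives the general case by [kpl_kcm]. *)
Lemma th_gcmp (W X Y Z : S) (c : W ~> Z) (b : W ~> Y) (a : W ~> X)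
    (x : kob K X) (y : kob K Y) (z : kob K Z) :
  th c a x z ∘ gcmp (B := lsys) c b a x y z
  = kcm c b a x y z ∘ (th c b y z ⊗₁ th b a x y).
Proof.
apply (cancel_epi (tmor_iso
  (gpl_gplV (B := lsys) (tr1_pair c b a) (tr2_pair c b a) y z)
  (gpl_gplV (B := lsys) (tr2_pair c b a) (tr3_pair c b a) x y))). ra.
rewrite tmor_cmp_, !th_gpl, tmor_cmp. rw (eq_sym (kpl_kcm _ _ _ _ _ _)).
rw (smul_nat (pb V _) _ _).
(* This is [gcmp] unfolded, with its comparisons displayed as [gpl] and [gplV]; the tensor of the
   two [gplV] then meets that of the two [gpl] and cancels. *)
transitivity (th c a x z
  ∘ (gpl (B := lsys) (tr1_pair c b a) (tr3_pair c b a) x z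
    ∘ smor (pb V ⟨⟨c, b⟩, a⟩) (a := ghom (B := lsys) (tr1 Z Y X) (tr2 Z Y X) y z ⊗ ghom (B := lsys) (tr2 Z Y X) (tr3 Z Y X) x y)
       (b := ghom (B := lsys) (tr1 Z Y X) (tr3 Z Y X) x z) (lc_cmp (l := lsys) x y z)
    ∘ fwd (smul (pb V ⟨⟨c, b⟩, a⟩) _ _)
    ∘ (gplV (B := lsys) (tr1_pair c b a) (tr2_pair c b a) y z
       ⊗₁ gplV (B := lsys) (tr2_pair c b a) (tr3_pair c b a) x y))
  ∘ (gpl (B := lsys) (tr1_pair c b a) (tr2_pair c b a) y z
       ⊗₁ gpl (B := lsys) (tr2_pair c b a) (tr3_pair c b a) x y)).
{ exact (eq_sym (cmp_assoc _ _ _)). }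
rw (tmor_cmp_ _ _ _ _).
rewrite !gplV_gpl, tmor_id, cmp_idr.
rw (th_gpl _ _ _ _). rw (eq_sym (smor_cmp (pb V _) _ _)).
rw (eq_sym (smor_cmp (pb V _) _ _)).
do 3 f_equal.
change (lc_cmp (l := lsys) x y z) with (thV (tr1 Z Y X) (tr3 Z Y X) x z ∘ kcm (tr1 Z Y X) (tr2 Z Y X) (tr3 Z Y X) x y z ∘ (th (tr1 Z Y X) (tr2 Z Y X) y z ⊗₁ th (tr2 Z Y X) (tr3 Z Y X) x y)).
rw (th_thV _ _ _ _). now rewrite cmp_idl.
Qed.

Lemma gcmp_thV (W X Y Z : S) (c : W ~> Z) (b : W ~> Y) (a : W ~> X)
    (x : kob K X) (y : kob K Y) (z : kob K Z) :
  gcmp (B := lsys) c b a x y z ∘ (thV c b y z ⊗₁ thV b a x y)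
  = thV c a x z ∘ kcm c b a x y z.
Proof.
apply (cancel_mono (thV_th c a x z)). rw (th_gcmp _ _ _ _ _ _).
rewrite tmor_cmp_, !th_thV, tmor_id. rw (th_thV _ _ _ _).
now rewrite cmp_idl, cmp_idr.
Qed.

Lemma thV_kid (W X : S) (a : W ~> X) (x : kob K X) :
  thV a a x x ∘ kid a x = gid (B := lsys) a x.
Proof.
apply (cancel_mono (thV_th a a x x)). rw (th_thV _ _ _ _).
now rewrite th_gid, cmp_idl.
Qed.

Lemma lsys_lcat : is_LCat lsys.
Proof.
split.
- intros. apply (assoc_transfer (thV_th d c z w) (thV_th c b y z) (thV_th b a x y)
    (gcmp_thV d c b y z w) (gcmp_thV c b a x y z)
    (gcmp_thV d b a x y w) (gcmp_thV d c a x z w)), kassoc.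
- intros. apply (lunit_transfer (thV_th b a x y) (thV_kid b y)
    (gcmp_thV b b a x y y)), kidl.
- intros. apply (runit_transfer (thV_th b a x y) (thV_kid a x)
    (gcmp_thV b a a x x y)), kidr.
Qed.

Variable H : is_LCat lsys.

Let gsys : KSys V := gamma HV H.

Lemma thV_kpl (W' W X Y : S) (t : W' ~> W) (b : W ~> Y) (a : W ~> X)
    (b' : W' ~> Y) (a' : W' ~> X) (eb : b ∘ t = b') (ea : a ∘ t = a')
    (x : kob K X) (y : kob K Y) :
  thV b' a' x y ∘ kpl eb ea x y = gpl (B := lsys) eb ea x y ∘ t ^*₁ thV b a x y.
Proof.
apply (cancel_mono (thV_th b' a' x y)). rw (th_gpl eb ea x y).
rw (th_thV _ _ _ _). rewrite <- smor_cmp, th_thV, smor_id.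
now rewrite cmp_idl, cmp_idr.
Qed.

Definition thfun : KFun gsys K :=
  {| kfo := (fun X x => x) : forall X, kob gsys X -> kob K X;
     kfh := th : forall W X Y b a (x : kob gsys X) (y : kob gsys Y),
       khom b a x y ~> khom b a (x : kob K X) (y : kob K Y);
     kfh_kid := th_gid; kfh_kcm := th_gcmp;
     kfh_kpl := th_gpl |}.

Definition thVfun : KFun K gsys :=
  {| kfo := (fun X x => x) : forall X, kob K X -> kob gsys X;
     kfh := thV : forall W X Y b a (x : kob K X) (y : kob K Y),
       khom b a x y ~> khom (k := gsys) b a (x : kob gsys X) (y : kob gsys Y);
     kfh_kid := thV_kid;
     kfh_kcm := fun W X Y Z c b a x y z => eq_sym (gcmp_thV c b a x y z);
     kfh_kpl := thV_kpl |}.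

End LargeOfSystem.

(** * Indexed V-functors between large V-categories as functors of systems *)

Section GMap.
Variables (S : FinProdCat) (V : IMCData S) (HV : is_IMC V).
Variables (A B : LCatData V) (F : LIFunData A B).

(** As extent components are identities, [gmap] can be given the target [ghom b a] itself in place
    of [ghom (idm Y ∘ b) (idm X ∘ a)]; this is the form of action required by [KFun]. *)
Definition gfm (W X Y : S) (b : W ~> Y) (a : W ~> X) (x : lob A X) (y : lob A Y) :
    ghom b a x y ~> ghom b a (li_ob F x) (li_ob F y) :=
  gmap (F := F) (cmp_idl b) (cmp_idl a).

Lemma gmap_gpl (W' W X Y : S) (t : W' ~> W) (b : W ~> Y) (a : W ~> X)
    (b0 : W ~> Y) (a0 : W ~> X) (b' : W' ~> Y) (a' : W' ~> X)
    (b0' : W' ~> Y) (a0' : W' ~> X)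
    (eb : b ∘ t = b') (ea : a ∘ t = a') (eb0 : b0 ∘ t = b0') (ea0 : a0 ∘ t = a0')
    (ib : idm Y ∘ b = b0) (ia : idm X ∘ a = a0)
    (ib' : idm Y ∘ b' = b0') (ia' : idm X ∘ a' = a0')
    (x : lob A X) (y : lob A Y) :
  gmap (F := F) ib' ia' ∘ gpl eb ea x y
  = gpl eb0 ea0 (li_ob F x) (li_ob F y) ∘ t ^*₁ gmap (F := F) ib ia.
Proof.
apply (cancel_epi (fwd_bwd (pbcmpE (pair_cmp eb ea) (lhom x y)))).
unfold gmap, pull, gpl, ghom. rewrite !smor_cmp. ra.
rewrite bwd_fwd, cmp_idr.
rewrite <- (pbcmpE_nat HV (pair_cmp eb ea)).
symmetry. apply (reassoc3 (assoc3 (pbcmpE_assocV HV _ _ _ _ _))).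
Qed.

Lemma gfm_gpl (W' W X Y : S) (t : W' ~> W) (b : W ~> Y) (a : W ~> X)
    (b' : W' ~> Y) (a' : W' ~> X) (eb : b ∘ t = b') (ea : a ∘ t = a')
    (x : lob A X) (y : lob A Y) :
  gfm b' a' x y ∘ gpl eb ea x y
  = gpl eb ea (li_ob F x) (li_ob F y) ∘ t ^*₁ gfm b a x y.
Proof. apply gmap_gpl. Qed.

(** The extent components being identities, any pair [(b', e)] with
    [e : idm ∘ b = b'] may be replaced by [(b, cmp_idl b)]. *)
Lemma idl_ind (X Y : S) (b : X ~> Y)
    (P : forall b' : X ~> Y, idm Y ∘ b = b' -> Prop) :
  P b (cmp_idl b) -> forall b' e, P b' e.
Proof.
intros H b' e.
assert (q : b = b') by (rewrite <- e; symmetry; apply cmp_idl).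
destruct q. now rewrite (proof_irrelevance _ e (cmp_idl b)).
Qed.

(** Pulls the equation back along [t]. Preservation of composition thus passes from the projections
    of the triple product, where the axiom states it, to arbitrary base morphisms. *)
Lemma gfm_gcmp_of (W0 W X Y Z : S) (t : W0 ~> W)
    (c : W ~> Z) (b : W ~> Y) (a : W ~> X)
    (c0 : W0 ~> Z) (b0 : W0 ~> Y) (a0 : W0 ~> X)
    (ec : c ∘ t = c0) (eb : b ∘ t = b0) (ea : a ∘ t = a0)
    (x : lob A X) (y : lob A Y) (z : lob A Z) :
  gfm c a x z ∘ gcmp c b a x y z
  = gcmp c b a (li_ob F x) (li_ob F y) (li_ob F z)
    ∘ (gfm c b y z ⊗₁ gfm b a x y) ->
  gfm c0 a0 x z ∘ gcmp c0 b0 a0 x y z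
  = gcmp c0 b0 a0 (li_ob F x) (li_ob F y) (li_ob F z)
    ∘ (gfm c0 b0 y z ⊗₁ gfm b0 a0 x y).
Proof.
intros H.
apply (cancel_epi (tmor_iso (gpl_gplV ec eb y z) (gpl_gplV eb ea x y))). ra.
rewrite tmor_cmp_, !gfm_gpl, tmor_cmp. rw (eq_sym (gpl_gcmp HV _ _ _ _ _ _)).
rw (eq_sym (gpl_gcmp HV _ _ _ _ _ _)). rw (gfm_gpl _ _ _ _).
rw (smul_nat (pb V t) _ _). do 2 rw (eq_sym (smor_cmp (pb V t) _ _)).
now rewrite H.
Qed.

(** Translates between the axiom, whose base morphisms are composites with [idm], and the form
    without them. *)
Lemma gmap_gcmp_iff (W X Y Z : S) (c c' : W ~> Z) (b b' : W ~> Y)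
    (a a' : W ~> X) (ec : idm Z ∘ c = c') (eb : idm Y ∘ b = b')
    (ea : idm X ∘ a = a') (x : lob A X) (y : lob A Y) (z : lob A Z) :
  gmap (F := F) ec ea ∘ gcmp c b a x y z
  = gcmp c' b' a' (li_ob F x) (li_ob F y) (li_ob F z)
    ∘ (gmap (F := F) ec eb ⊗₁ gmap (F := F) eb ea)
  <-> gfm c a x z ∘ gcmp c b a x y z
  = gcmp c b a (li_ob F x) (li_ob F y) (li_ob F z)
    ∘ (gfm c b y z ⊗₁ gfm b a x y).
Proof.
revert c' ec. apply idl_ind. revert b' eb. apply idl_ind.
revert a' ea. apply idl_ind. reflexivity.
Qed.

Lemma lifun_intro :
  (forall X (x : lob A X),
     gfm (idm X) (idm X) x x ∘ lc_id x = gid (idm X) (li_ob F x)) ->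
  (forall X Y Z (x : lob A X) (y : lob A Y) (z : lob A Z),
    let c := tr1 Z Y X in
    let b := tr2 Z Y X in
    let a := tr3 Z Y X in
    gfm c a x z ∘ gcmp c b a x y z
    = gcmp c b a (li_ob F x) (li_ob F y) (li_ob F z)
      ∘ (gfm c b y z ⊗₁ gfm b a x y)) ->
  is_LIFun F.
Proof.
intros H1 H2. split; cbn.
- intros X x. rewrite <- H1. unfold gfm.
  now rewrite (proof_irrelevance _ (cmp_idr _) (cmp_idl (idm X))).
- intros X Y Z x y z. apply (proj2 (gmap_gcmp_iff _ _ _ _ _ _)), H2.
Qed.

Hypothesis (HA : is_LCat A) (HB : is_LCat B) (HF : is_LIFun F).

Lemma gfm_gcmp (W X Y Z : S) (c : W ~> Z) (b : W ~> Y) (a : W ~> X)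
    (x : lob A X) (y : lob A Y) (z : lob A Z) :
  gfm c a x z ∘ gcmp c b a x y z
  = gcmp c b a (li_ob F x) (li_ob F y) (li_ob F z)
    ∘ (gfm c b y z ⊗₁ gfm b a x y).
Proof.
apply (gfm_gcmp_of (tr1_pair c b a) (tr2_pair c b a) (tr3_pair c b a)).
apply (proj1 (gmap_gcmp_iff _ _ _ _ _ _) (lf_cmp HF x y z)).
Qed.

Lemma gfm_gid (W X : S) (a : W ~> X) (x : lob A X) :
  gfm a a x x ∘ gid a x = gid a (li_ob F x).
Proof.
assert (q := lf_id HF x). cbn in q.
assert (q' : gfm (idm X) (idm X) x x ∘ gid (idm X) x
   = gid (idm X) (li_ob F x)).
{ rewrite (gid_idm HV HA), <- q. unfold gfm.
  now rewrite (proof_irrelevance _ (cmp_idr _) (cmp_idl (idm X))). }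
rewrite <- (gpl_gid HV (cmp_idl a) (cmp_idl a) x). rw (gfm_gpl _ _ _ _).
rw (eq_sym (smor_cmp (pb V a) _ _)). rewrite q', <- cmp_assoc.
apply (gpl_gid HV).
Qed.

Definition gfun : KFun (gamma HV HA) (gamma HV HB) :=
  {| kfo := (fun X x => li_ob F x)
       : forall X, kob (gamma HV HA) X -> kob (gamma HV HB) X;
     kfh := gfm : forall W X Y b a (x : kob (gamma HV HA) X)
       (y : kob (gamma HV HA) Y),
       khom b a x y ~> khom (k := gamma HV HB) b a
         (li_ob F x : kob (gamma HV HB) X) (li_ob F y : kob (gamma HV HB) Y);
     kfh_kid := gfm_gid; kfh_kcm := gfm_gcmp; kfh_kpl := gfm_gpl |}.
End GMap.

(** * The system of an indexed V-category *)

Section ICatLemmas.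
Variables (S : FinProdCat) (V : IMCData S) (HV : is_IMC V).
Variables (A : ICatData V) (HA : is_ICat A).

Definition icE (X : S) : is_ECat (A X) := ic_ecat HA X.

(** [efh (ic_re A f)], typed with the source [f ^* ehom x y] unfolded. *)
Definition rh (X Y : S) (f : X ~> Y) (x y : A Y) :
    f ^* ehom x y ~> ehom (ic_re A f x) (ic_re A f y) := efh (ic_re A f) x y.

Lemma rh_inv (X Y : S) (f : X ~> Y) (x y : A Y) :
  rh f x y ∘ ic_ffinv f x y = idm _.
Proof. exact (ic_ff2 HA f x y). Qed.

Lemma inv_rh (X Y : S) (f : X ~> Y) (x y : A Y) :
  ic_ffinv f x y ∘ rh f x y = idm _.
Proof. exact (ic_ff1 HA f x y). Qed.

Lemma rh_eid (X Y : S) (f : X ~> Y) (x : A Y) :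
  rh f x x ∘ f ^*₁ eid x ∘ fwd (sunit (pb V f)) = eid (ic_re A f x).
Proof. rewrite cmp_assoc. exact (efh_id (ic_efun HA f) x). Qed.

Lemma rh_ecmp (X Y : S) (f : X ~> Y) (x y z : A Y) :
  rh f x z ∘ f ^*₁ ecmp x y z ∘ fwd (smul (pb V f) _ _)
  = ecmp (ic_re A f x) (ic_re A f y) (ic_re A f z) ∘ (rh f y z ⊗₁ rh f x y).
Proof. rewrite cmp_assoc. exact (efh_cmp (ic_efun HA f) x y z). Qed.

Lemma ic_appE (X Y : S) (f : X ~> Y) (x y : A Y) (u : elt x y) :
  ic_app f u = eapp (C := chbase (pb V f) (A Y)) (ic_re A f) (capp (pb V f) u).
Proof. apply cmp_assoc. Qed.

Lemma ic_app_comp (X Y : S) (f : X ~> Y) (x y z : A Y) (v : elt y z)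
    (u : elt x y) : ic_app f (ecomp v u) = ecomp (ic_app f v) (ic_app f u).
Proof.
rewrite !ic_appE, capp_comp. apply (eapp_comp (ic_efun HA f)).
Qed.

Lemma ic_app_id (X Y : S) (f : X ~> Y) (x : A Y) :
  ic_app f (eid x) = eid (ic_re A f x).
Proof. rewrite ic_appE. apply (efh_id (ic_efun HA f)). Qed.

Lemma rh_post (X Y : S) (f : X ~> Y) (x y z : A Y) (v : elt y z) :
  rh f x z ∘ f ^*₁ epost v = epost (ic_app f v) ∘ rh f x y.
Proof.
rewrite smor_post, ic_appE.
exact (efh_post (ic_efun HA f) (x := x) (y := y) (z := z) _).
Qed.

Lemma rh_pre (X Y : S) (f : X ~> Y) (x y z : A Y) (u : elt x y) :
  rh f x z ∘ f ^*₁ epre u = epre (ic_app f u) ∘ rh f y z.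
Proof.
rewrite smor_pre, ic_appE.
exact (efh_pre (ic_efun HA f) (x := x) (y := y) (z := z) _).
Qed.

Section CmpE.
Variables (X Y Z : S) (f : X ~> Y) (g : Y ~> Z) (h : X ~> Z) (e : g ∘ f = h).

Lemma ic_cmpE_inverse (x : A Z) : einverse (ic_cmpE e x) (ic_cmpVE e x).
Proof. destruct e. apply (ic_cmp_inv HA). Qed.

Lemma ic_cmpVE_cmpE (x : A Z) : ecomp (ic_cmpVE e x) (ic_cmpE e x) = eid _.
Proof. apply ic_cmpE_inverse. Qed.

Lemma ic_cmpE_cmpVE (x : A Z) : ecomp (ic_cmpE e x) (ic_cmpVE e x) = eid _.
Proof. apply ic_cmpE_inverse. Qed.

Lemma ic_cmpE_nat (x y : A Z) :
  epost (ic_cmpE e y) ∘ rh h x y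
  = epre (ic_cmpE e x) ∘ rh f (ic_re A g x) (ic_re A g y)
    ∘ f ^*₁ rh g x y ∘ fwd (pbcmpE e (ehom x y)).
Proof.
destruct e. cbn. refine (eq_trans (@ic_cmp_nat _ _ _ HA _ _ _ f g x y) _). cbn. now ra.
Qed.
End CmpE.

Lemma ic_cmpE_assoc (X Y Z W : S) (f : X ~> Y) (g : Y ~> Z) (h : Z ~> W)
    (gf : X ~> Z) (hg : Y ~> W) (k : X ~> W) (x : A W)
    (e1 : h ∘ g = hg) (e2 : hg ∘ f = k) (e3 : g ∘ f = gf) (e4 : h ∘ gf = k) :
  ecomp (ic_app f (ic_cmpE e1 x)) (ic_cmpE e2 x)
  = ecomp (ic_cmpE e3 (ic_re A h x)) (ic_cmpE e4 x).
Proof.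
destruct e1, e2, e3. cbn.
rewrite (proof_irrelevance _ e4 (eq_sym (cmp_assoc h g f))).
apply (ic_cmp_assoc HA).
Qed.

Lemma ic_cmpE_idl (X Y : S) (f : X ~> Y) (e : idm Y ∘ f = f) (x : A Y) :
  ic_cmpE e x = ic_app f (ic_id x).
Proof. rewrite (proof_irrelevance _ e (cmp_idl f)). apply (ic_cmp_idl HA). Qed.

Lemma ic_cmpE_idr (X Y : S) (f : X ~> Y) (e : f ∘ idm X = f) (x : A Y) :
  ic_cmpE e x = ic_id (ic_re A f x).
Proof. rewrite (proof_irrelevance _ e (cmp_idr f)). apply (ic_cmp_idr HA). Qed.

Lemma ic_app_inverse (X Y : S) (f : X ~> Y) (x y : A Y) (u : elt x y)
    (v : elt y x) : einverse u v -> einverse (ic_app f u) (ic_app f v).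
Proof.
intros [e e']. split; now rewrite <- ic_app_comp, ?e, ?e', ic_app_id.
Qed.

Lemma ic_cmpVE_idl (X Y : S) (f : X ~> Y) (e : idm Y ∘ f = f) (x : A Y) :
  ic_cmpVE e x = ic_app f (ic_idV x).
Proof.
apply (einverse_uniq (icE X) (ic_cmpE_inverse e x)).
rewrite ic_cmpE_idl. apply ic_app_inverse, (ic_id_inv HA).
Qed.

Lemma ic_cmpVE_idr (X Y : S) (f : X ~> Y) (e : f ∘ idm X = f) (x : A Y) :
  ic_cmpVE e x = ic_idV (ic_re A f x).
Proof.
apply (einverse_uniq (icE X) (ic_cmpE_inverse e x)).
rewrite ic_cmpE_idr. apply (ic_id_inv HA).
Qed.

Lemma ic_idV_id (X : S) (x : A X) : ecomp (ic_idV x) (ic_id x) = eid x.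
Proof. apply (ic_id_inv HA). Qed.

Lemma ic_id_idV (X : S) (x : A X) : ecomp (ic_id x) (ic_idV x) = eid _.
Proof. apply (ic_id_inv HA). Qed.

Lemma ic_app_cmp (X Y Z : S) (f : X ~> Y) (g : Y ~> Z) (h : X ~> Z)
    (e : g ∘ f = h) (x y : A Z) (u : elt x y) :
  ecomp (ic_cmpE e y) (ic_app h u)
  = ecomp (ic_app f (ic_app g u)) (ic_cmpE e x).
Proof.
unfold ecomp at 1. unfold ic_app at 1. rw (ic_cmpE_nat e x y).
rewrite ecomp_pre. f_equal. unfold ic_app. rewrite !smor_cmp. ra.
rw (pbcmpE_nat HV e u). now rewrite (pbcmpE_unit HV e).
Qed.

Lemma ic_id_post (X : S) (x y : A X) :
  epost (ic_id y)
  = epre (ic_id x) ∘ (rh (idm X) x y ∘ fwd (pbid V (ehom x y))).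
Proof.
rewrite <- (cmp_idr (epost _)). exact (@ic_id_nat _ _ _ HA _ x y).
Qed.

Lemma ic_app_idm (X : S) (x y : A X) (u : elt x y) :
  ecomp (ic_app (idm X) u) (ic_id x) = ecomp (ic_id y) u.
Proof.
unfold ecomp at 2. rewrite ic_id_post, ecomp_pre. unfold ic_app. ra.
now rw (pbid_nat HV u); rewrite (pbid_unit HV).
Qed.

Definition ipl (W' W X Y : S) (t : W' ~> W) (b : W ~> Y) (a : W ~> X)
    (b' : W' ~> Y) (a' : W' ~> X) (eb : b ∘ t = b') (ea : a ∘ t = a')
    (x : A X) (y : A Y) :
    t ^* ehom (ic_re A a x) (ic_re A b y)
    ~> ehom (ic_re A a' x) (ic_re A b' y) :=
  epost (ic_cmpVE eb y) ∘ epre (ic_cmpE ea x)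
  ∘ rh t (ic_re A a x) (ic_re A b y).

Definition iplV (W' W X Y : S) (t : W' ~> W) (b : W ~> Y) (a : W ~> X)
    (b' : W' ~> Y) (a' : W' ~> X) (eb : b ∘ t = b') (ea : a ∘ t = a')
    (x : A X) (y : A Y) :
    ehom (ic_re A a' x) (ic_re A b' y)
    ~> t ^* ehom (ic_re A a x) (ic_re A b y) :=
  ic_ffinv t (ic_re A a x) (ic_re A b y)
  ∘ epre (ic_cmpVE ea x) ∘ epost (ic_cmpE eb y).

Section Pull.
Variables (W' W X Y Z : S) (t : W' ~> W).
Variables (c : W ~> Z) (b : W ~> Y) (a : W ~> X).
Variables (c' : W' ~> Z) (b' : W' ~> Y) (a' : W' ~> X).
Variables (ec : c ∘ t = c') (eb : b ∘ t = b') (ea : a ∘ t = a').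
Variables (x : A X) (y : A Y) (z : A Z).

(** Full faithfulness of reindexing makes pullback invertible: [ic_ffinv] inverts [rh], and the
    comparisons cancel against their inverses. *)
Lemma ipl_iplV : ipl eb ea x y ∘ iplV eb ea x y = idm _.
Proof.
unfold ipl, iplV. ra. rw (rh_inv t _ _). rewrite cmp_idl.
rw (eq_sym (epre_comp (icE W') _ _)).
rewrite ic_cmpVE_cmpE, (epre_id (icE W')), cmp_idl.
now rewrite <- (epost_comp (icE W')), ic_cmpVE_cmpE, (epost_id (icE W')).
Qed.

Lemma iplV_ipl : iplV eb ea x y ∘ ipl eb ea x y = idm _.
Proof.
unfold ipl, iplV. ra. rw (eq_sym (epost_comp (icE W') _ _)).
rewrite ic_cmpE_cmpVE, (epost_id (icE W')), cmp_idl.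
rw (eq_sym (epre_comp (icE W') _ _)).
rewrite ic_cmpE_cmpVE, (epre_id (icE W')), cmp_idl. apply inv_rh.
Qed.

Lemma ipl_ecmp :
  ipl ec ea x z ∘ t ^*₁ ecmp (ic_re A a x) (ic_re A b y) (ic_re A c z)
    ∘ fwd (smul (pb V t) _ _)
  = ecmp (ic_re A a' x) (ic_re A b' y) (ic_re A c' z)
    ∘ (ipl ec eb y z ⊗₁ ipl eb ea x y).
Proof.
unfold ipl. rw (rh_ecmp t (ic_re A a x) (ic_re A b y) (ic_re A c z)).
rewrite <- !cmp_assoc, tmor_cmp, <- cmp_assoc.
now rewrite <- (ecmp_conj (icE W') (ic_cmpE_cmpVE eb y)).
Qed.

Lemma ipl_eid (e e' : a ∘ t = a') :
  ipl e e' x x ∘ t ^*₁ eid (ic_re A a x) ∘ fwd (sunit (pb V t))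
  = eid (ic_re A a' x).
Proof.
rewrite (proof_irrelevance _ e' e). unfold ipl. ra.
rw (rh_eid t (ic_re A a x)).
rewrite <- ecomp_pre, (ecomp_idl (icE W')). apply ic_cmpVE_cmpE.
Qed.

(** The coherence axiom of [ic_cmp], used at the source object ([qC]) and at the target object
    ([qD]), together with the naturality of [ic_cmp]. *)
Lemma ipl_ipl (W'' : S) (s : W'' ~> W') (st : W'' ~> W) (e : t ∘ s = st)
    (b2 : W'' ~> Y) (a2 : W'' ~> X) (eb2 : b' ∘ s = b2)
    (ea2 : a' ∘ s = a2) (eb3 : b ∘ st = b2) (ea3 : a ∘ st = a2) :
  ipl eb2 ea2 x y ∘ s ^*₁ ipl eb ea x y ∘ fwd (pbcmpE e _)
  = ipl eb3 ea3 x y.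
Proof.
assert (qC : ecomp (ic_app s (ic_cmpE ea x)) (ic_cmpE ea2 x)
  = ecomp (ic_cmpE e (ic_re A a x)) (ic_cmpE ea3 x))
  by apply ic_cmpE_assoc.
assert (qD : ecomp (ic_app s (ic_cmpE eb y)) (ic_cmpE eb2 y)
  = ecomp (ic_cmpE e (ic_re A b y)) (ic_cmpE eb3 y))
  by apply ic_cmpE_assoc.
(* At the target the inverse comparisons occur, so [qD] is solved for them. *)
assert (qV : ecomp (ecomp (ic_cmpVE eb2 y) (ic_app s (ic_cmpVE eb y)))
     (ic_cmpE e (ic_re A b y)) = ic_cmpVE eb3 y).
{ rewrite <- (ecomp_idr (icE W'') (ecomp _ _)), <- (ic_cmpE_cmpVE eb3 y).
  erw (icE W'') (eq_sym qD). erw (icE W'') (eq_sym (ic_app_comp s _ _)).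
  rewrite ic_cmpVE_cmpE, ic_app_id, (ecomp_idl (icE W'')).
  erw (icE W'') (ic_cmpVE_cmpE _ _). apply (ecomp_idl (icE W'')). }
unfold ipl. rewrite !smor_cmp. rw (rh_post s _). rw (rh_pre s _).
rewrite <- qV, !(epost_comp (icE W'')). ra.
rw (epost_epre (icE W'') (ic_cmpE e (ic_re A b y)) (ic_cmpE ea3 x)).
rw (ic_cmpE_nat e _ _).
rw (eq_sym (epost_epre (icE W'') (ic_app s (ic_cmpVE eb y)) (ic_cmpE ea2 x))).
do 2 rw (eq_sym (epre_comp (icE W'') _ _)). now rewrite qC.
Qed.
End Pull.

Lemma ipl_idm (W X Y : S) (b : W ~> Y) (a : W ~> X)
    (eb : b ∘ idm W = b) (ea : a ∘ idm W = a) (x : A X) (y : A Y) :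
  ipl eb ea x y ∘ fwd (pbid V _) = idm (ehom (ic_re A a x) (ic_re A b y)).
Proof.
unfold ipl. rewrite ic_cmpVE_idr, ic_cmpE_idr. ra.
rewrite <- ic_id_post.
now rewrite <- (epost_comp (icE W)), ic_idV_id, (epost_id (icE W)).
Qed.

Definition phi : KSys V :=
  {| kob := fun X => A X;
     khom := fun W X Y b a x y => ehom (ic_re A a x) (ic_re A b y);
     kid := fun W X a x => eid (ic_re A a x);
     kcm := fun W X Y Z c b a x y z =>
       ecmp (ic_re A a x) (ic_re A b y) (ic_re A c z);
     kpl := fun W' W X Y t b a b' a' eb ea x y => ipl eb ea x y;
     kplV := fun W' W X Y t b a b' a' eb ea x y => iplV eb ea x y;
     kassoc := fun W X Y Z U d c b a x y z w => ecmp_assoc (icE W) _ _ _ _;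
     kidl := fun W X Y b a x y => ecmp_idl (icE W) _ _;
     kidr := fun W X Y b a x y => ecmp_idr (icE W) _ _;
     kpl_kplV := ipl_iplV; kplV_kpl := iplV_ipl;
     kpl_kpl := fun W'' W' W X Y s t st e b a b1 a1 b2 a2
       eb1 ea1 eb2 ea2 eb3 ea3 x y => ipl_ipl eb1 ea1 x y e eb2 ea2 eb3 ea3;
     kpl_idm := ipl_idm;
     kpl_kcm := ipl_ecmp; kpl_kid := fun W' W X t a a' e e' x => ipl_eid x e e' |}.

Lemma phi_kapp (W' W X Y : S) (t : W' ~> W) (b : W ~> Y) (a : W ~> X)
    (b' : W' ~> Y) (a' : W' ~> X) (eb : b ∘ t = b') (ea : a ∘ t = a')
    (x : A X) (y : A Y) (u : elt (ic_re A a x) (ic_re A b y)) :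
  kapp (K := phi) (x := x) (y := y) eb ea u
  = ecomp (ic_cmpVE eb y) (ecomp (ic_app t u) (ic_cmpE ea x)).
Proof.
rewrite (ecomp_pre (ic_app t u)). unfold kapp, ecomp, ic_app, rh. cbn. unfold ipl.
now ra.
Qed.
End ICatLemmas.

Section IFunSystem.
Variables (S : FinProdCat) (V : IMCData S) (HV : is_IMC V).
Variables (A B : ICatData V) (HA : is_ICat A) (HB : is_ICat B).
Variables (F : IFunData A B) (HF : is_IFun F).

Lemma if_nat (X Y : S) (f : X ~> Y) (x y : A Y) :
  epost (if_re F f y)
    ∘ (efh (F X) (ic_re A f x) (ic_re A f y) ∘ rh f x y)
  = epre (if_re F f x) ∘ (rh f (F Y x) (F Y y) ∘ f ^*₁ efh (F Y) x y).
Proof. exact (@if_re_nat _ _ _ _ _ HF _ _ f x y). Qed.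

Lemma if_re_reV (X Y : S) (f : X ~> Y) (x : A Y) :
  ecomp (if_re F f x) (if_reV F f x) = eid _.
Proof. apply (if_re_inv HF). Qed.

Lemma if_reV_re (X Y : S) (f : X ~> Y) (x : A Y) :
  ecomp (if_reV F f x) (if_re F f x) = eid _.
Proof. apply (if_re_inv HF). Qed.

Lemma if_re_cmpE (X Y Z : S) (f : X ~> Y) (g : Y ~> Z) (h : X ~> Z)
    (e : g ∘ f = h) (x : A Z) :
  ecomp (ic_cmpE e (F Z x)) (if_re F h x)
  = ecomp (ic_app f (if_re F g x))
      (ecomp (if_re F f (ic_re A g x)) (eapp (F X) (ic_cmpE e x))).
Proof. destruct e. apply (if_re_cmp HF). Qed.

Lemma efh_efh_post (X : S) (x y z : A X) (v : elt y z) :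
  efh (F X) x z ∘ epost v = epost (eapp (F X) v) ∘ efh (F X) x y.
Proof. apply (efh_post (if_efun HF X)). Qed.

Lemma if_fh_nat (X Y : S) (f : X ~> Y) (x y : A Y) :
  efh (F X) (ic_re A f x) (ic_re A f y) ∘ rh f x y
  = epost (if_reV F f y) ∘ (epre (if_re F f x)
    ∘ (rh f (F Y x) (F Y y) ∘ f ^*₁ efh (F Y) x y)).
Proof.
rewrite <- if_nat. rw (eq_sym (epost_comp (icE HB X) _ _)).
now rewrite if_reV_re, (epost_id (icE HB X)), cmp_idl.
Qed.

(** [F] applied over [W] lands between [F (a^* x)] and [F (b^* y)], whereas the system of [B] has
    [a^* (F x)] and [b^* (F y)]; hence the conjugation by [if_re]. *)
Definition phih (W X Y : S) (b : W ~> Y) (a : W ~> X) (x : A X) (y : A Y) :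
    ehom (ic_re A a x) (ic_re A b y)
    ~> ehom (ic_re B a (F X x)) (ic_re B b (F Y y)) :=
  epost (if_re F b y) ∘ epre (if_reV F a x)
  ∘ efh (F W) (ic_re A a x) (ic_re A b y).

Lemma phih_kid (W X : S) (a : W ~> X) (x : A X) :
  phih a a x x ∘ eid (ic_re A a x) = eid (ic_re B a (F X x)).
Proof.
unfold phih. ra. rewrite (efh_id (if_efun HF W)).
rewrite <- ecomp_pre, (ecomp_idl (icE HB W)). apply if_re_reV.
Qed.

Lemma phih_kcm (W X Y Z : S) (c : W ~> Z) (b : W ~> Y) (a : W ~> X)
    (x : A X) (y : A Y) (z : A Z) :
  phih c a x z ∘ ecmp (ic_re A a x) (ic_re A b y) (ic_re A c z)
  = ecmp (ic_re B a (F X x)) (ic_re B b (F Y y)) (ic_re B c (F Z z))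
    ∘ (phih c b y z ⊗₁ phih b a x y).
Proof.
unfold phih. rw (efh_cmp (if_efun HF W) _ _ _).
rewrite <- !cmp_assoc, tmor_cmp, <- cmp_assoc.
now rewrite <- (ecmp_conj (icE HB W) (if_reV_re b y)).
Qed.

(** Naturality of [if_re] along [t], combined with its compatibility with composites at both ends.
    As inverses occur in [phih] and [ipl], that compatibility is needed in the solved forms [qV] at
    the target and [qU] at the source. *)
Lemma phih_kpl (W' W X Y : S) (t : W' ~> W) (b : W ~> Y) (a : W ~> X)
    (b' : W' ~> Y) (a' : W' ~> X) (eb : b ∘ t = b') (ea : a ∘ t = a')
    (x : A X) (y : A Y) :
  phih b' a' x y ∘ ipl eb ea x y
  = ipl eb ea (F X x) (F Y y) ∘ t ^*₁ phih b a x y.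
Proof.
assert (qC := if_re_cmpE ea x). assert (qD := if_re_cmpE eb y).
assert (qV : ecomp (if_re F b' y) (ecomp (eapp (F W') (ic_cmpVE eb y))
    (if_reV F t (ic_re A b y)))
  = ecomp (ic_cmpVE eb (F Y y)) (ic_app t (if_re F b y))).
{ rewrite <- (ecomp_idl (icE HB W') (ecomp (if_re F b' y) _)).
  rewrite <- (ic_cmpVE_cmpE HB eb (F Y y)). erw (icE HB W') qD.
  erw (icE HB W') (eq_sym (eapp_comp (if_efun HF W') _ _)).
  rewrite (ic_cmpE_cmpVE HA), (eapp_id (if_efun HF W')), (ecomp_idl (icE HB W')).
  now rewrite if_re_reV, (ecomp_idr (icE HB W')). }
assert (qU : ecomp (if_re F t (ic_re A a x))
    (ecomp (eapp (F W') (ic_cmpE ea x)) (if_reV F a' x))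
  = ecomp (ic_app t (if_reV F a x)) (ic_cmpE ea (F X x))).
{ rewrite <- (ecomp_idr (icE HB W') (ic_cmpE ea (F X x))).
  rewrite <- (if_re_reV a' x). erw (icE HB W') qC.
  erw (icE HB W') (eq_sym (ic_app_comp HB t _ _)).
  now rewrite if_reV_re, (ic_app_id HB), (ecomp_idl (icE HB W')). }
unfold phih, ipl. ra. rw (efh_efh_post _).
rw (efh_pre (if_efun HF W') _). rewrite if_fh_nat.
rewrite !smor_cmp. rw (rh_post HB t _). rw (rh_pre HB t _).
enorm (icE HB W'). now rewrite qU, qV.
Qed.

Definition phifun : KFun (phi HA) (phi HB) :=
  {| kfo := (fun X x => F X x)
       : forall X, kob (phi HA) X -> kob (phi HB) X;
     kfh := phih : forall W X Y b a (x : kob (phi HA) X)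
       (y : kob (phi HA) Y),
       khom b a x y ~> khom (k := phi HB) b a
         (F X x : kob (phi HB) X) (F Y y : kob (phi HB) Y);
     kfh_kid := phih_kid; kfh_kcm := phih_kcm; kfh_kpl := phih_kpl |}.
End IFunSystem.
Arguments efh_efh_post {S V A B F} HF {X x y z} v.

(** * Equality of indexed V-functors between large V-categories *)

Section GMapCore.
Variables (S : FinProdCat) (V : IMCData S) (HV : is_IMC V).
Variables (A B : LCatData V).

(** The target of [li_hom] is pulled back along [pmap (idm Y) (idm X)], which equals the identity.
    Without this pullback a core [h] remains, and the whole action consists of plain pullbacks of
    [h]; identities and composites of functors are compared on cores. *)
Lemma gfm_core (F : LIFunData A B)
    (h : forall X Y (x : lob A X) (y : lob A Y),
      lhom x y ~> lhom (li_ob F x) (li_ob F y)) :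
  (forall X Y (x : lob A X) (y : lob A Y),
    li_hom F x y = fwd (pbidE (pmap_id Y X) _) ∘ h X Y x y) ->
  forall W X Y (b : W ~> Y) (a : W ~> X) (x : lob A X) (y : lob A Y),
    gfm F b a x y = ⟨b, a⟩ ^*₁ h X Y x y.
Proof.
intros e W X Y b a x y. unfold gfm, gmap, pull. cbn. rewrite e, smor_cmp.
rewrite <- (pbcmpE_idl HV _ (pmap_id Y X) (pmap_pair (cmp_idl b) (cmp_idl a))).
rw (bwd_fwd _). apply cmp_idl.
Qed.

Lemma li_hom_core (F : LIFunData A B) X Y (x : lob A X) (y : lob A Y) :
  li_hom F x y
  = fwd (pbidE (pmap_id Y X) _) ∘ (bwd (pbidE (pmap_id Y X) _) ∘ li_hom F x y).
Proof. rw (fwd_bwd _). now rewrite cmp_idl. Qed.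

Lemma pair_id (X Y : S) : idm (prd X Y) = ⟨pr1 X Y, pr2 X Y⟩.
Proof. rewrite (pair_uniq (idm _)). now rewrite !cmp_idr. Qed.

Lemma pair_faithful (X Y : S) (M N : V (prd X Y)) (u v : M ~> N) :
  ⟨pr1 X Y, pr2 X Y⟩ ^*₁ u = ⟨pr1 X Y, pr2 X Y⟩ ^*₁ v -> u = v.
Proof.
intros e. apply (fwd_inj (i := pbidE (pair_id X Y) N)).
now rewrite !(pbidE_nat HV), e.
Qed.

(** Object maps are compared as whole functions so that [e] can be destructed; where they agree by
    computation it is [eq_refl] and the [match] disappears. The universal pair suffices because
    pullback along [⟨pr1, pr2⟩], an identity, is faithful. *)
Lemma lifun_ext (F G : LIFunData A B)
    (e : (fun X x => li_ob F (X := X) x) = (fun X x => li_ob G (X := X) x)) :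
  (forall X Y (x : lob A X) (y : lob A Y),
    match e in _ = o return ghom (pr1 Y X) (pr2 Y X) x y
      ~> ghom (pr1 Y X) (pr2 Y X) (o X x) (o Y y)
    with eq_refl => gfm F (pr1 Y X) (pr2 Y X) x y end
    = gfm G (pr1 Y X) (pr2 Y X) x y) ->
  F = G.
Proof.
destruct F as [o h], G as [o' h']. cbn in e. change (o = o') in e.
destruct e. intros H. f_equal.
do 4 (apply functional_extensionality_dep; intro).
specialize (H x x0 x1 x2).
rewrite !(gfm_core (li_hom_core _)) in H. apply pair_faithful in H.
now rewrite (li_hom_core {| li_hom := h |}), H, <- (li_hom_core {| li_hom := h' |}).
Qed.

End GMapCore.

Lemma gfm_lifun_id (S : FinProdCat) (V : IMCData S) (HV : is_IMC V)
    (A : LCatData V) (W X Y : S) (b : W ~> Y) (a : W ~> X)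
    (x : lob A X) (y : lob A Y) :
  gfm (lifun_id A) b a x y = idm _.
Proof.
rewrite (gfm_core HV (F := lifun_id A) (h := fun X Y x y => idm _)).
- apply smor_id.
- intros. symmetry. apply cmp_idr.
Qed.

Lemma gfm_lifun_cmp (S : FinProdCat) (V : IMCData S) (HV : is_IMC V)
    (A B C : LCatData V) (G : LIFunData B C) (F : LIFunData A B)
    (W X Y : S) (b : W ~> Y) (a : W ~> X) (x : lob A X) (y : lob A Y) :
  gfm (lifun_cmp G F) b a x y
  = gfm G b a (li_ob F x) (li_ob F y) ∘ gfm F b a x y.
Proof.
rewrite (gfm_core HV (li_hom_core F)), (gfm_core HV (li_hom_core G)).
refine (eq_trans _ (smor_cmp (pb V ⟨b, a⟩) _ _)).
apply (gfm_core HV (F := lifun_cmp G F) (h := fun X Y x y => 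
  (bwd (pbidE (pmap_id Y X) _) ∘ li_hom G (li_ob F x) (li_ob F y))
  ∘ (bwd (pbidE (pmap_id Y X) _) ∘ li_hom F x y))).
intros X' Y' x' y'. cbn. unfold pull.
rewrite (li_hom_core G) at 1. rewrite (li_hom_core F) at 1.
rewrite smor_cmp. ra.
rewrite <- (pbcmpE_idl HV _ (pmap_id Y' X') (pmap_idcmp Y' X')).
rw (bwd_fwd (pbcmpE (pmap_idcmp Y' X') _)). rewrite cmp_idl.
now rw (eq_sym (pbidE_nat HV (pmap_id Y' X') _)).
Qed.

(** The core of [Θ F] is [phih] at the universal pair, so this is stability of [phih] under pullback
    along [⟨b, a⟩]. *)
Lemma th_gfm_theta (S : FinProdCat) (V : IMCData S) (HV : is_IMC V)
    (A B : ICatData V) (HA : is_ICat A) (HB : is_ICat B) (F : IFunData A B)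
    (HF : is_IFun F) (W X Y : S) (b : W ~> Y) (a : W ~> X) (x : A X) (y : A Y) :
  th (K := phi HB) b a (F X x) (F Y y) ∘ gfm (theta_fun F) b a x y
  = phih F b a x y ∘ th (K := phi HA) b a x y.
Proof.
rewrite (gfm_core HV (F := theta_fun F)
  (h := fun X Y x y => phih F (pr1 Y X) (pr2 Y X) x y)) by reflexivity.
symmetry. exact (phih_kpl HA HB HF (pr1_pair b a) (pr2_pair b a) x y).
Qed.

Section IFunElements.
Variables (S : FinProdCat) (V : IMCData S).
Variables (A B : ICatData V) (HA : is_ICat A) (HB : is_ICat B).

Lemma ifun_intro (F : IFunData A B) :
  (forall X, is_EFun (F X)) ->
  (forall (X Y : S) (f : X ~> Y) (x y : A Y),
    epost (if_re F f y)
      ∘ (efh (F X) (ic_re A f x) (ic_re A f y) ∘ rh f x y)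
    = epre (if_re F f x) ∘ (rh f (F Y x) (F Y y) ∘ f ^*₁ efh (F Y) x y)) ->
  (forall (X Y : S) (f : X ~> Y) (x : A Y),
    ecomp (if_reV F f x) (if_re F f x) = eid _) ->
  (forall (X Y : S) (f : X ~> Y) (x : A Y),
    ecomp (if_re F f x) (if_reV F f x) = eid _) ->
  (forall (X Y Z : S) (f : X ~> Y) (g : Y ~> Z) (x : A Z),
    ecomp (ic_cmp f g (F Z x)) (if_re F (g ∘ f) x)
    = ecomp (ic_app f (if_re F g x))
        (ecomp (if_re F f (ic_re A g x)) (eapp (F X) (ic_cmp f g x)))) ->
  (forall (X : S) (x : A X),
    ecomp (if_re F (idm X) x) (eapp (F X) (ic_id x)) = ic_id (F X x)) ->
  is_IFun F.
Proof.
intros H1 H2 H3 H4 H5 H6. split.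
- exact H1.
- exact H2.
- intros. split; [apply H3 | apply H4].
- exact H5.
- exact H6.
Qed.

Lemma if_app (F : IFunData A B) (HF : is_IFun F) (X Y : S) (f : X ~> Y)
    (x y : A Y) (u : elt x y) :
  ecomp (if_re F f y) (eapp (F X) (ic_app f u))
  = ecomp (ic_app f (eapp (F Y) u)) (if_re F f x).
Proof.
rewrite (ecomp_pre (ic_app f _)). unfold ecomp, eapp, ic_app. rewrite smor_cmp. ra.
rw (if_nat HF f x y). reflexivity.
Qed.

Lemma in_app (F G : IFunData A B) (t : INatData F G) (Ht : is_INat t) (X : S)
    (x y : A X) (u : elt x y) :
  ecomp (t X y) (eapp (F X) u) = ecomp (eapp (G X) u) (t X x).
Proof.
rewrite (ecomp_pre (eapp (G X) u)). unfold ecomp, eapp.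
rw (in_nat Ht x y). reflexivity.
Qed.
End IFunElements.

Lemma eapp_efun_cmp (M : MonCat) (C D E : ECatData M)
    (G : EFunData D E) (F : EFunData C D) (x y : C) (u : elt x y) :
  eapp (efun_cmp G F) u = eapp G (eapp F u).
Proof. apply cmp_assoc. Qed.

(** * The 2-category of indexed V-categories *)

Section IndexedCells.
Variables (S : FinProdCat) (V : IMCData S) (HV : is_IMC V).

Lemma ifun_id_ax (A : ICatData V) : is_ICat A -> is_IFun (ifun_id A).
Proof.
intros HA. assert (E := icE HA). apply ifun_intro; cbn; intros.
- split; intros; cbn.
  + apply cmp_idl.
  + now rewrite tmor_id, cmp_idl, cmp_idr.
- now rewrite smor_id, (epost_id (E _)), (epre_id (E _)), cmp_idr, !cmp_idl.
- apply (ecomp_idl (E _)).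
- apply (ecomp_idl (E _)).
- rewrite (ic_app_id HA), !(ecomp_idl (E _)), (ecomp_idr (E _)).
  symmetry. apply cmp_idl.
- rewrite (ecomp_idl (E _)). apply cmp_idl.
Qed.

Lemma ifun_cmp_ax (A B C : ICatData V) (HA : is_ICat A) (HB : is_ICat B)
    (HC : is_ICat C) (G : IFunData B C) (F : IFunData A B) :
  is_IFun G -> is_IFun F -> is_IFun (ifun_cmp G F).
Proof.
intros HG HF. assert (E := icE HC). assert (EB := icE HB).
apply ifun_intro; cbn; intros.
- apply efun_cmp_efun; [apply (if_efun HG) | apply (if_efun HF)].
- rewrite (epost_comp (E _)), (epre_comp (E _)). ra.
  rw (eq_sym (efh_efh_post HG _)). rw (if_nat HF f x y).
  rw (efh_pre (if_efun HG _) _). rw (epost_epre (E _) _ _).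
  rw (if_nat HG f (F _ x) (F _ y)). now rewrite smor_cmp.
- erw (E _) (if_reV_re HG _ _). rewrite (ecomp_idl (E _)).
  rewrite <- (eapp_comp (if_efun HG _)), (if_reV_re HF). apply (eapp_id (if_efun HG _)).
- erw (E _) (eq_sym (eapp_comp (if_efun HG _) _ _)).
  rewrite (if_re_reV HF), (eapp_id (if_efun HG _)), (ecomp_idl (E _)).
  apply (if_re_reV HG).
- erw (E _) (if_re_cmp HG f g _). rewrite eapp_efun_cmp.
  rewrite <- (eapp_comp (if_efun HG _)), (if_re_cmp HF f g x).
  rewrite !(eapp_comp (if_efun HG _)).
  erw (E _) (if_app HG _ _). now rewrite (ic_app_comp HC), !(ecomp_assoc (E _)).
- rewrite eapp_efun_cmp. era (E X). rewrite <- (eapp_comp (if_efun HG _)), (if_re_id HF).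
  apply (if_re_id HG).
Qed.

Lemma inat_id_ax (A B : ICatData V) (HB : is_ICat B) (F : IFunData A B) :
  is_INat (inat_id F).
Proof.
assert (E := icE HB). unfold inat_id. split.
- intros X x y. now rewrite (epost_id (E _)), (epre_id (E _)).
- intros. now rewrite (ic_app_id HB), (ecomp_idl (E _)), (ecomp_idr (E _)).
Qed.

Lemma inat_vcmp_ax (A B : ICatData V) (HB : is_ICat B) (F G H : IFunData A B)
    (b : INatData G H) (a : INatData F G) :
  is_INat b -> is_INat a -> is_INat (inat_vcmp b a).
Proof.
intros Hb Ha. assert (E := icE HB). unfold inat_vcmp. split.
- intros X x y. rewrite (epost_comp (E _)), (epre_comp (E _)). ra.
  rewrite (in_nat Ha x y). rw (epost_epre (E _) _ _).
  now rewrite (in_nat Hb x y).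
- intros. erw (E X) (in_re Hb f x). erw (E X) (in_re Ha f x).
  now rewrite (ic_app_comp HB), (ecomp_assoc (E X)).
Qed.

Lemma inat_hcmp_ax (A B C : ICatData V) (HB : is_ICat B) (HC : is_ICat C)
    (F F' : IFunData A B) (G G' : IFunData B C) (b : INatData G G')
    (a : INatData F F') :
  is_IFun G -> is_IFun G' ->
  is_INat b -> is_INat a -> is_INat (inat_hcmp b a).
Proof.
intros HG HG' Hb Ha. assert (E := icE HC). unfold inat_hcmp. split.
- intros X x y. cbn. rewrite (epost_comp (E _)), (epre_comp (E _)). ra.
  rw (eq_sym (efh_efh_post HG _)). rewrite (in_nat Ha x y).
  rw (efh_pre (if_efun HG _) _). rw (epost_epre (E _) _ _).
  now rw (in_nat Hb (F' X x) (F' X y)).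
- intros. cbn. erw (E _) (eq_sym (in_app Hb _)).
  erw (E _) (in_re Hb f _). rewrite <- (eapp_comp (if_efun HG _)), (in_re Ha).
  rewrite (eapp_comp (if_efun HG _)). erw (E _) (if_app HG _ _).
  now rewrite (ic_app_comp HC), (ecomp_assoc (E _)).
Qed.

End IndexedCells.

Lemma VCATidx_wf_ok (S : FinProdCat) (V : IMCData S) : VCATidx_wf V.
Proof.
split; intros.
- apply ifun_id_ax, icat_ax.
- apply ifun_cmp_ax; try apply icat_ax; apply ifun_ax.
- apply inat_id_ax, icat_ax.
- apply inat_vcmp_ax; try apply icat_ax; apply inat_ax.
- apply inat_hcmp_ax; try apply icat_ax; try apply ifun_ax; apply inat_ax.
Qed.

Section IndexedExt.
Variables (S : FinProdCat) (V : IMCData S).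

(** A record below a quantifier cannot be destructed; extensionality replaces the family by one in
    constructor form with the same object and hom parts. *)
Lemma efun_family_ind (A B : ICatData V)
    (P : (forall X, EFunData (A X) (B X)) -> Prop) :
  (forall (o : forall X, A X -> B X)
     (h : forall X (x y : A X), ehom x y ~> ehom (o X x) (o X y)),
     P (fun X => Build_EFunData (efo := o X) (h X))) ->
  forall n, P n.
Proof.
intros H n. specialize (H (fun X => n X) (fun X => efh (n X))).
replace n with (fun X => Build_EFunData (efh (n X))); [exact H|].
apply functional_extensionality_dep. intros X. now destruct (n X).
Qed.

(** The remaining component [if_reV] is recovered from [if_re] by uniqueness of inverses. *)
Lemma ifun_ext (A B : ICat V) (F G : IFun A B)
    (e : (fun X (x : A X) => efo (ifn F X) x)
         = (fun X (x : A X) => efo (ifn G X) x)) :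
  (forall X (x y : A X),
    match e in _ = o return ehom x y ~> ehom (o X x) (o X y)
    with eq_refl => efh (ifn F X) x y end = efh (ifn G X) x y) ->
  (forall (X Y : S) (f : X ~> Y) (x : A Y),
    match e in _ = o
      return elt (C := B X) (o X (ic_re A f x)) (ic_re B f (o Y x))
    with eq_refl => if_re F f x end = if_re G f x) ->
  F = G.
Proof.
destruct F as [[n re rV] ax], G as [[n' re' rV'] ax']. revert re rV ax re' rV' ax' e.
pattern n. apply efun_family_ind. intros o h.
pattern n'. apply efun_family_ind. intros o' h' re rV ax re' rV' ax' e.
cbn in *. change (o = o') in e. destruct e. intros H1 H2.
assert (e1 : h = h').
{ do 3 (apply functional_extensionality_dep; intro). apply H1. }
destruct e1.
assert (e2 : re = re').
{ do 4 (apply functional_extensionality_dep; intro). apply H2. }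
destruct e2.
assert (e3 : rV = rV').
{ do 4 (apply functional_extensionality_dep; intro).
  exact (einverse_uniq (ic_ecat (icat_ax B) x) (if_re_inv ax x1 x2)
    (if_re_inv ax' x1 x2)). }
destruct e3. f_equal. apply proof_irrelevance.
Qed.

Lemma inat_ext (A B : ICat V) (F G : IFun A B) (t s : INat F G) :
  (forall X (x : A X), inat_data t x = inat_data s x) -> t = s.
Proof.
destruct t as [t a], s as [s a']. cbn. intros H.
assert (e : t = s) by (do 2 (apply functional_extensionality_dep; intro); apply H).
destruct e. f_equal. apply proof_irrelevance.
Qed.

(** The components of a 2-cell depend on its boundary only through the object maps. Transport along
    equalities of these alone replaces transport along [F = F'] and [G = G'], and in all uses they
    are [eq_refl]. *)
Lemma icell_ext (w : VCATidx_wf V) (A B : ICat V) (F F' G G' : IFun A B)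
    (t : INat F G) (t' : INat F' G')
    (eo : (fun X (x : A X) => efo (ifn F X) x)
         = (fun X (x : A X) => efo (ifn F' X) x))
    (eo' : (fun X (x : A X) => efo (ifn G X) x)
         = (fun X (x : A X) => efo (ifn G' X) x)) :
  F = F' -> G = G' ->
  (forall X (x : A X),
    match eo in _ = o return elt (o X x) (efo (ifn G' X) x) with eq_refl =>
      match eo' in _ = o' return elt (efo (ifn F X) x) (o' X x) with eq_refl =>
        inat_data t x end end = inat_data t' x) ->
  pack (C := VCATidx w) (a := A) (b := B) t
  = pack (C := VCATidx w) (a := A) (b := B) t'.
Proof.
intros e e'. destruct e, e'.
rewrite (proof_irrelevance _ eo eq_refl), (proof_irrelevance _ eo' eq_refl).
intros H. f_equal. now apply inat_ext.
Qed.

End IndexedExt.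

Ltac ifun_ext :=
  lazymatch goal with |- ?F = ?G =>
    refine (@ifun_ext _ _ _ _ F G eq_refl _ _) end.
Ltac icell_ext :=
  lazymatch goal with |- @pack _ _ _ ?F ?G ?t = @pack _ _ _ ?F' ?G' ?t' =>
    refine (@icell_ext _ _ _ _ _ F F' G G' t t' eq_refl eq_refl _ _ _) end.

Lemma VCATidx_2cat (S : FinProdCat) (V : IMCData S) (w : VCATidx_wf V) : is_2category (VCATidx w).
Proof.
assert (E := fun (A : ICat V) => icE (icat_ax A)).
assert (I1 : forall (A B : ICat V) (f : IFun A B),
  cmp1 (t := VCATidx w) (id1 (t := VCATidx w) B) f = f).
{ intros A B f. ifun_ext; cbn; intros.
  - apply cmp_idl.
  - rewrite (ecomp_idl (E B X)). apply cmp_idl. }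
assert (I2 : forall (A B : ICat V) (f : IFun A B),
  cmp1 (t := VCATidx w) f (id1 (t := VCATidx w) A) = f).
{ intros A B f. ifun_ext; cbn; intros.
  - apply cmp_idr.
  - rewrite (eapp_id (if_efun (ifun_ax f) X)). apply (ecomp_idr (E B X)). }
assert (I3 : forall (A B C D : ICat V) (h : IFun C D) (g : IFun B C) (f : IFun A B),
  cmp1 (t := VCATidx w) (cmp1 (t := VCATidx w) h g) f
  = cmp1 (t := VCATidx w) h (cmp1 (t := VCATidx w) g f)).
{ intros A B C D h g f. ifun_ext; cbn; intros.
  - apply cmp_assoc.
  - rewrite eapp_efun_cmp, (eapp_comp (if_efun (ifun_ax h) X)).
    apply (ecomp_assoc (E D X)). }
split; auto.
- intros A B f g t. apply inat_ext. intros. apply (ecomp_idl (E B X)).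
- intros A B f g t. apply inat_ext. intros. apply (ecomp_idr (E B X)).
- intros A B f g h k u t s. apply inat_ext. intros. apply (ecomp_assoc (E B X)).
- intros A B C g f. apply inat_ext. intros. cbn. unfold inat_hcmp, inat_id.
  rewrite (eapp_id (if_efun (ifun_ax g) X)). apply (ecomp_idl (E C X)).
- intros A B C f f' f'' g g' g'' t' t s' s. apply inat_ext. intros. cbn.
  unfold inat_hcmp, inat_vcmp. cbn.
  rewrite (eapp_comp (if_efun (ifun_ax g) X)).
  (* Interchange is naturality of [t] at the element [s' x]. *)
  erw (E C X) (in_app (inat_ax t) (inat_data s' x)). reflexivity.
- intros A B f g t. icell_ext; [first [apply I1 | apply I2 | apply I3].. | intros X x].
  cbn. unfold inat_hcmp, inat_id. cbn. rewrite (ecomp_idl (E B X)).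
  apply cmp_idl.
- intros A B f g t. icell_ext; [first [apply I1 | apply I2 | apply I3].. | intros X x].
  cbn. unfold inat_hcmp, inat_id. cbn.
  rewrite (eapp_id (if_efun (ifun_ax f) X)). apply (ecomp_idr (E B X)).
- intros A B C D h h' g g' f f' u t s.
  icell_ext; [first [apply I1 | apply I2 | apply I3].. | intros X x].
  cbn. unfold inat_hcmp. cbn.
  rewrite eapp_efun_cmp, (eapp_comp (if_efun (ifun_ax h) X)).
  apply (ecomp_assoc (E D X)).
Qed.

(** * Transformations between functors of systems *)

Section KNat.
Variables (S : FinProdCat) (V : IMCData S) (HV : is_IMC V).
Variables (K L : KSys V) (F G : KFun K L).

Definition KNatData : Type := forall (X : S) (x : kob K X),
  tunit ~> khom (idm X) (idm X) (kfo F x) (kfo G x).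

Definition is_KNat (t : KNatData) : Prop :=
  forall X Y (x : kob K X) (y : kob K Y),
    kpost (pr2 Y X) (kapp (cmp_idl (pr1 Y X)) (cmp_idl (pr1 Y X)) (t Y y))
      ∘ kfh F (pr1 Y X) (pr2 Y X) x y
    = kpre (pr1 Y X) (kapp (cmp_idl (pr2 Y X)) (cmp_idl (pr2 Y X)) (t X x))
      ∘ kfh G (pr1 Y X) (pr2 Y X) x y.

(** The square is the pullback along [⟨b, a⟩] of the one required at the universal pair. *)
Lemma knat_nat (t : KNatData) (Ht : is_KNat t)
    (W X Y : S) (b : W ~> Y) (a : W ~> X) (x : kob K X) (y : kob K Y) :
  kpost a (kapp (cmp_idl b) (cmp_idl b) (t Y y)) ∘ kfh F b a x y
  = kpre b (kapp (cmp_idl a) (cmp_idl a) (t X x)) ∘ kfh G b a x y.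
Proof.
assert (eb := pr1_pair b a). assert (ea := pr2_pair b a).
apply (cancel_epi (kpl_kplV eb ea x y)). ra.
rewrite !kfh_kpl.
rewrite <- (kapp_kapp HV (cmp_idl (pr1 Y X)) (cmp_idl (pr1 Y X))
  eb eb eb (cmp_idl b) (cmp_idl b)).
rewrite <- (kapp_kapp HV (cmp_idl (pr2 Y X)) (cmp_idl (pr2 Y X))
  ea ea ea (cmp_idl a) (cmp_idl a)).
rw (eq_sym (kpl_post eb eb ea _)).
rw (eq_sym (kpl_pre eb ea ea _)).
rewrite <- !smor_cmp. now rewrite Ht.
Qed.

Lemma knat_app (t : KNatData) (Ht : is_KNat t)
    (W X Y : S) (b : W ~> Y) (a : W ~> X) (x : kob K X) (y : kob K Y)
    (u : tunit ~> khom b a x y) :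
  kcomp (kapp (cmp_idl b) (cmp_idl b) (t Y y)) (kfh F b a x y ∘ u)
  = kcomp (kfh G b a x y ∘ u) (kapp (cmp_idl a) (cmp_idl a) (t X x)).
Proof.
rewrite (kcomp_pre (kfh G b a x y ∘ u)). unfold kcomp.
rewrite <- !cmp_assoc. f_equal. now apply knat_nat.
Qed.

Lemma knat_app_idm (t : KNatData) (Ht : is_KNat t) (X : S) (x y : kob K X)
    (u : tunit ~> khom (idm X) (idm X) x y) :
  kcomp (t X y) (kfh F (idm X) (idm X) x y ∘ u)
  = kcomp (kfh G (idm X) (idm X) x y ∘ u) (t X x).
Proof.
assert (q := knat_app Ht (b := idm X) (a := idm X) u).
now rewrite !(kapp_idm HV) in q.
Qed.
End KNat.

Section KNatOps.
Variables (S : FinProdCat) (V : IMCData S) (HV : is_IMC V).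

Lemma knat_id (K L : KSys V) (F : KFun K L) :
  is_KNat (F := F) (G := F) (fun X x => kid (idm X) (kfo F x)).
Proof. intros X Y x y. now rewrite !kapp_kid, kpost_id, kpre_id. Qed.

Lemma knat_vcmp (K L : KSys V) (F G H : KFun K L) (t : KNatData G H)
    (s : KNatData F G) :
  is_KNat t -> is_KNat s ->
  is_KNat (F := F) (G := H) (fun X x => kcomp (t X x) (s X x)).
Proof.
intros Ht Hs X Y x y.
rewrite (kapp_comp (cmp_idl (pr1 Y X)) (cmp_idl (pr1 Y X)) (cmp_idl (pr1 Y X))).
rewrite (kapp_comp (cmp_idl (pr2 Y X)) (cmp_idl (pr2 Y X)) (cmp_idl (pr2 Y X))).
rewrite kpost_comp, kpre_comp. ra. rewrite Hs. rw (kpost_kpre _ _).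
now rewrite Ht.
Qed.

Lemma knat_post (K L M : KSys V) (F G : KFun K L) (P : KFun L M)
    (s : KNatData F G) :
  is_KNat s ->
  is_KNat (F := kfun_cmp P F) (G := kfun_cmp P G)
    (fun X x => kfh P (idm X) (idm X) _ _ ∘ s X x).
Proof.
intros Hs X Y x y. cbn. rewrite <- !kfh_kapp.
rw (eq_sym (kfh_post P _)). rewrite Hs. now rw (kfh_pre P _).
Qed.

Lemma knat_pre (J K L : KSys V) (Q : KFun J K) (F G : KFun K L)
    (s : KNatData F G) :
  is_KNat s ->
  is_KNat (F := kfun_cmp F Q) (G := kfun_cmp G Q) (fun X x => s X (kfo Q x)).
Proof. intros Hs X Y x y. cbn. rewrite <- !cmp_assoc. now rewrite Hs. Qed.

Lemma knat_hcmp (K L M : KSys V) (F F' : KFun K L) (G G' : KFun L M)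
    (t : KNatData G G') (s : KNatData F F') :
  is_KNat t -> is_KNat s ->
  is_KNat (F := kfun_cmp G F) (G := kfun_cmp G' F') (fun X x =>
    kcomp (t X (kfo F' x)) (kfh G (idm X) (idm X) _ _ ∘ s X x)).
Proof.
intros Ht Hs X Y x y. cbn.
rewrite (kapp_comp (cmp_idl (pr1 Y X)) (cmp_idl (pr1 Y X)) (cmp_idl (pr1 Y X))).
rewrite (kapp_comp (cmp_idl (pr2 Y X)) (cmp_idl (pr2 Y X)) (cmp_idl (pr2 Y X))).
rewrite kpost_comp, kpre_comp. ra. rewrite <- !kfh_kapp.
rw (eq_sym (kfh_post G _)). rewrite Hs. rw (kfh_pre G _).
rw (kpost_kpre _ _). now rw (knat_nat HV Ht _ _ _ _).
Qed.
End KNatOps.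

Section LNatLemmas.
Variables (S : FinProdCat) (V : IMCData S) (HV : is_IMC V).
Variables (A B : LCatData V) (HA : is_LCat A) (HB : is_LCat B).
Variables (F G : LIFunData A B) (HF : is_LIFun F) (HG : is_LIFun G).

(** [is_LNat] is written over composites with the identity extent components; [idl_ind] strips
    these, and what remains is convertible with naturality in [gamma]. *)
Lemma lnat_iff (t : LNatData F G) :
  is_LNat t
  <-> is_KNat (F := gfun HV HA HB HF) (G := gfun HV HA HB HG) t.
Proof.
assert (H : forall W X Y (b b' : W ~> Y) (a a' : W ~> X)
  (eb : idm Y ∘ b = b') (ea : idm X ∘ a = a') (x : lob A X) (y : lob A Y),
  gpost (B := B) a' (li_ob F x) (pull_unit (pair_cmp eb eb) (t Y y)
       : tunit ~> ghom b' b' (li_ob F y) (li_ob G y))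
    ∘ gmap (F := F) (x := x) (y := y) eb ea
  = gpre (B := B) b' (li_ob G y) (pull_unit (pair_cmp ea ea) (t X x)
       : tunit ~> ghom a' a' (li_ob F x) (li_ob G x))
    ∘ gmap (F := G) eb ea
  <-> kpost (K := gamma HV HB) a
      (kapp (K := gamma HV HB) (cmp_idl b) (cmp_idl b) (t Y y))
      ∘ gfm F b a x y
    = kpre (K := gamma HV HB) b
      (kapp (K := gamma HV HB) (cmp_idl a) (cmp_idl a) (t X x))
      ∘ gfm G b a x y).
{ intros W X Y b b' a a' eb ea x y. revert b' eb. apply idl_ind.
  revert a' ea. apply idl_ind. reflexivity. }
split; intros H' X Y x y.
- apply (proj1 (H _ _ _ _ _ _ _ eq_refl eq_refl x y)), H'.
- cbn. apply (proj2 (H _ _ _ _ _ _ _ eq_refl eq_refl x y)), H'.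
Qed.
End LNatLemmas.

(** * The 2-category of V-fibrations *)

Section LargeCells.
Variables (S : FinProdCat) (V : IMCData S) (HV : is_IMC V).

Lemma lifun_id_ax (A : LCatData V) (HA : is_LCat A) : is_LIFun (lifun_id A).
Proof.
apply lifun_intro; cbn; intros.
- rewrite (gfm_lifun_id HV), (gid_idm HV HA). apply cmp_idl.
- rewrite !(gfm_lifun_id HV), tmor_id, cmp_idl, cmp_idr. reflexivity.
Qed.

Lemma lifun_cmp_ax (A B C : LCatData V) (HA : is_LCat A) (HB : is_LCat B)
    (HC : is_LCat C) (G : LIFunData B C) (F : LIFunData A B) :
  is_LIFun G -> is_LIFun F -> is_LIFun (lifun_cmp G F).
Proof.
intros HG HF. apply lifun_intro; cbn; intros.
- rewrite (gfm_lifun_cmp HV), <- (gid_idm HV HA). ra.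
  rewrite (gfm_gid HV HA HF). apply (gfm_gid HV HB HG).
- rewrite !(gfm_lifun_cmp HV). ra. rewrite (gfm_gcmp HV HF).
  rw (gfm_gcmp HV HG _ _ _ _ _ _). now rewrite tmor_cmp_.
Qed.

Section Cells.
Variables (A B : LCatData V) (HA : is_LCat A) (HB : is_LCat B).

Lemma lnat_id_ax (F : LIFunData A B) (HF : is_LIFun F) : is_LNat (lnat_id F).
Proof.
assert (e : lnat_id F = (fun X x => gid (idm X) (li_ob F x))).
{ do 2 (apply functional_extensionality_dep; intro).
  symmetry. apply (gid_idm HV HB). }
rewrite e. apply (proj2 (lnat_iff HV HA HB HF HF _)).
exact (knat_id (gfun HV HA HB HF)).
Qed.

Lemma lnat_vcmp_ax (F G H : LIFunData A B) (HF : is_LIFun F) (HG : is_LIFun G)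
    (HH : is_LIFun H) (t : LNatData G H) (s : LNatData F G) :
  is_LNat t -> is_LNat s -> is_LNat (lnat_vcmp t s).
Proof.
intros Ht Hs. apply (proj2 (lnat_iff HV HA HB HF HH _)).
exact (knat_vcmp (proj1 (lnat_iff HV HA HB HG HH t) Ht)
  (proj1 (lnat_iff HV HA HB HF HG s) Hs)).
Qed.
End Cells.

Lemma lnat_hcmp_ax (A B C : LCatData V) (HA : is_LCat A) (HB : is_LCat B)
    (HC : is_LCat C) (F F' : LIFunData A B) (G G' : LIFunData B C)
    (HF : is_LIFun F) (HF' : is_LIFun F') (HG : is_LIFun G) (HG' : is_LIFun G')
    (t : LNatData G G') (s : LNatData F F') :
  is_LNat t -> is_LNat s -> is_LNat (lnat_hcmp t s).
Proof.
intros Ht Hs.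
apply (proj2 (lnat_iff HV HA HC (lifun_cmp_ax HA HB HC HG HF)
  (lifun_cmp_ax HA HB HC HG' HF') _)).
intros X Y x y. cbn. rewrite !(gfm_lifun_cmp HV).
exact (knat_hcmp HV (proj1 (lnat_iff HV HB HC HG HG' t) Ht)
  (proj1 (lnat_iff HV HA HB HF HF' s) Hs) x y).
Qed.
End LargeCells.

Lemma VFIB_wf_ok (S : FinProdCat) (V : IMCData S) (HV : is_IMC V) : VFIB_wf V.
Proof.
assert (H : forall A : VFib V, is_LCat A) by (intros A; apply (vf_cat (vfib_ax A))).
split; intros.
- apply (lifun_id_ax HV (H A)).
- apply (lifun_cmp_ax HV (H A) (H B) (H C)); apply lifun_ax.
- apply (lnat_id_ax HV (H A) (H B)), lifun_ax.
- apply (lnat_vcmp_ax HV (H A) (H B)); try apply lifun_ax; apply lnat_ax.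
- apply (lnat_hcmp_ax HV (H A) (H B) (H C)); try apply lifun_ax; apply lnat_ax.
Qed.

Section LargeExt.
Variables (S : FinProdCat) (V : IMCData S) (HV : is_IMC V).

Lemma vlcat (A : VFib V) : is_LCat A.
Proof. apply (vf_cat (vfib_ax A)). Qed.

Lemma lifun_bext (A B : LCatData V) (F G : LIFun A B)
    (e : (fun X x => li_ob F (X := X) x) = (fun X x => li_ob G (X := X) x)) :
  (forall X Y (x : lob A X) (y : lob A Y),
    match e in _ = o return ghom (pr1 Y X) (pr2 Y X) x y
      ~> ghom (pr1 Y X) (pr2 Y X) (o X x) (o Y y)
    with eq_refl => gfm F (pr1 Y X) (pr2 Y X) x y end
    = gfm G (pr1 Y X) (pr2 Y X) x y) ->
  F = G.
Proof.
intros H. assert (q := lifun_ext HV (e := e) H). destruct F, G. cbn in q.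
destruct q. f_equal. apply proof_irrelevance.
Qed.

Lemma lnat_ext (A B : LCatData V) (F G : LFunData A B) (t s : LNat F G) :
  (forall X (x : lob A X), lnat_data t x = lnat_data s x) -> t = s.
Proof.
destruct t as [t a], s as [s a']. cbn. intros H.
assert (e : t = s) by (do 2 (apply functional_extensionality_dep; intro); apply H).
destruct e. f_equal. apply proof_irrelevance.
Qed.

Lemma lcell_ext (w : VFIB_wf V) (A B : VFib V) (F F' G G' : LIFun A B)
    (t : LNat F G) (t' : LNat F' G')
    (eo : (fun X x => li_ob F (X := X) x) = (fun X x => li_ob F' (X := X) x))
    (eo' : (fun X x => li_ob G (X := X) x) = (fun X x => li_ob G' (X := X) x)) :
  F = F' -> G = G' ->
  (forall X (x : lob A X),
    match eo in _ = o
      return tunit ~> ghom (idm X) (idm X) (o X x) (li_ob G' x) with eq_refl =>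
      match eo' in _ = o'
        return tunit ~> ghom (idm X) (idm X) (li_ob F x) (o' X x)
      with eq_refl => lnat_data t x end end = lnat_data t' x) ->
  pack (C := VFIB w) (a := A) (b := B) t
  = pack (C := VFIB w) (a := A) (b := B) t'.
Proof.
intros e e'. destruct e, e'.
rewrite (proof_irrelevance _ eo eq_refl), (proof_irrelevance _ eo' eq_refl).
intros H. f_equal. now apply lnat_ext.
Qed.
End LargeExt.

Ltac lifun_ext HV :=
  lazymatch goal with |- ?F = ?G =>
    refine (@lifun_bext _ _ HV _ _ F G eq_refl _) end.
Ltac lcell_ext :=
  lazymatch goal with |- @pack _ _ _ ?F ?G ?t = @pack _ _ _ ?F' ?G' ?t' =>
    refine (@lcell_ext _ _ _ _ _ F F' G G' t t' eq_refl eq_refl _ _ _) end.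

Lemma VFIB_2cat (S : FinProdCat) (V : IMCData S) (HV : is_IMC V)
    (w : VFIB_wf V) : is_2category (VFIB w).
Proof.
assert (I1 : forall (A B : VFib V) (f : LIFun A B),
  cmp1 (t := VFIB w) (id1 (t := VFIB w) B) f = f).
{ intros A B f. lifun_ext HV; cbn; intros.
  rewrite (gfm_lifun_cmp HV), (gfm_lifun_id HV). apply cmp_idl. }
assert (I2 : forall (A B : VFib V) (f : LIFun A B),
  cmp1 (t := VFIB w) f (id1 (t := VFIB w) A) = f).
{ intros A B f. lifun_ext HV; cbn; intros.
  rewrite (gfm_lifun_cmp HV), (gfm_lifun_id HV). apply cmp_idr. }
assert (I3 : forall (A B C D : VFib V) (h : LIFun C D) (g : LIFun B C) (f : LIFun A B),
  cmp1 (t := VFIB w) (cmp1 (t := VFIB w) h g) f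
  = cmp1 (t := VFIB w) h (cmp1 (t := VFIB w) g f)).
{ intros A B C D h g f. lifun_ext HV; cbn; intros.
  rewrite !(gfm_lifun_cmp HV). apply cmp_assoc. }
(* [L1] to [L5] restate the calculus of [gamma] for [gcomp] and [lc_id]; the latter equals [kid] at
   [idm] only by [gid_idm]. *)
assert (L1 : forall (B : VFib V) (X : S) (x y : lob B X)
  (u : tunit ~> ghom (idm X) (idm X) x y), gcomp (lc_id y) u = u).
{ intros B X x y u. rewrite <- (gid_idm HV (vlcat B)).
  apply (kcomp_idl (K := gamma HV (vlcat B)) u). }
assert (L2 : forall (B : VFib V) (X : S) (x y : lob B X)
  (u : tunit ~> ghom (idm X) (idm X) x y), gcomp u (lc_id x) = u).
{ intros B X x y u. rewrite <- (gid_idm HV (vlcat B)).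
  apply (kcomp_idr (K := gamma HV (vlcat B)) u). }
assert (L3 : forall (B : VFib V) (X : S) (x y z w : lob B X)
  (t : tunit ~> ghom (idm X) (idm X) z w)
  (v : tunit ~> ghom (idm X) (idm X) y z)
  (u : tunit ~> ghom (idm X) (idm X) x y),
  gcomp (gcomp t v) u = gcomp t (gcomp v u)).
{ intros B X x y z w' t v u. apply (kcomp_assoc (K := gamma HV (vlcat B))). }
assert (L4 : forall (B C : VFib V) (G : LIFun B C) (X : S) (x y z : lob B X)
  (v : tunit ~> ghom (idm X) (idm X) y z)
  (u : tunit ~> ghom (idm X) (idm X) x y),
  gfm G _ _ _ _ ∘ gcomp v u = gcomp (gfm G _ _ _ _ ∘ v) (gfm G _ _ _ _ ∘ u)).
{ intros. apply (kfh_kcomp (gfun HV (vlcat B) (vlcat C) (lifun_ax G)) v u). }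
assert (L5 : forall (B C : VFib V) (G : LIFun B C) (X : S) (x : lob B X),
  gfm G (idm X) (idm X) x x ∘ lc_id x = lc_id (li_ob G x)).
{ intros. rewrite <- (gid_idm HV (vlcat B)), <- (gid_idm HV (vlcat C)).
  apply (gfm_gid HV (vlcat B) (lifun_ax G)). }
split; auto.
- intros A B f g t. apply lnat_ext. intros. apply L1.
- intros A B f g t. apply lnat_ext. intros. apply L2.
- intros A B f g h k u t s. apply lnat_ext. intros. apply L3.
- intros A B C g f. apply lnat_ext. intros X x. cbn. unfold lnat_hcmp, lnat_id.
  etransitivity; [exact (f_equal (fun q => gcomp _ q) (L5 _ _ g _ _)) | apply L1].
- intros A B C f f' f'' g g' g'' t' t s' s. apply lnat_ext. intros X x. cbn.
  unfold lnat_hcmp, lnat_vcmp. cbn.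
  (* Interchange is again naturality of [t] at [s' x]; the rest is reassociation. *)
  assert (q := knat_app_idm HV
    (proj1 (lnat_iff HV (vlcat B) (vlcat C) (lifun_ax g) (lifun_ax g') t) (lnat_ax t))
    (lnat_data s' x)).
  etransitivity; [exact (f_equal (fun q => gcomp _ q) (L4 _ _ g _ _ _ _ _ _))|].
  etransitivity; [apply L3|]. etransitivity; [|symmetry; apply L3].
  refine (f_equal (fun q => gcomp _ q) _). etransitivity; [symmetry; apply L3|].
  etransitivity; [|apply L3].
  apply (f_equal (fun z => gcomp z _)). exact q.
- intros A B f g t. lcell_ext; [apply I1.. | intros X x].
  cbn. unfold lnat_hcmp, lnat_id. cbn.
  etransitivity; [apply L1|].
  change (gfm (lifun_id B) (idm X) (idm X) (li_ob f x) (li_ob g x) ∘ lnat_data t x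
   = lnat_data t x).
  rewrite (gfm_lifun_id HV). apply cmp_idl.
- intros A B f g t. lcell_ext; [apply I2.. | intros X x].
  cbn. unfold lnat_hcmp, lnat_id. cbn.
  etransitivity; [exact (f_equal (fun q => gcomp _ q) (L5 _ _ f _ x)) | apply L2].
- intros A B C D h h' g g' f f' u t s.
  lcell_ext; [apply I3.. | intros X x].
  cbn. unfold lnat_hcmp. cbn.
  change (gcomp (gcomp (lnat_data u (li_ob g' (li_ob f' x)))
      (gfm h _ _ _ _ ∘ lnat_data t (li_ob f' x)))
    (gfm (lifun_cmp h g) (idm X) (idm X) (li_ob f x) (li_ob f' x) ∘ lnat_data s x)
    = gcomp (lnat_data u (li_ob g' (li_ob f' x)))
      (gfm h (idm X) (idm X) _ _ ∘ gcomp (lnat_data t (li_ob f' x))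
         (gfm g (idm X) (idm X) _ _ ∘ lnat_data s x))).
  rewrite (gfm_lifun_cmp HV). etransitivity; [apply L3|].
  refine (f_equal (fun q => gcomp _ q) _). symmetry. etransitivity; [apply L4|]. now ra.
Qed.

(** * The 2-functor Θ *)

Section ThetaObjects.
Variables (S : FinProdCat) (V : IMCData S) (HV : is_IMC V).
Variables (A : ICatData V) (HA : is_ICat A).

Lemma theta_lcat : is_LCat (theta_cat A).
Proof. exact (lsys_lcat (phi HA)). Qed.

Lemma thV_kcomp (W X Y Z : S) (c : W ~> Z) (b : W ~> Y) (a : W ~> X)
    (x : A X) (y : A Y) (z : A Z)
    (v : elt (ic_re A b y) (ic_re A c z)) (u : elt (ic_re A a x) (ic_re A b y)) :
  thV (K := phi HA) c a x z ∘ ecomp v u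
  = gcomp (B := theta_cat A) (thV (K := phi HA) c b y z ∘ v)
      (thV (K := phi HA) b a x y ∘ u).
Proof. exact (kfh_kcomp (thVfun HV (K := phi HA) theta_lcat) v u). Qed.

Lemma thV_eid (W X : S) (a : W ~> X) (x : A X) :
  thV (K := phi HA) a a x x ∘ eid (ic_re A a x) = gid (B := theta_cat A) a x.
Proof. exact (thV_kid (K := phi HA) a x). Qed.

Lemma thV_eid_idm (X : S) (x : A X) :
  thV (K := phi HA) (idm X) (idm X) x x ∘ eid (ic_re A (idm X) x)
  = lc_id (l := theta_cat A) x.
Proof. rewrite thV_eid. exact (gid_idm HV theta_lcat x). Qed.

(** In [phi HA] the hom-object from [f^* x] at [1] to [x] at [f] consists of the maps from
    [1^* f^* x] to [f^* x] in A^Y, so the unit isomorphism of [f^* x] and its inverse serve as the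
    restriction. *)
Definition theta_restr (X Y : S) (f : Y ~> X) (x : A X) :
  Restriction (B := theta_cat A) f x.
Proof.
refine (@Build_Restriction _ _ (theta_cat A) X Y f x (ic_re A f x)
  (thV (K := phi HA) f (idm Y) (ic_re A f x) x ∘ ic_idV (ic_re A f x))
  (thV (K := phi HA) (idm Y) f x (ic_re A f x) ∘ ic_id (ic_re A f x)) _ _).
- rewrite <- (thV_kcomp (c := idm Y) (b := f) (a := idm Y)), (ic_id_idV HA).
  apply thV_eid_idm.
- rewrite <- (thV_kcomp (c := f) (b := idm Y) (a := f)), (ic_idV_id HA).
  apply thV_eid.
Defined.

Lemma theta_vfib : is_VFib (theta_cat A).
Proof.
split; [exact theta_lcat|]. intros. constructor. apply theta_restr.
Qed.
End ThetaObjects.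

Section ThetaCells.
Variables (S : FinProdCat) (V : IMCData S) (HV : is_IMC V).

Section Functors.
Variables (A B : ICatData V) (HA : is_ICat A) (HB : is_ICat B).

Lemma theta_fun_ax (F : IFunData A B) : is_IFun F -> is_LIFun (theta_fun F).
Proof.
intros HF. apply lifun_intro.
- intros X x. apply (cancel_mono (thV_th (K := phi HB) (idm X) (idm X) _ _)).
  rw (th_gfm_theta HV HA HB HF (idm X) (idm X) x x).
  etransitivity; [exact (f_equal _ (th_lc_id (K := phi HA) x))|].
  etransitivity; [exact (phih_kid HB HF (idm X) x)|].
  symmetry. exact (th_gid (K := phi HB) (idm X) (F X x)).
- intros X Y Z x y z c b a.
  apply (cancel_mono (thV_th (K := phi HB) c a _ _)).
  rw (th_gfm_theta HV HA HB HF c a x z).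
  etransitivity; [exact (f_equal _ (th_gcmp (K := phi HA) c b a x y z))|].
  rewrite <- cmp_assoc.
  etransitivity; [exact (f_equal (fun q => q ∘ _) (phih_kcm HB HF c b a x y z))|].
  symmetry. rewrite <- cmp_assoc.
  etransitivity; [exact (f_equal (fun q => q ∘ _)
    (th_gcmp (K := phi HB) c b a (F X x) (F Y y) (F Z z)))|].
  ra. f_equal. etransitivity; [apply tmor_cmp_|].
  etransitivity; [exact (f_equal2 (fun p q => p ⊗₁ q)
    (th_gfm_theta HV HA HB HF c b y z) (th_gfm_theta HV HA HB HF b a x y))|].
  apply tmor_cmp.
Qed.

(** By naturality of [ic_cmp], reindexing along [idm Y] followed by pullback along [b] is reindexing
    along [b]; thus the components of [Θ t] pull back to reindexings of those of [t]. *)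
Lemma phi_kapp_app (X Y : S) (b : X ~> Y) (e e' : idm Y ∘ b = b) (x y : A Y) (u : elt x y) :
  kapp (K := phi HA) (x := x) (y := y) e e' (ic_app (idm Y) u) = ic_app b u.
Proof.
rewrite (proof_irrelevance _ e' e).
rewrite phi_kapp, <- (ic_app_cmp HV HA e u).
erw (icE HA X) (ic_cmpVE_cmpE HA e y). apply (ecomp_idl (icE HA X)).
Qed.
End Functors.

Lemma theta_nat_ax (A B : ICatData V) (HA : is_ICat A) (HB : is_ICat B)
    (F G : IFunData A B) (HF : is_IFun F) (HG : is_IFun G) (t : INatData F G) :
  is_INat t -> is_LNat (theta_nat t).
Proof.
intros Ht. assert (E := icE HB).
apply (proj2 (lnat_iff HV (theta_lcat HA) (theta_lcat HB)
  (theta_fun_ax HA HB HF) (theta_fun_ax HA HB HG) _)).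
(* Naturality within [phi HB], from [in_nat] over the product and [in_re] along both projections. *)
assert (N0 : forall X Y (x : A X) (y : A Y),
  epost (ic_app (pr1 Y X) (t Y y)) ∘ phih F (pr1 Y X) (pr2 Y X) x y
  = epre (ic_app (pr2 Y X) (t X x)) ∘ phih G (pr1 Y X) (pr2 Y X) x y).
{ intros X Y x y. set (b := pr1 Y X). set (a := pr2 Y X).
  (* At the source the inverse [if_reV] occurs, so [in_re] is solved for it. *)
  assert (q1 : ecomp (t _ (ic_re A a x)) (if_reV F a x)
     = ecomp (if_reV G a x) (ic_app a (t X x))).
  { rewrite <- (ecomp_idr (E _) (ic_app a (t X x))), <- (if_re_reV HF a x).
    rewrite <- (ecomp_idl (E _) (ecomp (t _ _) _)), <- (if_reV_re HG a x).
    era (E (prd Y X)). erw (E (prd Y X)) (in_re Ht a x). reflexivity. }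
  unfold phih. ra. rw (eq_sym (epost_comp (E _) _ _)).
  rewrite <- (in_re Ht), (epost_comp (E _)). ra.
  rw (epost_epre (E _) (t _ _) _). rewrite (in_nat Ht (ic_re A a x) (ic_re A b y)).
  rw (eq_sym (epre_comp (E _) _ _)). rewrite q1, (epre_comp (E _)).
  rw (eq_sym (epost_epre (E _) (if_re G b y) (ic_app a _))). reflexivity. }
intros X Y x y. set (b := pr1 Y X). set (a := pr2 Y X).
assert (H : forall (F : IFunData A B) (HF : is_IFun F),
  gfm (theta_fun F) b a x y
  = thV (K := phi HB) b a (F X x) (F Y y) ∘ (phih F b a x y
    ∘ th (K := phi HA) b a x y)).
{ intros F' HF'. rewrite <- (th_gfm_theta HV HA HB HF').
  rw (thV_th (K := phi HB) _ _ _ _). symmetry. apply cmp_idl. }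
cbn [kfh gfun]. rewrite (H F HF), (H G HG).
assert (N : is_KNat (F := phifun HA HB HF) (G := phifun HA HB HG)
  (fun X x => ic_app (idm X) (t X x))).
{ intros X' Y' x' y'. rewrite !(phi_kapp_app HB). apply N0. }
(* Composition with [th] and [thV] is whiskering with functors of systems, which carries [N] over to
   [gamma]. *)
exact (knat_post (thVfun HV (K := phi HB) (theta_lcat HB)) (knat_pre (thfun HV (K := phi HA) (theta_lcat HA)) N) x y).
Qed.
End ThetaCells.

Lemma Theta_wf_ok (S : FinProdCat) (V : IMCData S) (HV : is_IMC V) : Theta_wf V.
Proof.
split; intros.
- apply (theta_vfib HV (icat_ax A)).
- apply (theta_fun_ax HV (icat_ax A) (icat_ax B)), ifun_ax.
- apply (theta_nat_ax HV (icat_ax A) (icat_ax B)); try apply ifun_ax.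
  apply inat_ax.
Qed.

Section ThetaFunctor.
Variables (S : FinProdCat) (V : IMCData S) (HV : is_IMC V).

Lemma gfm_theta (A B : ICatData V) (HA : is_ICat A) (HB : is_ICat B)
    (F : IFunData A B) (HF : is_IFun F)
    (W X Y : S) (b : W ~> Y) (a : W ~> X) (x : A X) (y : A Y) :
  gfm (theta_fun F) b a x y
  = thV (K := phi HB) b a (F X x) (F Y y)
    ∘ (phih F b a x y ∘ th (K := phi HA) b a x y).
Proof.
rewrite <- (th_gfm_theta HV HA HB HF).
rw (thV_th (K := phi HB) _ _ _ _). symmetry. apply cmp_idl.
Qed.

Lemma phih_id (A : ICatData V) (HA : is_ICat A)
    (W X Y : S) (b : W ~> Y) (a : W ~> X) (x : A X) (y : A Y) :
  phih (ifun_id A) b a x y = idm _.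
Proof.
unfold phih. cbn.
now rewrite (epost_id (icE HA W)), (epre_id (icE HA W)), !cmp_idl.
Qed.

Lemma phih_cmp (A B C : ICatData V) (HC : is_ICat C) (G : IFunData B C)
    (F : IFunData A B) (HG : is_IFun G)
    (W X Y : S) (b : W ~> Y) (a : W ~> X) (x : A X) (y : A Y) :
  phih (ifun_cmp G F) b a x y
  = phih G b a (F X x) (F Y y) ∘ phih F b a x y.
Proof.
unfold phih. cbn. rewrite (epost_comp (icE HC W)), (epre_comp (icE HC W)). ra.
rw (efh_efh_post HG _). rw (efh_pre (if_efun HG W) _).
rw (epost_epre (icE HC W) _ (if_reV G a (F X x))). reflexivity.
Qed.

Lemma phih_app (A B : ICatData V) (HB : is_ICat B) (F : IFunData A B)
    (HF : is_IFun F) (X Y : S) (f : X ~> Y) (x y : A Y) (u : elt x y) :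
  phih F f f x y ∘ ic_app f u = ic_app f (eapp (F Y) u).
Proof.
unfold phih. ra. change (efh (F X) (ic_re A f x) (ic_re A f y) ∘ ic_app f u)
  with (eapp (F X) (ic_app f u)).
rewrite <- ecomp_pre.
change (ecomp (if_re F f y) (ecomp (eapp (F X) (ic_app f u)) (if_reV F f x))
  = ic_app f (eapp (F Y) u)).
erw (icE HB X) (if_app HF f u). rewrite (if_re_reV HF).
apply (ecomp_idr (icE HB X)).
Qed.

Lemma Theta_2functor (wi : VCATidx_wf V) (wf : VFIB_wf V) (w : Theta_wf V) :
  is_2functor (Theta wi wf w).
Proof.
assert (I1 : forall a : ICat V, fun1 (Theta wi wf w) (id1 (t := VCATidx wi) a)
  = id1 (t := VFIB wf) (Theta wi wf w a)).
{ intros A. lifun_ext HV. intros X Y x y. cbn.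
  rewrite (gfm_lifun_id HV), (gfm_theta (icat_ax A) (icat_ax A) (ifun_id_ax (icat_ax A))).
  rewrite (phih_id (icat_ax A)), cmp_idl.
  exact (thV_th (K := phi (icat_ax A)) _ _ x y). }
assert (I2 : forall (A B C : ICat V) (G : IFun B C) (F : IFun A B),
  fun1 (Theta wi wf w) (cmp1 (t := VCATidx wi) G F)
  = cmp1 (t := VFIB wf) (fun1 (Theta wi wf w) G) (fun1 (Theta wi wf w) F)).
{ intros A B C G F. lifun_ext HV. intros X Y x y. cbn.
  rewrite (gfm_lifun_cmp HV).
  rewrite (gfm_theta (icat_ax A) (icat_ax C) (ifun_cmp_ax (icat_ax A) (icat_ax B) (icat_ax C) (ifun_ax G) (ifun_ax F))).
  rewrite (phih_cmp (icat_ax C) F (ifun_ax G)).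
  rewrite (gfm_theta (icat_ax A) (icat_ax B) (ifun_ax F)).
  etransitivity; [|exact (f_equal (fun q => q ∘ _) (eq_sym
    (gfm_theta (icat_ax B) (icat_ax C) (ifun_ax G) (pr1 Y X) (pr2 Y X)
       (F X x) (F Y y))))].
  exact (cancel_mid _ _ _ _ (th_thV (K := phi (icat_ax B)) _ _ _ _)). }
assert (L : forall (B : ICat V) (X : S) (x y z : B X)
  (v : elt y z) (u : elt x y),
  thV (K := phi (icat_ax B)) (idm X) (idm X) x z ∘ ic_app (idm X) (ecomp v u)
  = gcomp (B := theta_cat B)
      (thV (K := phi (icat_ax B)) (idm X) (idm X) y z ∘ ic_app (idm X) v)
      (thV (K := phi (icat_ax B)) (idm X) (idm X) x y ∘ ic_app (idm X) u)).
{ intros. rewrite (ic_app_comp (icat_ax B)). apply thV_kcomp, HV. }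
split; auto.
- intros A B F. apply lnat_ext. intros X x. cbn. unfold lnat_id, theta_nat, inat_id.
  rewrite (ic_app_id (icat_ax B)). exact (thV_eid_idm HV (icat_ax B) (F X x)).
- intros A B F G H t s. apply lnat_ext. intros X x.
  exact (L B X _ _ _ (inat_data t x) (inat_data s x)).
- intros A B C F F' G G' t s. lcell_ext; [apply I2.. | intros X x].
  cbn. unfold theta_nat, inat_hcmp, lnat_hcmp. cbn.
  etransitivity; [exact (L C X _ _ _ (inat_data t (F' X x)) (eapp (G X) (inat_data s x)))|].
  refine (f_equal (fun q => gcomp _ q) _).
  change (thV (K := phi (icat_ax C)) (idm X) (idm X) _ _ ∘ ic_app (idm X) (eapp (G X) (inat_data s x))
    = gfm (theta_fun G) (idm X) (idm X) (F X x) (F' X x)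
      ∘ (thV (K := phi (icat_ax B)) (idm X) (idm X) _ _ ∘ ic_app (idm X) (inat_data s x))).
  rewrite (gfm_theta (icat_ax B) (icat_ax C) (ifun_ax G)).
  rewrite <- (phih_app (icat_ax C) (ifun_ax G)). symmetry.
  exact (cancel_mid2 _ _ _ (th_thV (K := phi (icat_ax B)) _ _ _ _)).
Qed.
End ThetaFunctor.

(** * The 2-functor Λ *)

(** Restrictions in a system, together with copies [ci], [cp], [cq] of the
    identities, pullbacks and inverse pullbacks in the shape in which they occur
    in [lambda_cat]. *)
Record KCleavage (S : FinProdCat) (V : IMCData S) (K : KSys V) := {
  ci : forall (X : S) (x : kob K X), tunit ~> khom (idm X) (idm X) x x;
  ciE : forall (X : S) (x : kob K X), ci x = kid (idm X) x;
  cp : forall (X Y : S) (f : X ~> Y) (x y : kob K Y),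
    f ^* khom (idm Y) (idm Y) x y ~> khom f f x y;
  cpE : forall (X Y : S) (f : X ~> Y) (x y : kob K Y),
    cp f x y = kpl (cmp_idl f) (cmp_idl f) x y;
  cq : forall (X Y : S) (f : X ~> Y) (x y : kob K Y),
    khom f f x y ~> f ^* khom (idm Y) (idm Y) x y;
  cqE : forall (X Y : S) (f : X ~> Y) (x y : kob K Y),
    cq f x y = kplV (cmp_idl f) (cmp_idl f) x y;
  ro : forall (X Y : S) (f : X ~> Y) (x : kob K Y), kob K X;
  rt : forall (X Y : S) (f : X ~> Y) (x : kob K Y),
    tunit ~> khom f (idm X) (ro f x) x;
  rf : forall (X Y : S) (f : X ~> Y) (x : kob K Y),
    tunit ~> khom (idm X) f x (ro f x);
  rf_rt : forall (X Y : S) (f : X ~> Y) (x : kob K Y),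
    kcomp (rf f x) (rt f x) = kid (idm X) (ro f x);
  rt_rf : forall (X Y : S) (f : X ~> Y) (x : kob K Y),
    kcomp (rt f x) (rf f x) = kid f x
}.
Arguments ci {S V K} k {X} x.
Arguments cp {S V K} k {X Y} f x y.
Arguments cq {S V K} k {X Y} f x y.
Arguments ro {S V K} k {X Y} f x.
Arguments rt {S V K} k {X Y} f x.
Arguments rf {S V K} k {X Y} f x.

Section LamK.
Variables (S : FinProdCat) (V : IMCData S) (HV : is_IMC V).
Variables (K : KSys V) (R : KCleavage K).

Definition lam_fib (X : S) : ECatData (V X) :=
  {| eob := kob K X;
     ehom := fun x y => khom (idm X) (idm X) x y;
     eid := fun x => ci R x;
     ecmp := fun x y z => kcm (idm X) (idm X) (idm X) x y z |}.

Definition lam_reh (X Y : S) (f : X ~> Y) (x y : kob K Y) :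
    f ^* khom (idm Y) (idm Y) x y ~> khom (idm X) (idm X) (ro R f x) (ro R f y) :=
  kpost (idm X) (rf R f y) ∘ kpre f (rt R f x) ∘ cp R f x y.

(** Convertible with [lambda_cat] for the restrictions [kclv] in [gamma]; the unit uses it over
    [phi HA] as well. *)
Definition lam_cat : ICatData V :=
  {| ic := lam_fib;
     ic_re := fun X Y f =>
       Build_EFunData (C := chbase (pb V f) (lam_fib Y)) (D := lam_fib X)
         (efo := fun x : kob K Y => ro R f x) (fun x y => lam_reh f x y);
     ic_ffinv := fun X Y f x y =>
       cq R f x y ∘ kpre f (rf R f x) ∘ kpost (idm X) (rt R f y);
     ic_cmp := fun X Y Z f g x =>
       kcomp (rf R f (ro R g x))
         (kcomp (kapp (cmp_idl f) eq_refl (rf R g x)) (rt R (g ∘ f) x));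
     ic_cmpV := fun X Y Z f g x =>
       kcomp (rf R (g ∘ f) x)
         (kcomp (kapp eq_refl (cmp_idl f) (rt R g x)) (rt R f (ro R g x)));
     ic_id := fun X x => rf R (idm X) x;
     ic_idV := fun X x => rt R (idm X) x |}.

Lemma krt_rf (X Y Z : S) (f : X ~> Y) (g : Y ~> Z) (x : kob K Z)
    (e : g ∘ f = g ∘ f) (e' : idm Y ∘ f = f) :
  kcomp (kapp e e' (rt R g x)) (kapp e' e (rf R g x)) = kid (g ∘ f) x.
Proof. rewrite <- kapp_comp, rt_rf. apply kapp_kid. Qed.

Lemma krf_rt (X Y Z : S) (f : X ~> Y) (g : Y ~> Z) (h : X ~> Z) (x : kob K Z)
    (e : g ∘ f = h) (e' : idm Y ∘ f = f) :
  kcomp (kapp e' e (rf R g x)) (kapp e e' (rt R g x)) = kid f (ro R g x).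
Proof. rewrite <- kapp_comp, rf_rt. apply kapp_kid. Qed.

Lemma lam_fib_ecat (X : S) : is_ECat (lam_fib X).
Proof.
split; intros; cbn.
- apply kassoc.
- rewrite ciE. apply kidl.
- rewrite ciE. apply kidr.
Qed.

Lemma lam_app (X Y : S) (f : X ~> Y) (x y : kob K Y)
    (u : tunit ~> khom (idm Y) (idm Y) x y) :
  ic_app (A := lam_cat) (x := x) (y := y) f u
  = kcomp (rf R f y)
      (kcomp (kapp (cmp_idl f) (cmp_idl f) u) (rt R f x)).
Proof.
unfold ic_app. cbn. unfold lam_reh. rewrite cpE, (kcomp_pre (kapp _ _ u)).
unfold kcomp, kapp. now ra.
Qed.

Lemma lam_cmpE (X Y Z : S) (f : X ~> Y) (g : Y ~> Z) (h : X ~> Z)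
    (e : g ∘ f = h) (x : kob K Z) :
  ic_cmpE (A := lam_cat) e x
  = kcomp (rf R f (ro R g x))
         (kcomp (kapp (cmp_idl f) e (rf R g x)) (rt R h x)).
Proof. now destruct e. Qed.

Lemma lam_reh_eid (X Y : S) (f : X ~> Y) (x : kob K Y) :
  lam_reh f x x ∘ (f ^*₁ ci R x ∘ fwd (sunit (pb V f))) = ci R (ro R f x).
Proof.
unfold lam_reh. rewrite cpE, !ciE. ra.
rw (kpl_kid (cmp_idl f) (cmp_idl f) x). rewrite <- kcomp_pre, kcomp_idl.
apply rf_rt.
Qed.

Lemma lam_reh_cmp (X Y : S) (f : X ~> Y) (x y z : kob K Y) :
  lam_reh f x z ∘ (f ^*₁ kcm (idm Y) (idm Y) (idm Y) x y z ∘ fwd (smul (pb V f) _ _))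
  = kcm (idm X) (idm X) (idm X) (ro R f x) (ro R f y) (ro R f z)
    ∘ (lam_reh f y z ⊗₁ lam_reh f x y).
Proof.
unfold lam_reh. rewrite !cpE. ra.
rw (kpl_kcm (cmp_idl f) (cmp_idl f) (cmp_idl f) x y z).
rewrite <- !cmp_assoc, tmor_cmp, <- cmp_assoc.
now rewrite <- (kcm_conj _ _ (rt_rf R f y)).
Qed.

Lemma lam_ff1 (X Y : S) (f : X ~> Y) (x y : kob K Y) :
  cq R f x y ∘ kpre f (rf R f x) ∘ kpost (idm X) (rt R f y) ∘ lam_reh f x y
  = idm _.
Proof.
unfold lam_reh. rewrite cpE, cqE. ra.
rw (eq_sym (kpost_comp _ _)). rewrite rt_rf, kpost_id, id_cmp.
rw (eq_sym (kpre_comp _ _)). rewrite rt_rf, kpre_id, id_cmp.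
apply kplV_kpl.
Qed.

Lemma lam_ff2 (X Y : S) (f : X ~> Y) (x y : kob K Y) :
  lam_reh f x y
    ∘ (cq R f x y ∘ kpre f (rf R f x) ∘ kpost (idm X) (rt R f y)) = idm _.
Proof.
unfold lam_reh. rewrite cpE, cqE. rw (kpl_kplV (cmp_idl f) (cmp_idl f) x y).
rewrite id_cmp. rw (eq_sym (kpre_comp _ _)). rewrite rf_rt, kpre_id, id_cmp.
rewrite <- kpost_comp, rf_rt. apply kpost_id.
Qed.

(** Both sides consist of restrictions, their pullbacks along [f], and pullback maps. Once the
    latter are merged by [kpl_kpl], all inner pairs [rt], [rf] cancel. *)
Lemma lam_nat (X Y Z : S) (f : X ~> Y) (g : Y ~> Z) (x y : kob K Z) :
  kpost (idm X) (kcomp (rf R f (ro R g y))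
         (kcomp (kapp (cmp_idl f) eq_refl (rf R g y)) (rt R (g ∘ f) y)))
    ∘ lam_reh (g ∘ f) x y
  = kpre (idm X) (kcomp (rf R f (ro R g x))
         (kcomp (kapp (cmp_idl f) eq_refl (rf R g x)) (rt R (g ∘ f) x)))
    ∘ (lam_reh f (ro R g x) (ro R g y)
       ∘ f ^*₁ lam_reh g x y ∘ fwd (pbcmp V f g _)).
Proof.
unfold lam_reh. rewrite !cpE, !smor_cmp. ra.
rw (kpl_post (cmp_idl f) eq_refl (cmp_idl f) (rf R g y)).
rw (kpl_pre eq_refl eq_refl (cmp_idl f) (rt R g x)).
change (pbcmp V f g (khom (idm Z) (idm Z) x y))
  with (pbcmpE (eq_refl (g ∘ f)) (khom (idm Z) (idm Z) x y)).
rw (kpl_kpl (eq_refl (g ∘ f)) (cmp_idl g) (cmp_idl g) eq_refl eq_refl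
  (cmp_idl (g ∘ f)) (cmp_idl (g ∘ f)) x y).
knorm. rewrite rt_rf, kcomp_idr.
krw (rt_rf R f (ro R g x)). rewrite kcomp_idl. krw (krt_rf _ _).
now rewrite kcomp_idl.
Qed.

Lemma lam_icat : is_ICat lam_cat.
Proof.
split.
- exact lam_fib_ecat.
- intros X Y f. split; [exact (lam_reh_eid f) | exact (lam_reh_cmp f)].
- exact lam_ff1.
- exact lam_ff2.
- intros X Y Z f g x y. exact (lam_nat f g x y).
- intros X Y Z f g x. split.
  + change (kcomp (kcomp (rf R (g ∘ f) x)
         (kcomp (kapp eq_refl (cmp_idl f) (rt R g x)) (rt R f (ro R g x))))
      (kcomp (rf R f (ro R g x))
         (kcomp (kapp (cmp_idl f) eq_refl (rf R g x)) (rt R (g ∘ f) x)))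
      = ci R (ro R (g ∘ f) x)).
    krw (rt_rf R f _). rewrite kcomp_idl. krw (krt_rf _ _).
    rewrite kcomp_idl, ciE. apply rf_rt.
  + change (kcomp (kcomp (rf R f (ro R g x))
         (kcomp (kapp (cmp_idl f) eq_refl (rf R g x)) (rt R (g ∘ f) x)))
       (kcomp (rf R (g ∘ f) x)
         (kcomp (kapp eq_refl (cmp_idl f) (rt R g x)) (rt R f (ro R g x))))
      = ci R (ro R f (ro R g x))).
    krw (rt_rf R (g ∘ f) _). rewrite kcomp_idl. krw (krf_rt _ _).
    rewrite kcomp_idl, ciE. apply rf_rt.
- intros X x y.
  change (kpost (idm X) (rf R (idm X) y) ∘ idm (khom (idm X) (idm X) x y)
    = kpre (idm X) (rf R (idm X) x) ∘ (lam_reh (idm X) x y ∘ fwd (pbid V _))).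
  unfold lam_reh. rewrite cpE. ra.
  rewrite kpl_idm, !cmp_idr. rw (eq_sym (kpost_kpre _ _)).
  now rewrite <- kpre_comp, rt_rf, kpre_id, cmp_idr.
- intros X x. split.
  + refine (eq_trans (rt_rf R (idm X) x) (eq_sym (ciE R x))).
  + refine (eq_trans (rf_rt R (idm X) x) (eq_sym (ciE R _))).
- intros X Y Z W f g h x. rewrite lam_cmpE.
  change (kcomp (ic_app (A := lam_cat) (x := ro R (h ∘ g) x) (y := ro R g (ro R h x)) f
       (kcomp (rf R g (ro R h x))
         (kcomp (kapp (cmp_idl g) eq_refl (rf R h x)) (rt R (h ∘ g) x))))
      (kcomp (rf R f (ro R (h ∘ g) x))
         (kcomp (kapp (cmp_idl f) eq_refl (rf R (h ∘ g) x)) (rt R (h ∘ g ∘ f) x)))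
    = kcomp (kcomp (rf R f (ro R g (ro R h x)))
         (kcomp (kapp (cmp_idl f) eq_refl (rf R g (ro R h x))) (rt R (g ∘ f) (ro R h x))))
       (kcomp (rf R (g ∘ f) (ro R h x))
         (kcomp (kapp (cmp_idl (g ∘ f)) (eq_sym (cmp_assoc h g f)) (rf R h x))
            (rt R (h ∘ g ∘ f) x)))).
  rewrite lam_app. krw (rt_rf R f _). rewrite kcomp_idl. krw (rt_rf R (g ∘ f) _).
  rewrite kcomp_idl.
  rewrite (kapp_comp (cmp_idl f) eq_refl (cmp_idl f)).
  rewrite (kapp_comp eq_refl eq_refl (cmp_idl f)).
  krw (krt_rf _ _). rewrite kcomp_idl.
  rewrite (kapp_kapp HV (cmp_idl g) eq_refl eq_refl eq_refl eq_refl
    (cmp_idl (g ∘ f)) (eq_sym (cmp_assoc h g f))).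
  now rewrite ?kcomp_assoc.
- intros X Y f x. rewrite lam_cmpE.
  change (ic_app f (ic_id x))
    with (ic_app (A := lam_cat) (x := x) (y := ro R (idm Y) x) f (rf R (idm Y) x)).
  rewrite lam_app. do 2 f_equal.
- intros X Y f x. rewrite lam_cmpE.
  rewrite (kapp_idm HV (K := K)), rf_rt. apply kcomp_idr.
Qed.
End LamK.

Section LamFun.
Variables (S : FinProdCat) (V : IMCData S) (HV : is_IMC V).
Variables (K L : KSys V) (R : KCleavage K) (Q : KCleavage L) (P : KFun K L).

Definition lam_fun : IFunData (lam_cat R) (lam_cat Q) :=
  {| ifn := (fun X => Build_EFunData (C := lam_fib R X) (D := lam_fib Q X)
         (efo := fun x : kob K X => kfo P x)
         (fun x y : kob K X => kfh P (idm X) (idm X) x y))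
       : forall X, EFunData (lam_cat R X) (lam_cat Q X);
     if_re := fun X Y f (x : kob K Y) =>
       kcomp (rf Q f (kfo P x)) (kfh P f (idm X) _ _ ∘ rt R f x);
     if_reV := fun X Y f (x : kob K Y) =>
       kcomp (kfh P (idm X) f _ _ ∘ rf R f x) (rt Q f (kfo P x)) |}.

(** Together with [kfh_rf_rt]: the images of [rt] and [rf] under [P] again form a restriction, which
    makes the elements [if_re] of [lam_fun] invertible. *)
Lemma kfh_rt_rf (X Y : S) (f : X ~> Y) (x : kob K Y) :
  kcomp (kfh P f (idm X) _ _ ∘ rt R f x) (kfh P (idm X) f _ _ ∘ rf R f x)
  = kid f (kfo P x).
Proof. rewrite <- kfh_kcomp, rt_rf. apply kfh_kid. Qed.

Lemma kfh_rf_rt (X Y : S) (f : X ~> Y) (x : kob K Y) :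
  kcomp (kfh P (idm X) f _ _ ∘ rf R f x) (kfh P f (idm X) _ _ ∘ rt R f x)
  = kid (idm X) (kfo P (ro R f x)).
Proof. rewrite <- kfh_kcomp, rf_rt. apply kfh_kid. Qed.

Lemma lam_fun_ax : is_IFun lam_fun.
Proof.
apply ifun_intro.
- intros X. split; intros; cbn.
  + rewrite !ciE. apply kfh_kid.
  + apply kfh_kcm.
- intros X Y f x y.
  change (kpost (idm X) (kcomp (rf Q f (kfo P y)) (kfh P f (idm X) _ _ ∘ rt R f y))
      ∘ (kfh P (idm X) (idm X) _ _ ∘ lam_reh R f x y)
    = kpre (idm X) (kcomp (rf Q f (kfo P x)) (kfh P f (idm X) _ _ ∘ rt R f x))
      ∘ (lam_reh Q f (kfo P x) (kfo P y) ∘ f ^*₁ kfh P (idm Y) (idm Y) x y)).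
  unfold lam_reh. rewrite !cpE. ra. rw (kfh_post P _). rw (kfh_pre P _).
  rw (kfh_kpl P _ _ _ _). knorm.
  rewrite kfh_rt_rf, kcomp_idr. krw (rt_rf Q f _). now rewrite kcomp_idl.
- intros X Y f x.
  change (kcomp (kcomp (kfh P (idm X) f _ _ ∘ rf R f x) (rt Q f (kfo P x)))
    (kcomp (rf Q f (kfo P x)) (kfh P f (idm X) _ _ ∘ rt R f x))
    = ci Q (kfo P (ro R f x))).
  krw (rt_rf Q f _). rewrite kcomp_idl, ciE. apply kfh_rf_rt.
- intros X Y f x.
  change (kcomp (kcomp (rf Q f (kfo P x)) (kfh P f (idm X) _ _ ∘ rt R f x))
    (kcomp (kfh P (idm X) f _ _ ∘ rf R f x) (rt Q f (kfo P x)))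
    = ci Q (ro Q f (kfo P x))).
  krw (kfh_rt_rf f x). rewrite kcomp_idl, ciE. apply rf_rt.
- intros X Y Z f g x.
  change (kcomp (kcomp (rf Q f (ro Q g (kfo P x)))
         (kcomp (kapp (cmp_idl f) eq_refl (rf Q g (kfo P x))) (rt Q (g ∘ f) (kfo P x))))
      (kcomp (rf Q (g ∘ f) (kfo P x)) (kfh P (g ∘ f) (idm X) _ _ ∘ rt R (g ∘ f) x))
    = kcomp (ic_app (A := lam_cat Q) (x := kfo P (ro R g x)) (y := ro Q g (kfo P x)) f
        (kcomp (rf Q g (kfo P x)) (kfh P g (idm Y) _ _ ∘ rt R g x)))
       (kcomp (kcomp (rf Q f (kfo P (ro R g x))) (kfh P f (idm X) _ _ ∘ rt R f (ro R g x)))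
         (kfh P (idm X) (idm X) _ _ ∘ kcomp (rf R f (ro R g x))
         (kcomp (kapp (cmp_idl f) eq_refl (rf R g x)) (rt R (g ∘ f) x))))).
  rewrite lam_app.
  rewrite (kapp_comp (cmp_idl f) eq_refl (cmp_idl f)).
  rewrite !kfh_kcomp, <- (kfh_kapp P), (kfh_kapp P _ _ (rf R g x)).
  krw (rt_rf Q f _). rewrite kcomp_idl. krw (kfh_rt_rf f _). rewrite kcomp_idl.
  rewrite (kfh_kapp P).
  krw (eq_sym (kapp_comp eq_refl (cmp_idl f) eq_refl
    (kfh P g (idm Y) _ _ ∘ rt R g x) (kfh P (idm Y) g _ _ ∘ rf R g x))).
  rewrite kfh_rt_rf, kapp_kid, kcomp_idl.
  krw (rt_rf Q _ _). now rewrite kcomp_idl.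
- intros X x.
  change (kcomp (kcomp (rf Q (idm X) (kfo P x)) (kfh P (idm X) (idm X) _ _ ∘ rt R (idm X) x))
     (kfh P (idm X) (idm X) _ _ ∘ rf R (idm X) x) = rf Q (idm X) (kfo P x)).
  rewrite kcomp_assoc, kfh_rt_rf. apply kcomp_idr.
Qed.
End LamFun.

Section LamNat.
Variables (S : FinProdCat) (V : IMCData S) (HV : is_IMC V).
Variables (K L : KSys V) (R : KCleavage K) (Q : KCleavage L) (F G : KFun K L).

(** Once the restriction of [F x] in [L] has cancelled, compatibility with reindexing is naturality
    of [t] at the element [rt R f x]. *)
Lemma lam_nat_ax (t : KNatData F G) : is_KNat t ->
  is_INat (F := lam_fun R Q F) (G := lam_fun R Q G) (fun X x => t X x).
Proof.
intros Ht. split.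
- intros X x y. assert (q := knat_nat HV Ht (idm X) (idm X) x y).
  rewrite !(kapp_idm HV) in q. exact q.
- intros X Y f x.
  change (kcomp (kcomp (rf Q f (kfo G x)) (kfh G f (idm X) _ _ ∘ rt R f x)) (t X (ro R f x))
    = kcomp (ic_app (A := lam_cat Q) (x := kfo F x) (y := kfo G x) f (t Y x))
      (kcomp (rf Q f (kfo F x)) (kfh F f (idm X) _ _ ∘ rt R f x))).
  rewrite lam_app. krw (rt_rf Q f _). rewrite kcomp_idl.
  rewrite (knat_app HV Ht). now rewrite (kapp_idm HV).
Qed.
End LamNat.

Section LambdaLink.
Variables (S : FinProdCat) (V : IMCData S) (HV : is_IMC V).

Definition kclv (B : LCatData V) (HB : is_LCat B) (r : Cleavage B) :
  KCleavage (gamma HV HB).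
Proof.
refine {|
  ci := fun X (x : kob (gamma HV HB) X) =>
    lc_id x : tunit ~> khom (k := gamma HV HB) (idm X) (idm X) x x;
  cp := fun X Y f (x y : kob (gamma HV HB) Y) =>
    bwd (pbcmpE (diag_cmp f) (lhom x y))
    : f ^* khom (k := gamma HV HB) (idm Y) (idm Y) x y
      ~> khom (k := gamma HV HB) f f x y;
  cq := fun X Y f (x y : kob (gamma HV HB) Y) =>
    fwd (pbcmpE (diag_cmp f) (lhom x y))
    : khom (k := gamma HV HB) f f x y
      ~> f ^* khom (k := gamma HV HB) (idm Y) (idm Y) x y;
  ro := fun X Y f (x : kob (gamma HV HB) Y) =>
    rob (r Y X f x) : kob (gamma HV HB) X;
  rt := fun X Y f x => r_to (r Y X f x);
  rf := fun X Y f x => r_from (r Y X f x) |}.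
- intros. symmetry. apply (gid_idm HV HB).
- intros. cbn. unfold gpl.
  now rewrite (proof_irrelevance _ (diag_cmp f) (pair_cmp (cmp_idl f) (cmp_idl f))).
- intros. cbn. unfold gplV.
  now rewrite (proof_irrelevance _ (diag_cmp f) (pair_cmp (cmp_idl f) (cmp_idl f))).
- intros. refine (eq_trans (r_from_to (r Y X f x)) _).
  symmetry. apply (gid_idm HV HB).
- intros. exact (r_to_from (r Y X f x)).
Defined.

Lemma lambda_cat_ax (B : LCatData V) (HB : is_LCat B) (r : Cleavage B) :
  is_ICat (lambda_cat r).
Proof. exact (lam_icat HV (kclv HB r)). Qed.

Section Cells.
Variables (A B : LCatData V) (HA : is_LCat A) (HB : is_LCat B).
Variables (rA : Cleavage A) (rB : Cleavage B).

Lemma lambda_fun_ax (F : LIFunData A B) : is_LIFun F -> is_IFun (lambda_fun rA rB F).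
Proof.
intros HF. exact (lam_fun_ax (kclv HA rA) (kclv HB rB) (gfun HV HA HB HF)).
Qed.

Lemma lambda_nat_ax (F G : LIFunData A B) (t : LNatData F G) :
  is_LIFun F -> is_LIFun G -> is_LNat t -> is_INat (lambda_nat rA rB t).
Proof.
intros HF HG Ht. exact (lam_nat_ax HV (kclv HA rA) (kclv HB rB)
  (proj1 (lnat_iff HV HA HB HF HG t) Ht)).
Qed.
End Cells.

Lemma Lambda_wf_ok (r : forall B : VFib V, Cleavage B) : Lambda_wf r.
Proof.
split; intros.
- apply lambda_cat_ax, vlcat.
- apply lambda_fun_ax; [apply vlcat.. | apply lifun_ax].
- apply lambda_nat_ax; [apply vlcat.. | apply lifun_ax | apply lifun_ax | apply lnat_ax].
Qed.

Lemma Lambda_2functor (r : forall B : VFib V, Cleavage B)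
    (wi : VCATidx_wf V) (wf : VFIB_wf V) (w : Lambda_wf r) :
  is_2functor (Lambda wi wf w).
Proof.
assert (I1 : forall a : VFib V, fun1 (Lambda wi wf w) (id1 (t := VFIB wf) a)
  = id1 (t := VCATidx wi) (Lambda wi wf w a)).
{ intros A. ifun_ext.
  - intros X x y. exact (gfm_lifun_id HV (idm X) (idm X) x y).
  - intros X Y f x.
    change (gcomp (r_from (r A Y X f x))
      (gfm (lifun_id A) f (idm X) (rob (r A Y X f x)) x ∘ r_to (r A Y X f x))
      = lc_id (rob (r A Y X f x))).
    rewrite (gfm_lifun_id HV), cmp_idl. apply r_from_to. }
assert (I2 : forall (A B C : VFib V) (G : LIFun B C) (F : LIFun A B),
  fun1 (Lambda wi wf w) (cmp1 (t := VFIB wf) G F)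
  = cmp1 (t := VCATidx wi) (fun1 (Lambda wi wf w) G) (fun1 (Lambda wi wf w) F)).
{ intros A B C G F. ifun_ext.
  - intros X x y. exact (gfm_lifun_cmp HV G F (idm X) (idm X) x y).
  - intros X Y f x.
    set (RA := kclv (vlcat A) (r A)). set (RB := kclv (vlcat B) (r B)).
    set (RC := kclv (vlcat C) (r C)).
    set (PG := gfun HV (vlcat B) (vlcat C) (lifun_ax G)).
    set (PF := gfun HV (vlcat A) (vlcat B) (lifun_ax F)).
    change (kcomp (rf RC f (kfo PG (kfo PF x)))
        (gfm (lifun_cmp G F) f (idm X) (rob (r A Y X f x)) x ∘ rt RA f x)
      = kcomp (kcomp (rf RC f (kfo PG (kfo PF x)))
          (kfh PG f (idm X) _ _ ∘ rt RB f (kfo PF x)))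
          (kfh PG (idm X) (idm X) _ _ ∘ kcomp (rf RB f (kfo PF x))
          (kfh PF f (idm X) _ _ ∘ rt RA f x))).
    (* The restriction of [F x] chosen in [B] occurs under [G] with both its [rt] and its [rf], so
       the intermediate choice cancels. *)
    rewrite (gfm_lifun_cmp HV), kfh_kcomp. krw (kfh_rt_rf RB PG f _).
    rewrite kcomp_idl. now rewrite <- cmp_assoc. }
split; auto.
- intros A B F. apply inat_ext. intros X x. reflexivity.
- intros A B F G H t s. apply inat_ext. intros X x. reflexivity.
- intros A B C F F' G G' t s. icell_ext; [apply I2.. | intros X x]. reflexivity.
Qed.
End LambdaLink.

(** * The unit *)

Section Eta.
Variables (S : FinProdCat) (V : IMCData S) (HV : is_IMC V).
Variables (A : ICatData V) (HA : is_ICat A) (R : KCleavage (phi HA)).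

Let E := icE HA.

Let rfA (X Y : S) (f : X ~> Y) (x : A Y) :
  elt (ic_re A f x) (ic_re A (idm X) (ro R f x : A X)) := rf R f x.
Let rtA (X Y : S) (f : X ~> Y) (x : A Y) :
  elt (ic_re A (idm X) (ro R f x : A X)) (ic_re A f x) := rt R f x.

Let rfrtA (X Y : S) (f : X ~> Y) (x : A Y) : ecomp (rfA f x) (rtA f x) = eid _.
Proof. exact (rf_rt R f x). Qed.

Let rtrfA (X Y : S) (f : X ~> Y) (x : A Y) : ecomp (rtA f x) (rfA f x) = eid _.
Proof. exact (rt_rf R f x). Qed.

Definition etah (X : S) (x y : A X) :
    ehom x y ~> ehom (ic_re A (idm X) x) (ic_re A (idm X) y) :=
  epost (ic_id y) ∘ epre (ic_idV x).

Definition zetah (X : S) (x y : A X) :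
    ehom (ic_re A (idm X) x) (ic_re A (idm X) y) ~> ehom x y :=
  epost (ic_idV y) ∘ epre (ic_id x).

(** The hom-objects of [lam_cat R] are those of [A] between objects reindexed along [1], so [if_re]
    must start at [1^* f^* x]; it removes the unit and then applies [rf], which starts at
    [f^* x]. *)
Definition eta0 : IFunData A (lam_cat R) :=
  {| ifn := (fun X => Build_EFunData (C := A X) (D := lam_fib R X)
         (efo := fun x : A X => x : kob (phi HA) X)
         (fun x y : A X => etah x y))
       : forall X, EFunData (A X) (lam_cat R X);
     if_re := fun X Y f (x : A Y) =>
       ecomp (rfA f x) (ic_idV (ic_re A f x));
     if_reV := fun X Y f (x : A Y) =>
       ecomp (ic_id (ic_re A f x)) (rtA f x) |}.

Definition zeta0 : IFunData (lam_cat R) A :=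
  {| ifn := (fun X => Build_EFunData (C := lam_fib R X) (D := A X)
         (efo := fun x : kob (phi HA) X => x : A X)
         (fun x y : A X => zetah x y))
       : forall X, EFunData (lam_cat R X) (A X);
     if_re := fun X Y f (x : A Y) =>
       ecomp (rtA f x) (ic_id (ro R f x : A X));
     if_reV := fun X Y f (x : A Y) =>
       ecomp (ic_idV (ro R f x : A X)) (rfA f x) |}.

Lemma zetah_etah (X : S) (x y : A X) : zetah x y ∘ etah x y = idm _.
Proof.
unfold zetah, etah. enorm (E X).
now rewrite !(ic_idV_id HA), (epost_id (E X)), (epre_id (E X)), cmp_idl.
Qed.

Lemma etah_zetah (X : S) (x y : A X) : etah x y ∘ zetah x y = idm _.
Proof.
unfold zetah, etah. enorm (E X).
now rewrite !(ic_id_idV HA), (epost_id (E X)), (epre_id (E X)), cmp_idl.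
Qed.

Lemma etah_elt (X : S) (x y : A X) (u : elt x y) :
  etah x y ∘ u = ecomp (ic_id y) (ecomp u (ic_idV x)).
Proof. unfold etah. ra. now rewrite <- ecomp_pre. Qed.

Lemma zetah_elt (X : S) (x y : A X)
    (u : elt (ic_re A (idm X) x) (ic_re A (idm X) y)) :
  zetah x y ∘ u = ecomp (ic_idV y) (ecomp u (ic_id x)).
Proof. unfold zetah. ra. now rewrite <- ecomp_pre. Qed.

Lemma etah_efun (X : S) : is_EFun (eta0 X).
Proof.
split.
- intros x. change (etah x x ∘ eid x = ci R (x : kob (phi HA) X)).
  rewrite etah_elt, (ecomp_idl (E X)), (ic_id_idV HA).
  symmetry. exact (ciE R (x : kob (phi HA) X)).
- intros x y z. exact (ecmp_conj (E X) (ic_idV_id HA y)).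
Qed.

Lemma zetah_efun (X : S) : is_EFun (zeta0 X).
Proof.
split.
- intros x. change (zetah x x ∘ ci R (x : kob (phi HA) X) = eid (x : A X)).
  rewrite ciE. refine (eq_trans (zetah_elt _) _).
  refine (eq_trans (f_equal _ (ecomp_idl (E X) _)) _). apply (ic_idV_id HA).
- intros x y z. exact (ecmp_conj (E X) (ic_id_idV HA y)).
Qed.

(** Pullback in [phi] of the base morphism [1] along [f] compares by [ic_cmp] at [1 ∘ f], which the
    unit axioms of [A] identify with the reindexed [ic_id]. The conjugation in [etah] therefore
    cancels and leaves the reindexing of [A]. *)
Lemma ipl_etah (X Y : S) (f : X ~> Y) (x y : A Y) :
  ipl (cmp_idl f) (cmp_idl f) x y ∘ f ^*₁ etah x y = rh f x y.
Proof.
unfold ipl, etah. rewrite (ic_cmpE_idl HA), (ic_cmpVE_idl HA), smor_cmp. ra.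
rw (rh_post HA f _ _). rw (rh_pre HA f _ _). enorm (E X).
rewrite <- !(ic_app_comp HA), !(ic_idV_id HA), !(ic_app_id HA).
now rewrite (epost_id (E X)), (epre_id (E X)), !cmp_idl.
Qed.

Lemma rh_zetah (X Y : S) (f : X ~> Y) (x y : A Y) :
  rh f x y ∘ f ^*₁ zetah x y = ipl (cmp_idl f) (cmp_idl f) x y.
Proof.
rewrite <- ipl_etah. ra. rewrite <- smor_cmp, etah_zetah, smor_id. apply cmp_idr.
Qed.

Lemma kapp_rf (X Y Z : S) (f : X ~> Y) (g : Y ~> Z) (x : A Z) :
  kapp (K := phi HA) (cmp_idl f) eq_refl (rf R g (x : kob (phi HA) Z))
  = ecomp (ic_app f (ic_idV (ro R g x : A Y)))
      (ecomp (ic_app f (rfA g x)) (ic_cmp f g x)).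
Proof.
refine (eq_trans (phi_kapp HA (cmp_idl f) eq_refl (rfA g x)) _).
now rewrite (ic_cmpVE_idl HA).
Qed.

Lemma kapp_elt (X Y : S) (f : X ~> Y) (x y : A Y)
    (u : elt (ic_re A (idm Y) x) (ic_re A (idm Y) y)) :
  kapp (K := phi HA) (cmp_idl f) (cmp_idl f) u
  = ic_app f (ecomp (ic_idV y) (ecomp u (ic_id x))).
Proof.
refine (eq_trans (phi_kapp HA (cmp_idl f) (cmp_idl f) u) _).
now rewrite (ic_cmpVE_idl HA), (ic_cmpE_idl HA), !(ic_app_comp HA).
Qed.

Lemma eta0_ax : is_IFun eta0.
Proof.
apply ifun_intro.
- exact etah_efun.
- intros X Y f x y.
  change (epost (ecomp (rfA f y) (ic_idV (ic_re A f y)))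
      ∘ (etah (ic_re A f x) (ic_re A f y) ∘ rh f x y)
    = epre (ecomp (rfA f x) (ic_idV (ic_re A f x)))
      ∘ ((epost (rfA f y) ∘ epre (rtA f x) ∘ cp R f (x : kob (phi HA) Y) y)
         ∘ f ^*₁ etah x y)).
  rewrite cpE.
  change (epost (ecomp (rfA f y) (ic_idV (ic_re A f y)))
      ∘ (etah (ic_re A f x) (ic_re A f y) ∘ rh f x y)
    = epre (ecomp (rfA f x) (ic_idV (ic_re A f x)))
      ∘ ((epost (rfA f y) ∘ epre (rtA f x) ∘ ipl (cmp_idl f) (cmp_idl f) x y)
         ∘ f ^*₁ etah x y)).
  ra. rewrite ipl_etah. unfold etah. enorm (E X).
  rewrite (ic_idV_id HA), (ecomp_idr (E X)). erw (E X) (rtrfA f x).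
  now rewrite (ecomp_idl (E X)).
- intros X Y f x.
  change (ecomp (ecomp (ic_id (ic_re A f x)) (rtA f x))
    (ecomp (rfA f x) (ic_idV (ic_re A f x))) = ci R (ic_re A f x : kob (phi HA) X)).
  erw (E X) (rtrfA f x). rewrite (ecomp_idl (E X)), (ic_id_idV HA), ciE. reflexivity.
- intros X Y f x.
  change (ecomp (ecomp (rfA f x) (ic_idV (ic_re A f x)))
    (ecomp (ic_id (ic_re A f x)) (rtA f x)) = ci R (ro R f (x : kob (phi HA) Y))).
  erw (E X) (ic_idV_id HA (ic_re A f x)). rewrite (ecomp_idl (E X)), rfrtA, ciE. reflexivity.
- intros X Y Z f g x.
  change (ecomp (kcomp (K := phi HA) (rf R f (ro R g (x : kob (phi HA) Z)))
         (kcomp (kapp (cmp_idl f) eq_refl (rf R g (x : kob (phi HA) Z)))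
            (rt R (g ∘ f) (x : kob (phi HA) Z))))
      (ecomp (rfA (g ∘ f) x) (ic_idV (ic_re A (g ∘ f) x)))
    = ecomp (ic_app (A := lam_cat R) (x := ic_re A g x : kob (phi HA) Y)
         (y := ro R g (x : kob (phi HA) Z)) f
         (ecomp (rfA g x) (ic_idV (ic_re A g x))))
       (ecomp (ecomp (rfA f (ic_re A g x)) (ic_idV (ic_re A f (ic_re A g x))))
         (etah (ic_re A (g ∘ f) x) (ic_re A f (ic_re A g x)) ∘ ic_cmp f g x))).
  rewrite etah_elt, (lam_app (K := phi HA)), kapp_rf.
  change (ecomp (ecomp (rfA f (ro R g x : A Y))
         (ecomp (ecomp (ic_app f (ic_idV (ro R g x : A Y)))
            (ecomp (ic_app f (rfA g x)) (ic_cmp f g x))) (rtA (g ∘ f) x)))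
      (ecomp (rfA (g ∘ f) x) (ic_idV (ic_re A (g ∘ f) x)))
    = ecomp (ecomp (rfA f (ro R g x : A Y)) (ecomp
       (kapp (K := phi HA) (cmp_idl f) (cmp_idl f)
         (ecomp (rfA g x) (ic_idV (ic_re A g x))))
         (rtA f (ic_re A g x))))
       (ecomp (ecomp (rfA f (ic_re A g x)) (ic_idV (ic_re A f (ic_re A g x))))
       (ecomp (ic_id (ic_re A f (ic_re A g x)))
          (ecomp (ic_cmp f g x) (ic_idV (ic_re A (g ∘ f) x)))))).
  rewrite kapp_elt. erw (E X) (rtrfA (g ∘ f) x).
  rewrite (ecomp_idl (E X)). erw (E X) (rtrfA f _). rewrite (ecomp_idl (E X)).
  erw (E X) (ic_idV_id HA (ic_re A f (ic_re A g x))). rewrite (ecomp_idl (E X)).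
  era (E Y). rewrite (ic_idV_id HA), (ecomp_idr (E Y)), (ic_app_comp HA).
  now era (E X).
- intros X x.
  change (ecomp (ecomp (rfA (idm X) x) (ic_idV (ic_re A (idm X) x)))
    (etah x (ic_re A (idm X) x) ∘ ic_id x) = rfA (idm X) x).
  rewrite etah_elt, (ic_id_idV HA), (ecomp_idr (E X)). era (E X).
  rewrite (ic_idV_id HA). apply (ecomp_idr (E X)).
Qed.

Lemma zeta0_ax : is_IFun zeta0.
Proof.
apply ifun_intro.
- exact zetah_efun.
- intros X Y f x y. change (eob (A Y)) in x, y.
  change (epost (ecomp (rtA f y) (ic_id (ro R f y : A X)))
      ∘ (zetah (ro R f x) (ro R f y)
         ∘ (epost (rfA f y) ∘ epre (rtA f x) ∘ cp R f (x : kob (phi HA) Y) y))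
    = epre (ecomp (rtA f x) (ic_id (ro R f x : A X)))
      ∘ (rh f x y ∘ f ^*₁ zetah x y)).
  rewrite cpE, rh_zetah.
  change (epost (ecomp (rtA f y) (ic_id (ro R f y : A X)))
      ∘ (zetah (ro R f x) (ro R f y)
         ∘ (epost (rfA f y) ∘ epre (rtA f x) ∘ ipl (cmp_idl f) (cmp_idl f) x y))
    = epre (ecomp (rtA f x) (ic_id (ro R f x : A X)))
      ∘ ipl (cmp_idl f) (cmp_idl f) x y).
  unfold zetah. enorm (E X).
  erw (E X) (ic_id_idV HA (ro R f y : A X)). rewrite (ecomp_idl (E X)), rtrfA.
  now rewrite (epost_id (E X)), id_cmp.
- intros X Y f x. change (eob (A Y)) in x.
  change (ecomp (ecomp (ic_idV (ro R f x : A X)) (rfA f x))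
    (ecomp (rtA f x) (ic_id (ro R f x : A X))) = eid (ro R f x : A X)).
  erw (E X) (rfrtA f x). rewrite (ecomp_idl (E X)). apply (ic_idV_id HA).
- intros X Y f x. change (eob (A Y)) in x.
  change (ecomp (ecomp (rtA f x) (ic_id (ro R f x : A X)))
    (ecomp (ic_idV (ro R f x : A X)) (rfA f x)) = eid (ic_re A f x)).
  erw (E X) (ic_id_idV HA (ro R f x : A X)). rewrite (ecomp_idl (E X)). apply rtrfA.
- intros X Y Z f g x. change (eob (A Z)) in x.
  change (ecomp (ic_cmp f g x) (ecomp (rtA (g ∘ f) x) (ic_id (ro R (g ∘ f) x : A X)))
    = ecomp (ic_app f (ecomp (rtA g x) (ic_id (ro R g x : A Y))))
       (ecomp (ecomp (rtA f (ro R g x : A Y)) (ic_id (ro R f (ro R g x) : A X)))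
         (zetah (ro R (g ∘ f) x) (ro R f (ro R g x))
          ∘ ecomp (rfA f (ro R g x : A Y))
         (ecomp (kapp (K := phi HA) (cmp_idl f) eq_refl (rf R g (x : kob (phi HA) Z)))
            (rtA (g ∘ f) x))))).
  rewrite zetah_elt, kapp_rf. erw (E X) (ic_id_idV HA (ro R f (ro R g x) : A X)).
  rewrite (ecomp_idl (E X)). erw (E X) (rtrfA f _). rewrite (ecomp_idl (E X)).
  rewrite (ic_app_comp HA). era (E X).
  erw (E X) (eq_sym (ic_app_comp HA f (ic_id (ro R g x : A Y)) _)).
  rewrite (ic_id_idV HA), (ic_app_id HA), (ecomp_idl (E X)).
  erw (E X) (eq_sym (ic_app_comp HA f (rtA g x) (rfA g x))).
  now rewrite rtrfA, (ic_app_id HA), (ecomp_idl (E X)).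
- intros X x. change (eob (A X)) in x.
  change (ecomp (ecomp (rtA (idm X) x) (ic_id (ro R (idm X) x : A X)))
    (zetah x (ro R (idm X) x) ∘ rfA (idm X) x) = ic_id x).
  rewrite zetah_elt. erw (E X) (ic_id_idV HA (ro R (idm X) x : A X)).
  rewrite (ecomp_idl (E X)). erw (E X) (rtrfA (idm X) x). apply (ecomp_idl (E X)).
Qed.
End Eta.

Section Unit.
Variables (S : FinProdCat) (V : IMCData S) (HV : is_IMC V).
Variables (A : ICatData V) (HA : is_ICat A) (HT : is_LCat (theta_cat A)).
Variables (r : Cleavage (theta_cat A)).

Let T := thfun HV (K := phi HA) HT.
Let TV := thVfun HV (K := phi HA) HT.
Let RT := kclv HV HT r.

(** The restrictions chosen on [Θ A] become restrictions in [phi HA] under [th], since functors of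
    systems preserve restrictions. *)
Definition phi_clv : KCleavage (phi HA).
Proof.
refine {|
  ci := fun X (x : kob (phi HA) X) => kid (idm X) x;
  ciE := fun X x => eq_refl;
  cp := fun X Y f (x y : kob (phi HA) Y) => kpl (cmp_idl f) (cmp_idl f) x y;
  cpE := fun X Y f x y => eq_refl;
  cq := fun X Y f (x y : kob (phi HA) Y) => kplV (cmp_idl f) (cmp_idl f) x y;
  cqE := fun X Y f x y => eq_refl;
  ro := fun X Y f (x : kob (phi HA) Y) => ro RT f x : kob (phi HA) X;
  rt := fun X Y f x => kfh T f (idm X) (ro RT f x) x ∘ rt RT f x;
  rf := fun X Y f x => kfh T (idm X) f x (ro RT f x) ∘ rf RT f x |}.
- intros. exact (kfh_rf_rt RT T f x).
- intros. exact (kfh_rt_rf RT T f x).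
Defined.

(** [eta0] passes from the reindexings of [A] to the transported restrictions; the second factor is
    the construction of [Λ] on functors applied to [thV]. *)
Definition eta : IFunData A (lambda_cat r) :=
  ifun_cmp (B := lam_cat phi_clv) (C := lambda_cat r)
    (lam_fun phi_clv RT TV) (eta0 phi_clv).

Definition zeta : IFunData (lambda_cat r) A :=
  ifun_cmp (A := lambda_cat r) (B := lam_cat phi_clv)
    (zeta0 phi_clv) (lam_fun RT phi_clv T).

Lemma phi_lam_icat : is_ICat (lam_cat phi_clv).
Proof. exact (lam_icat HV phi_clv). Qed.

Lemma eta_ax : is_IFun eta.
Proof.
apply (ifun_cmp_ax HA phi_lam_icat (lambda_cat_ax HV HT r)).
- exact (lam_fun_ax phi_clv RT TV).
- apply eta0_ax.
Qed.

Lemma zeta_ax : is_IFun zeta.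
Proof.
apply (ifun_cmp_ax (lambda_cat_ax HV HT r) phi_lam_icat HA).
- apply zeta0_ax.
- exact (lam_fun_ax RT phi_clv T).
Qed.

Lemma th_TV (W X Y : S) (b : W ~> Y) (a : W ~> X) (x : kob (phi HA) X)
    (y : kob (phi HA) Y) :
  kfh T b a x y ∘ kfh TV b a x y = idm _.
Proof. exact (th_thV (K := phi HA) b a x y). Qed.

Lemma TV_th (W X Y : S) (b : W ~> Y) (a : W ~> X) (x : kob (phi HA) X)
    (y : kob (phi HA) Y) :
  kfh TV b a x y ∘ kfh T b a x y = idm _.
Proof. exact (thV_th (K := phi HA) b a x y). Qed.

Definition rfA (X Y : S) (f : X ~> Y) (x : A Y) :
  elt (ic_re A f x) (ic_re A (idm X) (ro RT f x : A X)) := rf phi_clv f x.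
Definition rtA (X Y : S) (f : X ~> Y) (x : A Y) :
  elt (ic_re A (idm X) (ro RT f x : A X)) (ic_re A f x) := rt phi_clv f x.

Lemma rfrtA (X Y : S) (f : X ~> Y) (x : A Y) : ecomp (rfA f x) (rtA f x) = eid _.
Proof. exact (rf_rt phi_clv f x). Qed.

Lemma rtrfA (X Y : S) (f : X ~> Y) (x : A Y) : ecomp (rtA f x) (rfA f x) = eid _.
Proof. exact (rt_rf phi_clv f x). Qed.

(** [phi_clv] consists of images of [RT], so the second factor compares each chosen restriction with
    itself and contributes the identity [rf ∘ rt]. *)
Lemma eta_re (X Y : S) (f : X ~> Y) (x : A Y) :
  if_re eta f x
  = thV (K := phi HA) (idm X) (idm X) (ic_re A f x) (ro RT f x)
    ∘ ecomp (rfA f x) (ic_idV (ic_re A f x)).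
Proof.
change (kcomp (kcomp (rf RT f x)
    (kfh TV f (idm X) (ro RT f x) x ∘ (kfh T f (idm X) (ro RT f x) x ∘ rt RT f x)))
  (kfh TV (idm X) (idm X) (ic_re A f x) (ro RT f x)
     ∘ ecomp (rfA f x) (ic_idV (ic_re A f x)))
  = kfh TV (idm X) (idm X) (ic_re A f x) (ro RT f x)
    ∘ ecomp (rfA f x) (ic_idV (ic_re A f x))).
assert (q : kfh TV f (idm X) (ro RT f x) x
  ∘ (kfh T f (idm X) (ro RT f x) x ∘ rt RT f x) = rt RT f x).
{ rewrite (reassoc2 (TV_th f (idm X) (ro RT f x) x)). apply cmp_idl. }
refine (eq_trans (f_equal (fun u => kcomp u _)
  (eq_trans (f_equal (fun u => kcomp _ u) q) (rf_rt RT f x))) _).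
apply kcomp_idl.
Qed.

Lemma zeta_re (X Y : S) (f : X ~> Y) (x : A Y) :
  if_re zeta f x = ecomp (rtA f x) (ic_id (ro RT f x : A X)).
Proof.
assert (q : zetah (A := A) (ro RT f x) (ro RT f x)
  ∘ kcomp (K := phi HA) (rf phi_clv f x) (rt phi_clv f x) = eid _).
{ refine (eq_trans (f_equal (fun u => _ ∘ u) (rf_rt phi_clv f x)) _).
  refine (eq_trans (zetah_elt _) _).
  refine (eq_trans (f_equal _ (ecomp_idl (icE HA X) _)) _). apply (ic_idV_id HA). }
refine (eq_trans (f_equal (fun u => ecomp _ u) q) _).
apply (ecomp_idr (icE HA X)).
Qed.

Lemma zeta_eta_re (X Y : S) (f : X ~> Y) (x : A Y) :
  ecomp (if_re zeta f x) (eapp (zeta X) (if_re eta f x)) = eid (ic_re A f x).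
Proof.
rewrite zeta_re, eta_re.
assert (q : eapp (zeta X) (thV (K := phi HA) (idm X) (idm X) (ic_re A f x) (ro RT f x)
    ∘ ecomp (rfA f x) (ic_idV (ic_re A f x)))
  = ecomp (ic_idV (ro RT f x : A X)) (ecomp (ecomp (rfA f x)
      (ic_idV (ic_re A f x))) (ic_id (ic_re A f x)))).
{ rewrite <- zetah_elt.
  change (zetah (A := A) (ic_re A f x) (ro RT f x) ∘ kfh T (idm X) (idm X) (ic_re A f x) (ro RT f x) ∘
    (kfh TV (idm X) (idm X) (ic_re A f x) (ro RT f x)
    ∘ ecomp (rfA f x) (ic_idV (ic_re A f x)))
   = zetah (A := A) (ic_re A f x) (ro RT f x) ∘ ecomp (rfA f x) (ic_idV (ic_re A f x))).
  exact (cancel_mid3 _ _ (th_TV _ _ _ _)). }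
refine (eq_trans (f_equal (fun u => ecomp _ u) q) _).
erw (icE HA X) (ic_id_idV HA (ro RT f x : A X)).
rewrite (ecomp_idl (icE HA X)), (ic_idV_id HA), (ecomp_idr (icE HA X)).
apply rtrfA.
Qed.

Lemma eta_zeta_re (X Y : S) (f : X ~> Y) (x : A Y) :
  ecomp (C := lambda_fib (theta_cat A) X) (if_re eta f x) (eapp (eta X) (if_re zeta f x))
  = eid (e := lambda_fib (theta_cat A) X) (ro RT f x).
Proof.
rewrite zeta_re, eta_re.
change (kcomp (kfh TV (idm X) (idm X) (ic_re A f x) (ro RT f x)
    ∘ ecomp (rfA f x) (ic_idV (ic_re A f x)))
  ((kfh TV (idm X) (idm X) (ro RT f x) (ic_re A f x)
     ∘ etah (A := A) (ro RT f x) (ic_re A f x))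
    ∘ ecomp (rtA f x) (ic_id (ro RT f x : A X))) = ci RT (ro RT f x)).
refine (eq_trans (f_equal (fun u => kcomp _ u) (eq_trans (cmp_assoc _ _ _)
  (f_equal (fun q => kfh TV (idm X) (idm X) (ro RT f x) (ic_re A f x) ∘ q)
     (etah_elt (ecomp (rtA f x) (ic_id (ro RT f x : A X))))))) _).
refine (eq_trans (eq_sym (kfh_kcomp TV _ _)) _).
refine (eq_trans (f_equal (fun u => kfh TV (idm X) (idm X) (ro RT f x) (ro RT f x) ∘ u) 
  (_ : _ = kid (k := phi HA) (idm X) (ro RT f x))) _).
- change (ecomp (ecomp (rfA f x) (ic_idV (ic_re A f x)))
    (ecomp (ic_id (ic_re A f x)) (ecomp (ecomp (rtA f x) (ic_id (ro RT f x : A X)))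
       (ic_idV (ro RT f x : A X)))) = eid _).
  erw (icE HA X) (ic_idV_id HA (ic_re A f x)). rewrite (ecomp_idl (icE HA X)).
  rewrite (ic_id_idV HA), (ecomp_idr (icE HA X)). apply rfrtA.
- rewrite ciE. apply kfh_kid.
Qed.
End Unit.

Section UnitNaturality.
Variables (S : FinProdCat) (V : IMCData S) (HV : is_IMC V).
Variables (A B : ICatData V) (HA : is_ICat A) (HB : is_ICat B).
Variables (TA : is_LCat (theta_cat A)) (TB : is_LCat (theta_cat B)).
Variables (rA : Cleavage (theta_cat A)) (rB : Cleavage (theta_cat B)).
Variables (F : IFunData A B) (HF : is_IFun F).

Let E := icE HB.

(** [if_re_id] for the inverses, which are unique. *)
Lemma if_idV (X : S) (x : A X) :
  ecomp (eapp (F X) (ic_idV x)) (if_reV F (idm X) x) = ic_idV (F X x).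
Proof.
refine (einverse_uniq (E X) (_ : einverse (ic_id (F X x)) _) (ic_id_inv HB (F X x))).
rewrite <- (if_re_id HF). split.
- erw (E X) (if_reV_re HF (idm X) x). rewrite (ecomp_idl (E X)).
  rewrite <- (eapp_comp (if_efun HF X)), (ic_idV_id HA).
  apply (eapp_id (if_efun HF X)).
- era (E X). erw (E X) (eq_sym (eapp_comp (if_efun HF X) (ic_id x) (ic_idV x))).
  rewrite (ic_id_idV HA), (eapp_id (if_efun HF X)), (ecomp_idl (E X)).
  apply (if_re_reV HF).
Qed.

Lemma phih_etah (X : S) (x y : A X) :
  phih F (idm X) (idm X) x y ∘ etah x y = etah (F X x) (F X y) ∘ efh (F X) x y.
Proof.
unfold phih, etah. ra. rw (efh_efh_post HF _). rw (efh_pre (if_efun HF X) _).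
enorm (E X). now rewrite (if_re_id HF), if_idV.
Qed.

Lemma phih_idV (X Y : S) (f : X ~> Y) (x : A Y) :
  phih F f (idm X) (ic_re A f x) x ∘ ic_idV (ic_re A f x)
  = ecomp (if_re F f x) (ic_idV (F X (ic_re A f x))).
Proof.
unfold phih. ra.
change (efh (F X) (ic_re A (idm X) (ic_re A f x)) (ic_re A f x) ∘ ic_idV (ic_re A f x))
  with (eapp (F X) (ic_idV (ic_re A f x))).
rewrite <- ecomp_pre, if_idV. reflexivity.
Qed.

Let PF := gfun HV TA TB (theta_fun_ax HV HA HB HF).

Lemma kfh_theta_thV (W X Y : S) (b : W ~> Y) (a : W ~> X) (x : A X) (y : A Y) :
  kfh PF b a x y ∘ thV (K := phi HA) b a x y
  = thV (K := phi HB) b a (F X x) (F Y y) ∘ phih F b a x y.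
Proof.
refine (eq_trans (f_equal (fun q => q ∘ _) (gfm_theta HV HA HB HF b a x y)) _).
rewrite !cmp_assoc. do 2 f_equal.
refine (eq_trans (f_equal (fun q => _ ∘ q) (th_thV (K := phi HA) b a x y)) _).
apply cmp_idr.
Qed.

(** Both sides become [rf] of the chosen restriction of [F x] after the image under [thV] of
    [if_re F f x] composed with a unit. On the left the restriction chosen in [Θ A] cancels, on the
    right the unit isomorphism of [f^* (F x)]. *)
Lemma eta_nat_re (X Y : S) (f : X ~> Y) (x : A Y) :
  if_re (ifun_cmp (lambda_fun rA rB (theta_fun F)) (eta HV HA TA rA)) f x
  = if_re (ifun_cmp (eta HV HB TB rB) F) f x.
Proof.
set (RA := kclv HV TA rA). set (RB := kclv HV TB rB).
set (TVA := thVfun HV (K := phi HA) TA). set (TVB := thVfun HV (K := phi HB) TB).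
assert (L : if_re (ifun_cmp (lambda_fun rA rB (theta_fun F)) (eta HV HA TA rA)) f x
  = kcomp (rf RB f (F Y x))
      (kfh TVB f (idm X) (F X (ic_re A f x)) (F Y x)
        ∘ ecomp (if_re F f x) (ic_idV (F X (ic_re A f x))))).
{ change (kcomp (kcomp (rf RB f (F Y x)) (kfh PF f (idm X) _ _ ∘ rt RA f x))
    (kfh PF (idm X) (idm X) _ _ ∘ if_re (eta HV HA TA rA) f x)
   = kcomp (rf RB f (F Y x))
      (kfh TVB f (idm X) (F X (ic_re A f x)) (F Y x)
        ∘ ecomp (if_re F f x) (ic_idV (F X (ic_re A f x))))).
  refine (eq_trans (kcomp_assoc _ _ _) _).
  refine (eq_trans (f_equal (fun u => kcomp _ u)
    (eq_sym (kfh_kcomp PF (rt RA f x) (if_re (eta HV HA TA rA) f x)))) _).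
  refine (f_equal (fun u => kcomp _ u) _).
  (* Here the restriction chosen in [Θ A] drops out. *)
  assert (q : kcomp (rt RA f x) (if_re (eta HV HA TA rA) f x)
    = kfh TVA f (idm X) (ic_re A f x) x ∘ ic_idV (ic_re A f x)).
  { rewrite eta_re.
    assert (q0 : rt RA f x = kfh TVA f (idm X) (ro RA f x) x ∘ rtA HV HA TA rA f x).
    { symmetry. refine (eq_trans (reassoc2 (TV_th HV TA f (idm X) (ro RA f x) x) _) _).
      apply cmp_idl. }
    rewrite q0.
    refine (eq_trans (eq_sym (kfh_kcomp TVA (rtA HV HA TA rA f x)
      (ecomp (rfA HV HA TA rA f x) (ic_idV (ic_re A f x))))) _).
    refine (f_equal (fun q => _ ∘ q) _).
    change (ecomp (rtA HV HA TA rA f x)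
      (ecomp (rfA HV HA TA rA f x) (ic_idV (ic_re A f x))) = ic_idV (ic_re A f x)).
    rewrite <- (ecomp_assoc (icE HA X)), rtrfA. apply (ecomp_idl (icE HA X)). }
  refine (eq_trans (f_equal (fun q => _ ∘ q) q) _).
  refine (eq_trans (eq_sym (cmp_assoc _ _ _)) _).
  refine (eq_trans (f_equal (fun q => q ∘ _) (kfh_theta_thV f (idm X) (ic_re A f x) x)) _).
  refine (eq_trans (cmp_assoc _ _ _) _).
  exact (f_equal (fun q => kfh TVB f (idm X) (F X (ic_re A f x)) (F Y x) ∘ q) (phih_idV f x)). }
rewrite L.
change (kcomp (rf RB f (F Y x))
      (kfh TVB f (idm X) (F X (ic_re A f x)) (F Y x)
        ∘ ecomp (if_re F f x) (ic_idV (F X (ic_re A f x))))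
  = kcomp (if_re (eta HV HB TB rB) f (F Y x)
       : tunit ~> khom (k := gamma HV TB) (idm X) (idm X)
           (ic_re B f (F Y x)) (ro RB f (F Y x)))
     ((kfh TVB (idm X) (idm X) (F X (ic_re A f x)) (ic_re B f (F Y x))
        ∘ etah (F X (ic_re A f x)) (ic_re B f (F Y x))) ∘ if_re F f x)).
rewrite eta_re.
refine (eq_trans _ (eq_sym (f_equal (fun u => kcomp _ u) (eq_trans (cmp_assoc _ _ _)
  (f_equal (fun q => kfh TVB (idm X) (idm X) (F X (ic_re A f x)) (ic_re B f (F Y x)) ∘ q)
     (etah_elt (if_re F f x))))))).
refine (eq_trans _ (kfh_kcomp TVB (ecomp (rfA HV HB TB rB f (F Y x)) (ic_idV (ic_re B f (F Y x)))) _)).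
assert (q0 : rf RB f (F Y x) = kfh TVB (idm X) f (F Y x) (ro RB f (F Y x)) ∘ rfA HV HB TB rB f (F Y x)).
{ symmetry. refine (eq_trans (reassoc2 (TV_th HV TB (idm X) f (F Y x) (ro RB f (F Y x))) _) _).
  apply cmp_idl. }
refine (eq_trans (f_equal (fun u => kcomp u _) q0) _).
refine (eq_trans (eq_sym (kfh_kcomp TVB (rfA HV HB TB rB f (F Y x)) _)) _).
refine (f_equal (fun q => _ ∘ q) _).
change (ecomp (rfA HV HB TB rB f (F Y x)) (ecomp (if_re F f x) (ic_idV (F X (ic_re A f x))))
  = ecomp (ecomp (rfA HV HB TB rB f (F Y x)) (ic_idV (ic_re B f (F Y x))))
    (ecomp (ic_id (ic_re B f (F Y x))) (ecomp (if_re F f x) (ic_idV (F X (ic_re A f x)))))).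
erw (E X) (ic_idV_id HB (ic_re B f (F Y x))). now rewrite (ecomp_idl (E X)).
Qed.

Lemma eta_nat_h (X : S) (x y : A X) :
  efh (ifn (ifun_cmp (lambda_fun rA rB (theta_fun F)) (eta HV HA TA rA)) X) x y
  = efh (ifn (ifun_cmp (eta HV HB TB rB) F) X) x y.
Proof.
change (kfh PF (idm X) (idm X) x y
    ∘ (thV (K := phi HA) (idm X) (idm X) x y ∘ etah x y)
  = (thV (K := phi HB) (idm X) (idm X) (F X x) (F X y)
    ∘ etah (F X x) (F X y)) ∘ efh (F X) x y).
refine (eq_trans (eq_sym (cmp_assoc _ _ _)) _).
refine (eq_trans (f_equal (fun q => q ∘ _) (kfh_theta_thV (idm X) (idm X) x y)) _).
refine (eq_trans (cmp_assoc _ _ _) _).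
refine (eq_trans (f_equal (fun q => _ ∘ q) (phih_etah x y)) _).
symmetry. apply cmp_assoc.
Qed.
End UnitNaturality.

(** Naturality of [ic_id]. It yields 2-naturality of the unit: [Θ] sends a component [u] to
    [ic_app (idm X) u], whereas the unit conjugates it. *)
Lemma etah_app (S : FinProdCat) (V : IMCData S) (HV : is_IMC V)
    (B : ICatData V) (HB : is_ICat B) (X : S) (x y : B X) (u : elt x y) :
  etah x y ∘ u = ic_app (idm X) u.
Proof.
rewrite etah_elt. erw (icE HB X) (eq_sym (ic_app_idm HV HB u)).
rewrite (ic_id_idV HB). apply (ecomp_idr (icE HB X)).
Qed.

(** * The counit *)

Section MkLIFun.
Variables (S : FinProdCat) (V : IMCData S) (HV : is_IMC V).
Variables (A B : LCatData V) (HA : is_LCat A) (HB : is_LCat B).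
Variable P : KFun (gamma HV HA) (gamma HV HB).

(** [kfh] at the universal pair acts between pullbacks along [⟨pr1, pr2⟩], an identity; [pbidE]
    removes them to give a map between the hom-objects themselves. *)
Definition mkli_core (X Y : S) (x : lob A X) (y : lob A Y) :
    lhom x y ~> lhom (kfo P x : lob B X) (kfo P y : lob B Y) :=
  bwd (pbidE (pair_id Y X) _)
  ∘ ((kfh P (pr1 Y X) (pr2 Y X) x y
      : ghom (pr1 Y X) (pr2 Y X) x y
        ~> ghom (pr1 Y X) (pr2 Y X) (kfo P x : lob B X) (kfo P y : lob B Y))
     ∘ fwd (pbidE (pair_id Y X) _)).

Definition mkli : LIFunData A B :=
  {| li_ob := (fun X x => kfo P x) : forall X, lob A X -> lob B X;
     li_hom := fun X Y (x : lob A X) (y : lob A Y) =>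
       fwd (pbidE (pmap_id Y X) _) ∘ mkli_core x y |}.

(** Compatibility with pullback along [⟨b, a⟩] recovers the action of [P] from the universal pair;
    the identity comparisons in [mkli_core] pull back to [gpl] and [gplV]. *)
Lemma gfm_mkli (W X Y : S) (b : W ~> Y) (a : W ~> X) (x : lob A X) (y : lob A Y) :
  gfm mkli b a x y = kfh P b a x y.
Proof.
rewrite (gfm_core HV (F := mkli) (h := mkli_core)) by reflexivity.
unfold mkli_core. rewrite !smor_cmp.
assert (p : ⟨pr1 Y X, pr2 Y X⟩ ∘ ⟨b, a⟩ = ⟨b, a⟩)
  by (rewrite <- pair_id; apply cmp_idl).
assert (e1 : forall (C : LCatData V) (x : lob C X) (y : lob C Y),
  ⟨b, a⟩ ^*₁ fwd (pbidE (pair_id Y X) (lhom x y))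
  = gplV (pr1_pair b a) (pr2_pair b a) x y).
{ intros C x' y'. rewrite <- (pbcmpE_idl HV _ _ p). unfold gplV.
  now rewrite (proof_irrelevance _ (pair_cmp _ _) p). }
assert (e2 : ⟨b, a⟩ ^*₁ bwd (pbidE (pair_id Y X) (lhom (kfo P x : lob B X) (kfo P y : lob B Y)))
  = gpl (pr1_pair b a) (pr2_pair b a) (kfo P x : lob B X) (kfo P y : lob B Y)).
{ apply (cancel_mono (gpl_gplV (pr1_pair b a) (pr2_pair b a) (kfo P x : lob B X) (kfo P y : lob B Y))).
  refine (eq_trans _ (eq_sym (gplV_gpl _ _ _ _))).
  rewrite <- e1. refine (eq_trans (eq_sym (smor_cmp (pb V ⟨b, a⟩) _ _)) _).
  rewrite fwd_bwd. apply smor_id. }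
rewrite e1, e2.
refine (eq_trans (eq_sym (cmp_assoc _ _ _)) _).
refine (eq_trans (f_equal (fun q => q ∘ _)
  (eq_sym (kfh_kpl P (pr1_pair b a) (pr2_pair b a) x y))) _).
refine (eq_trans (cmp_assoc _ _ _) _).
refine (eq_trans (f_equal (fun q => _ ∘ q) (gpl_gplV (pr1_pair b a) (pr2_pair b a) x y)) _).
apply cmp_idr.
Qed.

Lemma mkli_ax : is_LIFun mkli.
Proof.
apply lifun_intro.
- intros X x. rewrite gfm_mkli, <- (gid_idm HV HA).
  exact (kfh_kid P (idm X) x).
- intros X Y Z x y z c b a. rewrite !gfm_mkli. exact (kfh_kcm P c b a x y z).
Qed.
End MkLIFun.

Section Kappa.
Variables (S : FinProdCat) (V : IMCData S) (HV : is_IMC V).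
Variables (K : KSys V) (R : KCleavage K) (HL : is_ICat (lam_cat R)).

Definition kappah (W X Y : S) (b : W ~> Y) (a : W ~> X) (x : kob K X) (y : kob K Y) :
    khom (idm W) (idm W) (ro R a x) (ro R b y) ~> khom b a x y :=
  kpost a (rt R b y) ∘ kpre (idm W) (rf R a x).

Definition kappaVh (W X Y : S) (b : W ~> Y) (a : W ~> X) (x : kob K X) (y : kob K Y) :
    khom b a x y ~> khom (idm W) (idm W) (ro R a x) (ro R b y) :=
  kpost (idm W) (rf R b y) ∘ kpre b (rt R a x).

Lemma kappah_V (W X Y : S) (b : W ~> Y) (a : W ~> X) (x : kob K X) (y : kob K Y) :
  kappah b a x y ∘ kappaVh b a x y = idm _.
Proof.
unfold kappah, kappaVh. knorm.
now rewrite !rt_rf, kpost_id, kpre_id, id_cmp.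
Qed.

Lemma kappaVh_h (W X Y : S) (b : W ~> Y) (a : W ~> X) (x : kob K X) (y : kob K Y) :
  kappaVh b a x y ∘ kappah b a x y = idm _.
Proof.
unfold kappah, kappaVh. knorm.
now rewrite !rf_rt, kpost_id, kpre_id, id_cmp.
Qed.

Lemma kappah_kid (W X : S) (a : W ~> X) (x : kob K X) :
  kappah a a x x ∘ ci R (ro R a x) = kid a x.
Proof.
unfold kappah. ra. rewrite ciE, <- kcomp_pre, kcomp_idl. apply rt_rf.
Qed.

Lemma kappah_kcm (W X Y Z : S) (c : W ~> Z) (b : W ~> Y) (a : W ~> X)
    (x : kob K X) (y : kob K Y) (z : kob K Z) :
  kappah c a x z ∘ kcm (idm W) (idm W) (idm W) (ro R a x) (ro R b y) (ro R c z)
  = kcm c b a x y z ∘ (kappah c b y z ⊗₁ kappah b a x y).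
Proof. apply kcm_conj, rf_rt. Qed.

Lemma lam_cmpVE (X Y Z : S) (f : X ~> Y) (g : Y ~> Z) (h : X ~> Z)
    (e : g ∘ f = h) (x : kob K Z) :
  ic_cmpVE (A := lam_cat R) e x
  = kcomp (rf R h x)
         (kcomp (kapp e (cmp_idl f) (rt R g x)) (rt R f (ro R g x))).
Proof. now destruct e. Qed.

(** In [lam_cat R], [ipl] is pullback conjugated by restrictions along [t], [b'], [a'] and by
    pulled-back restrictions along [b], [a]. All cancel in pairs except the pulled-back ones, which
    form the pullback of [kappah]. *)
Lemma kappah_kpl (W' W X Y : S) (t : W' ~> W) (b : W ~> Y) (a : W ~> X)
    (b' : W' ~> Y) (a' : W' ~> X) (eb : b ∘ t = b') (ea : a ∘ t = a')
    (x : kob K X) (y : kob K Y) :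
  kappah b' a' x y ∘ ipl (A := lam_cat R) eb ea x y
  = kpl eb ea x y ∘ t ^*₁ kappah b a x y.
Proof.
transitivity (kappah b' a' x y ∘ (kpost (idm W')
     (kcomp (rf R b' y) (kcomp (kapp eb (cmp_idl t) (rt R b y)) (rt R t (ro R b y))))
  ∘ kpre (idm W')
     (kcomp (rf R t (ro R a x)) (kcomp (kapp (cmp_idl t) ea (rf R a x)) (rt R a' x)))
  ∘ (kpost (idm W') (rf R t (ro R b y)) ∘ kpre t (rt R t (ro R a x))
     ∘ kpl (cmp_idl t) (cmp_idl t) (ro R a x) (ro R b y)))).
{ rewrite <- lam_cmpVE, <- lam_cmpE, <- (cpE R). reflexivity. }
unfold kappah. rewrite smor_cmp. ra.
rw (kpl_post eb (cmp_idl t) ea (rt R b y)).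
rw (kpl_pre (cmp_idl t) (cmp_idl t) ea (rf R a x)).
knorm. krw (rt_rf R b' y). rewrite kcomp_idl, rt_rf, kcomp_idr.
krw (rt_rf R t (ro R a x)). rewrite kcomp_idl, rt_rf, kcomp_idr. reflexivity.
Qed.

Definition kappa : KFun (phi HL) K :=
  {| kfo := (fun X x => x) : forall X, kob (phi HL) X -> kob K X;
     kfh := kappah : forall W X Y b a (x : kob (phi HL) X) (y : kob (phi HL) Y),
       khom b a x y ~> khom b a (x : kob K X) (y : kob K Y);
     kfh_kid := kappah_kid; kfh_kcm := kappah_kcm; kfh_kpl := kappah_kpl |}.

Lemma kappaVh_kid (W X : S) (a : W ~> X) (x : kob K X) :
  kappaVh a a x x ∘ kid a x = ci R (ro R a x).
Proof.
apply (cancel_mono (kappaVh_h a a x x)). rewrite kappah_kid.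
rw (kappah_V _ _ _ _). apply cmp_idl.
Qed.

Lemma kappaVh_kcm (W X Y Z : S) (c : W ~> Z) (b : W ~> Y) (a : W ~> X)
    (x : kob K X) (y : kob K Y) (z : kob K Z) :
  kappaVh c a x z ∘ kcm c b a x y z
  = kcm (idm W) (idm W) (idm W) (ro R a x) (ro R b y) (ro R c z)
    ∘ (kappaVh c b y z ⊗₁ kappaVh b a x y).
Proof. apply kcm_conj, rt_rf. Qed.

Lemma kappaVh_kpl (W' W X Y : S) (t : W' ~> W) (b : W ~> Y) (a : W ~> X)
    (b' : W' ~> Y) (a' : W' ~> X) (eb : b ∘ t = b') (ea : a ∘ t = a')
    (x : kob K X) (y : kob K Y) :
  kappaVh b' a' x y ∘ kpl eb ea x y
  = ipl (A := lam_cat R) eb ea x y ∘ t ^*₁ kappaVh b a x y.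
Proof.
apply (cancel_mono (kappaVh_h b' a' x y)).
rewrite <- !cmp_assoc, kappah_V, id_cmp.
refine (eq_sym (eq_trans (f_equal (fun q => q ∘ _) (kappah_kpl eb ea x y)) _)).
refine (eq_trans (cmp_assoc _ _ _) _).
rewrite <- smor_cmp, kappah_V, smor_id. apply cmp_idr.
Qed.

Definition kappaV : KFun K (phi HL) :=
  {| kfo := (fun X x => x) : forall X, kob K X -> kob (phi HL) X;
     kfh := kappaVh : forall W X Y b a (x : kob K X) (y : kob K Y),
       khom b a x y ~> khom (k := phi HL) b a (x : kob (phi HL) X) (y : kob (phi HL) Y);
     kfh_kid := kappaVh_kid; kfh_kcm := kappaVh_kcm; kfh_kpl := kappaVh_kpl |}.

(** Reindexing along [1] in [lam_cat R] is conjugation by the restriction along [1], which [kappah]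
    undoes; this gives 2-naturality of the counit. *)
Lemma kappa_app (X : S) (x y : kob K X) (u : tunit ~> khom (idm X) (idm X) x y) :
  kappah (idm X) (idm X) x y ∘ ic_app (A := lam_cat R) (x := x) (y := y) (idm X) u = u.
Proof.
rewrite (lam_app R). rewrite (kapp_idm HV). unfold kappah. ra.
rewrite <- kcomp_pre. change (kcomp (rt R (idm X) y)
  (kcomp (kcomp (rf R (idm X) y) (kcomp u (rt R (idm X) x))) (rf R (idm X) x)) = u).
krw (rt_rf R (idm X) y). rewrite kcomp_idl, rt_rf. apply kcomp_idr.
Qed.
End Kappa.

(** [thfun] and [thVfun], with [lsys (phi HA)] displayed as [theta_cat A];
    with [A] a variable the conversion is immediate, whereas for concrete [A]
    it is very slow. *)
Section ThetaTh.
Variables (S : FinProdCat) (V : IMCData S) (HV : is_IMC V).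
Variables (A : ICatData V) (HA : is_ICat A) (HT : is_LCat (theta_cat A)).

Definition theta_th : KFun (gamma HV HT) (phi HA) := thfun HV (K := phi HA) HT.
Definition theta_thV : KFun (phi HA) (gamma HV HT) := thVfun HV (K := phi HA) HT.

Lemma theta_th_thV (W X Y : S) (b : W ~> Y) (a : W ~> X)
    (x : kob (phi HA) X) (y : kob (phi HA) Y) :
  kfh theta_th b a x y ∘ kfh theta_thV b a x y = idm _.
Proof. exact (th_thV (K := phi HA) b a x y). Qed.

Lemma theta_thV_th (W X Y : S) (b : W ~> Y) (a : W ~> X)
    (x : kob (phi HA) X) (y : kob (phi HA) Y) :
  kfh theta_thV b a x y ∘ kfh theta_th b a x y = idm _.
Proof. exact (thV_th (K := phi HA) b a x y). Qed.
End ThetaTh.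

Lemma gfm_theta_th (S : FinProdCat) (V : IMCData S) (HV : is_IMC V)
    (A B : ICatData V) (HA : is_ICat A) (HB : is_ICat B)
    (TA : is_LCat (theta_cat A)) (TB : is_LCat (theta_cat B))
    (F : IFunData A B) (HF : is_IFun F)
    (W X Y : S) (b : W ~> Y) (a : W ~> X) (x : A X) (y : A Y) :
  gfm (theta_fun F) b a x y
  = kfh (theta_thV HV HB TB) b a (F X x) (F Y y)
    ∘ (phih F b a x y ∘ kfh (theta_th HV HA TA) b a x y).
Proof. exact (gfm_theta HV HA HB HF b a x y). Qed.

Section KappaNat.
Variables (S : FinProdCat) (V : IMCData S) (K L : KSys V).
Variables (R : KCleavage K) (Q : KCleavage L) (P : KFun K L).

(** [phih] of [lam_fun] compares the image under [P] of a restriction with the one chosen in [L];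
    [kappah] removes the latter, and the image of [kappah] under [P] remains. *)
Lemma kappah_nat (W X Y : S) (b : W ~> Y) (a : W ~> X) (x : kob K X) (y : kob K Y) :
  kappah Q b a (kfo P x) (kfo P y) ∘ phih (lam_fun R Q P) b a x y
  = kfh P b a x y ∘ kappah R b a x y.
Proof.
transitivity (kappah Q b a (kfo P x) (kfo P y)
  ∘ (kpost (idm W) (kcomp (rf Q b (kfo P y)) (kfh P b (idm W) _ _ ∘ rt R b y))
     ∘ kpre (idm W) (kcomp (kfh P (idm W) a _ _ ∘ rf R a x) (rt Q a (kfo P x)))
     ∘ kfh P (idm W) (idm W) (ro R a x) (ro R b y))).
{ reflexivity. }
unfold kappah. ra. rw (kfh_post P _). rw (kfh_pre P _). knorm.
krw (rt_rf Q b _). rewrite kcomp_idl, rt_rf, kcomp_idr. reflexivity.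
Qed.
End KappaNat.

Section Counit.
Variables (S : FinProdCat) (V : IMCData S) (HV : is_IMC V).
Variables (B : LCatData V) (HB : is_LCat B) (R : KCleavage (gamma HV HB)).
Variables (HL : is_ICat (lam_cat R)) (HT : is_LCat (theta_cat (lam_cat R))).

Definition epsK : KFun (gamma HV HT) (gamma HV HB) :=
  kfun_cmp (kappa HL) (theta_th HV HL HT).

Definition epsVK : KFun (gamma HV HB) (gamma HV HT) :=
  kfun_cmp (theta_thV HV HL HT) (kappaV HL).

Definition eps : LIFunData (theta_cat (lam_cat R)) B := mkli epsK.
Definition epsV : LIFunData B (theta_cat (lam_cat R)) := mkli epsVK.

Lemma eps_ax : is_LIFun eps.
Proof. exact (mkli_ax epsK). Qed.

Lemma epsV_ax : is_LIFun epsV.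
Proof. exact (mkli_ax epsVK). Qed.

Lemma eps_epsV (W X Y : S) (b : W ~> Y) (a : W ~> X) (x : lob B X) (y : lob B Y) :
  gfm eps b a x y ∘ gfm epsV b a x y = idm _.
Proof.
refine (eq_trans (f_equal2 (fun p q => p ∘ q) (gfm_mkli epsK b a x y)
  (gfm_mkli epsVK b a x y)) _).
refine (eq_trans (cancel_mid3 (kfh (kappa HL) b a x y) _ (theta_th_thV HV (HA := HL) HT b a x y)) _).
exact (kappah_V R b a x y).
Qed.

Lemma epsV_eps (W X Y : S) (b : W ~> Y) (a : W ~> X) (x : lob B X) (y : lob B Y) :
  gfm epsV b a x y ∘ gfm eps b a x y = idm _.
Proof.
refine (eq_trans (f_equal2 (fun p q => p ∘ q) (gfm_mkli epsVK b a x y)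
  (gfm_mkli epsK b a x y)) _).
refine (eq_trans (cancel_mid3 (kfh (theta_thV HV HL HT) b a x y) _ (kappaVh_h R b a x y)) _).
exact (theta_thV_th HV (HA := HL) HT b a x y).
Qed.

Lemma gfm_eps_thV (W X Y : S) (b : W ~> Y) (a : W ~> X) (x : lob B X) (y : lob B Y) :
  gfm eps b a x y ∘ kfh (theta_thV HV HL HT) b a x y = kappah R b a x y.
Proof.
refine (eq_trans (f_equal (fun p => p ∘ _) (gfm_mkli epsK b a x y)) _).
refine (eq_trans (cmp_assoc _ _ _) _).
refine (eq_trans (f_equal (fun p => _ ∘ p) (theta_th_thV HV (HA := HL) HT b a x y)) _).
apply cmp_idr.
Qed.

Lemma epsV_eps_id : lifun_cmp epsV eps = lifun_id (theta_cat (lam_cat R)).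
Proof.
apply (lifun_ext HV (F := lifun_cmp epsV eps)
  (G := lifun_id (theta_cat (lam_cat R))) (e := eq_refl)).
intros X Y x y.
rewrite (gfm_lifun_cmp HV). refine (eq_trans (epsV_eps _ _ x y) _).
symmetry. exact (gfm_lifun_id HV (A := theta_cat (lam_cat R)) _ _ x y).
Qed.

Lemma eps_epsV_id : lifun_cmp eps epsV = lifun_id B.
Proof.
apply (lifun_ext HV (F := lifun_cmp eps epsV) (G := lifun_id B) (e := eq_refl)).
intros X Y x y.
rewrite (gfm_lifun_cmp HV). refine (eq_trans (eps_epsV _ _ x y) _).
symmetry. apply (gfm_lifun_id HV).
Qed.

Lemma eps_elt (X : S) (x y : lob B X) (u : tunit ~> ghom (idm X) (idm X) x y) :
  gfm eps (idm X) (idm X) x y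
    ∘ (th_from (A := lam_cat R) (idm X) (idm X) x y
       ∘ ic_app (A := lam_cat R) (x := x) (y := y) (idm X) u) = u.
Proof.
refine (eq_trans (eq_sym (cmp_assoc _ _ _)) _).
refine (eq_trans (f_equal (fun q => q ∘ _) (gfm_eps_thV (idm X) (idm X) x y)) _).
exact (kappa_app HV R u).
Qed.
End Counit.

Section CounitNat.
Variables (S : FinProdCat) (V : IMCData S) (HV : is_IMC V).
Variables (A B : LCatData V) (HA : is_LCat A) (HB : is_LCat B).
Variables (RA : KCleavage (gamma HV HA)) (RB : KCleavage (gamma HV HB)).
Variables (LA : is_ICat (lam_cat RA)) (LB : is_ICat (lam_cat RB)).
Variables (TA : is_LCat (theta_cat (lam_cat RA))).
Variables (TB : is_LCat (theta_cat (lam_cat RB))).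
Variables (F : LIFunData A B) (HF : is_LIFun F).

Lemma eps_nat (W X Y : S) (b : W ~> Y) (a : W ~> X) (x : lob A X) (y : lob A Y) :
  gfm F b a x y ∘ gfm (eps LA TA) b a x y
  = gfm (eps LB TB) b a (li_ob F x) (li_ob F y)
    ∘ gfm (theta_fun (lam_fun RA RB (gfun HV HA HB HF))) b a x y.
Proof.
assert (q1 : gfm (eps LA TA) b a x y = kappah RA b a x y ∘ kfh (theta_th HV LA TA) b a x y)
 by exact (gfm_mkli (epsK LA TA) b a x y).
exact (paste_square q1 (gfm_eps_thV LB TB b a (li_ob F x) (li_ob F y))
  (gfm_theta_th HV LA LB TA TB (lam_fun_ax RA RB (gfun HV HA HB HF)) b a x y)
  (kappah_nat RA RB (gfun HV HA HB HF) b a x y)).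
Qed.

Lemma eps_nat_data :
  lifun_cmp F (eps LA TA)
  = lifun_cmp (eps LB TB) (theta_fun (lam_fun RA RB (gfun HV HA HB HF))).
Proof.
apply (lifun_ext HV (F := lifun_cmp F (eps LA TA))
  (G := lifun_cmp (eps LB TB) (theta_fun (lam_fun RA RB (gfun HV HA HB HF))))
  (e := eq_refl)).
intros X Y x y.
refine (eq_trans (gfm_lifun_cmp HV F (eps LA TA) _ _ x y) _).
refine (eq_trans (eps_nat (pr1 Y X) (pr2 Y X) x y) _).
symmetry. exact (gfm_lifun_cmp HV (eps LB TB)
  (theta_fun (lam_fun RA RB (gfun HV HA HB HF))) (pr1 Y X) (pr2 Y X) x y).
Qed.
End CounitNat.

(** * The 2-equivalence *)

Section Equivalence.
Variables (S : FinProdCat) (V : IMCData S) (HV : is_IMC V).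
Variable r : forall B : VFib V, Cleavage B.
Arguments r : clear implicits.
Variables (wi : VCATidx_wf V) (wf : VFIB_wf V) (wT : Theta_wf V) (wL : Lambda_wf r).

Let Th := Theta wi wf wT.
Let La := Lambda wi wf wL.

Definition etaF (A : ICat V) : IFun A (La (Th A)) :=
  {| ifun_ax := eta_ax HV (icat_ax A) (vlcat (Th A)) (r (Th A)) |}.

Definition zetaF (A : ICat V) : IFun (La (Th A)) A :=
  {| ifun_ax := zeta_ax HV (icat_ax A) (vlcat (Th A)) (r (Th A)) |}.

Lemma zeta_eta (A : ICat V) :
  cmp1 (t := VCATidx wi) (zetaF A) (etaF A) = id1 (t := VCATidx wi) A.
Proof.
ifun_ext.
- intros X x y.
  refine (eq_trans (cancel_mid3 (zetah x y) _ (th_thV (K := phi (icat_ax A)) (idm X) (idm X) x y)) _).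
  apply (zetah_etah (icat_ax A)).
- intros X Y f x. exact (zeta_eta_re HV (icat_ax A) (vlcat (Th A)) (r (Th A)) f x).
Qed.

Lemma eta_zeta (A : ICat V) :
  cmp1 (t := VCATidx wi) (etaF A) (zetaF A) = id1 (t := VCATidx wi) (La (Th A)).
Proof.
ifun_ext.
- intros X x y.
  refine (eq_trans (cancel_mid3 (thV (K := phi (icat_ax A)) (idm X) (idm X) x y) _
     (etah_zetah (icat_ax A) x y)) _).
  exact (thV_th (K := phi (icat_ax A)) (idm X) (idm X) x y).
- intros X Y f x. exact (eta_zeta_re HV (icat_ax A) (vlcat (Th A)) (r (Th A)) f x).
Qed.

Lemma eta_nat1 (A B : ICat V) (F : IFun A B) :
  cmp1 (t := VCATidx wi) (fun1 La (fun1 Th F)) (etaF A)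
  = cmp1 (t := VCATidx wi) (etaF B) F.
Proof.
ifun_ext.
- intros X x y. exact (eta_nat_h HV (icat_ax A) (icat_ax B) (vlcat (Th A))
    (vlcat (Th B)) (r (Th A)) (r (Th B)) (ifun_ax F) x y).
- intros X Y f x. exact (eta_nat_re HV (icat_ax A) (icat_ax B) (vlcat (Th A))
    (vlcat (Th B)) (r (Th A)) (r (Th B)) (ifun_ax F) f x).
Qed.

Definition unit_iso : TwoNatIso (twofun_id (VCATidx wi)) (twofun_cmp La Th).
Proof.
refine (@Build_TwoNatIso (VCATidx wi) (VCATidx wi) (twofun_id (VCATidx wi))
  (twofun_cmp La Th) etaF zetaF zeta_eta eta_zeta eta_nat1 _).
intros A B F G s. icell_ext; [apply eta_nat1.. | intros X x].
set (TB := thVfun HV (K := phi (icat_ax B)) (vlcat (Th B))).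
(* Whiskering with the unit contributes an identity on each side; once these are removed, the square
   is [etah_app]. *)
change (ecomp (C := lambda_fib (theta_cat B) X)
    (kfh TB (idm X) (idm X) (F X x) (G X x) ∘ ic_app (idm X) (inat_data s x))
    (eapp (ifn (fun1 La (fun1 Th F)) X) (eid (e := lambda_fib (theta_cat A) X) x))
  = ecomp (C := lambda_fib (theta_cat B) X) (eid (e := lambda_fib (theta_cat B) X) (G X x))
     ((kfh TB (idm X) (idm X) (F X x) (G X x) ∘ etah (F X x) (G X x)) ∘ inat_data s x)).
assert (E := icE (icat_ax (La (Th B))) X).
refine (eq_trans (f_equal (fun u => ecomp _ u)
  (eapp_id (if_efun (ifun_ax (fun1 La (fun1 Th F))) X) x)) _).
refine (eq_trans (ecomp_idr E _) _).
refine (eq_trans _ (eq_sym (ecomp_idl E _))).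
refine (eq_trans _ (eq_sym (cmp_assoc _ _ _))).
exact (f_equal (fun u => kfh TB (idm X) (idm X) (F X x) (G X x) ∘ u)
  (eq_sym (etah_app HV (icat_ax B) (inat_data s x)))).
Qed.

Definition clv (B : VFib V) : KCleavage (gamma HV (vlcat B)) :=
  kclv HV (vlcat B) (r B).

(** [lax] and [tax] retype the axioms stored in [La B] and [Th (La B)] over [lam_cat], so that [eps]
    can be read as a 1-cell out of [Th (La B)]. *)
Definition lax (B : VFib V) : is_ICat (lam_cat (clv B)) := icat_ax (La B).

Definition tax (B : VFib V) : is_LCat (theta_cat (lam_cat (clv B))) :=
  vlcat (Th (La B)).

Lemma lifun_beq (A B : LCatData V) (F G : LIFun A B) :
  lifun_data F = lifun_data G -> F = G.
Proof.
destruct F, G. cbn. intros e. destruct e. f_equal. apply proof_irrelevance.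
Qed.

Definition epsF (B : VFib V) : LIFun (Th (La B)) B :=
  {| lifun_ax := eps_ax (lax B) (tax B) |}.

Definition epsVF (B : VFib V) : LIFun B (Th (La B)) :=
  {| lifun_ax := epsV_ax (lax B) (tax B) |}.

Lemma epsVF_epsF (B : VFib V) :
  cmp1 (t := VFIB wf) (epsVF B) (epsF B) = id1 (t := VFIB wf) (Th (La B)).
Proof. apply lifun_beq. exact (epsV_eps_id (lax B) (tax B)). Qed.

Lemma epsF_epsVF (B : VFib V) :
  cmp1 (t := VFIB wf) (epsF B) (epsVF B) = id1 (t := VFIB wf) B.
Proof. apply lifun_beq. exact (eps_epsV_id (lax B) (tax B)). Qed.

Lemma eps_nat1 (A B : VFib V) (F : LIFun A B) :
  cmp1 (t := VFIB wf) F (epsF A)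
  = cmp1 (t := VFIB wf) (epsF B) (fun1 Th (fun1 La F)).
Proof. apply lifun_beq. exact (eps_nat_data (lax A) (lax B) (tax A) (tax B) (lifun_ax F)). Qed.

Definition counit_iso : TwoNatIso (twofun_cmp Th La) (twofun_id (VFIB wf)).
Proof.
refine (@Build_TwoNatIso (VFIB wf) (VFIB wf) (twofun_cmp Th La)
  (twofun_id (VFIB wf)) epsF epsVF epsVF_epsF epsF_epsVF eps_nat1 _).
intros A B F G s. lcell_ext; [apply eps_nat1.. | intros X x].
change (lob (vfib_data A) X) in x.
(* Again only identities arise from the whiskering; without them the square is [eps_elt]. *)
change (gcomp (B := B) (lnat_data s x)
    (gfm F (idm X) (idm X) x x ∘ lc_id x)
  = gcomp (B := B) (lc_id (li_ob G x))
      (gfm (eps (lax B) (tax B)) (idm X) (idm X) (li_ob F x) (li_ob G x)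
       ∘ (th_from (A := lam_cat (clv B)) (idm X) (idm X) (li_ob F x) (li_ob G x)
          ∘ ic_app (A := lam_cat (clv B)) (x := li_ob F x) (y := li_ob G x)
              (idm X) (lnat_data s x)))).
refine (eq_trans (f_equal (fun u => gcomp _ u) (_ : _ = gid (idm X) (li_ob F x))) _).
{ rewrite <- (gid_idm HV (vlcat A)). exact (gfm_gid HV (vlcat A) (lifun_ax F) (idm X) x). }
refine (eq_trans (kcomp_idr (K := gamma HV (vlcat B)) (lnat_data s x)) _).
symmetry.
refine (eq_trans (f_equal (fun u => gcomp u _) (eq_sym (gid_idm HV (vlcat B) _))) _).
refine (eq_trans (kcomp_idl (K := gamma HV (vlcat B)) _) _).
exact (eps_elt (lax B) (tax B) (lnat_data s x)).
Qed.
End Equivalence.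

Theorem theorem6p7 (S : FinProdCat) (V : IndexedMonCat S)
    (r : forall B : VFib V, Cleavage B) :
  exists (wi : VCATidx_wf V) (wf : VFIB_wf V)
         (wT : Theta_wf V) (wL : Lambda_wf r),
    is_2category (VCATidx wi) /\
    is_2category (VFIB wf) /\
    is_2functor (Theta wi wf wT) /\
    is_2functor (Lambda wi wf wL) /\
    inverse_2equivalences (Theta wi wf wT) (Lambda wi wf wL).
Proof.
assert (HV := imc_ax V).
exists (VCATidx_wf_ok V), (VFIB_wf_ok HV), (Theta_wf_ok HV), (Lambda_wf_ok HV r).
split; [apply VCATidx_2cat|]. split; [apply (VFIB_2cat HV)|].
split; [apply (Theta_2functor HV)|]. split; [apply (Lambda_2functor HV)|].
split; constructor; [apply (unit_iso HV) | apply (counit_iso HV)].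
Qed.
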